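(* Let $G=(V,E)$ be a countably infinite connected graph with finite degrees, let $(G_n)_{n\ge 1}$ be an increasing exhaustion of $G$, and let $p:\mathcal C_\to(G)\to[0,1]$ be a weight function on oriented cycles such that $(G_n)$ and $p$ satisfy the loop assumption (stated in the context). Let $\phi$ be an ordering of $V$, i.e. a bijection $\phi:\mathbb N\to V$. Let $(\mu_n^F)$ and $(\mu_n^W)$ be the sequences of probability measures on cycle-rooted spanning forests of $G_n$ associated with $p$, with free and wired boundary conditions respectively. Then both sequences $(\mu_n^F)$ and $(\mu_n^W)$ converge weakly to $\mu_\phi$, the law of the random configuration $\mathsf F$ produced by the $p$-loop-erased random walk algorithm on $G$ with ordering $\phi$.
   Context: **Cycles and forests.** $\mathcal C_\to(H)$ is the set of oriented simple cycles of a graph $H$, $\mathcal C(H)$ the set of unoriented simple cycles; $\gamma,\gamma^{-1}$ are the two orientations of $[\gamma]\in\mathcal C(H)$. A back-and-forth path $(v,u,v)$ along one edge is not a cycle and is by convention given weight $p=0$. A cycle-rooted spanning forest (CRSF) of $H$ is a subgraph containing all vertices of $H$, each of whose connected components contains exactly one cycle. For a set $W$ of vertices of $H$, an essential CRSF (ECRSF) with respect to $W$ is a spanning subgraph each of whose connected components is either disjoint from $W$ and contains exactly one cycle, or is a tree containing exactly one vertex of $W$. **Exhaustion.** $(G_n)_{n\ge1}$ is an increasing sequence of finite connected induced subgraphs of $G$ with union $G$; $V_n$ is the vertex set of $G_n$; $\partial G_n\subset V_n$ is the set of vertices of $G_n$ having a neighbour in $G$ outside $G_n$. $\mathbb P_v$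 is the law of the simple random walk $(X_k)_{k\ge0}$ on $G$ with $X_0=v$. **Loop assumption.** There exist $\alpha>0$, $\beta>0$ such that for every $n\ge1$ and every $v\in\partial G_n$ there is an oriented cycle $\gamma_v$ with all its vertices in $V_{n+1}\setminus(V_n\cup\partial G_{n+1})$ such that $p(\gamma_v)\ge\alpha$ and $\mathbb P_v((X_1,\dots,X_{|\gamma_v|})=\gamma_v)>\beta$. Here $\gamma_v$ is written as a closed vertex sequence $(x_1,\dots,x_k)$ with $x_k=x_1$, and $|\gamma_v|=k$. **Finite-volume measures.** $\mu_n^F$ is the probability measure on CRSFs $F$ of $G_n$ with $\mu_n^F(F)\propto\prod_{[\gamma]\in\mathcal C(F)}(p(\gamma)+p(\gamma^{-1}))$. $\mu_n^W$ is the probability measure on ECRSFs $F$ of $G_n$ with respect to $\partial G_n$ with $\mu_n^W(F)\propto\prod_{[\gamma]\in\mathcal C(F)}(p(\gamma)+p(\gamma^{-1}))$. (They are considered for $n$ large enough that the normalizing constant is positive.) **$p$-loop-erased random walk with boundary condition $W\subset V$.** Let $(X_n)_{n\ge0}$ be a simple random walk on $G$ started at $x$ and $(Y_n)$ i.i.d. uniform on $[0,1]$, independent of $(X_n)$. Maintain a current self-avoiding path, initially $(x)$. At time $n+1$, if the current path is $(x_0,\dots,x_l)$ and $X_{n+1}\notin\{x_0,\dots,x_l\}$, append $X_{n+1}$. If $X_{n+1}=x_i$, a loop $\gamma=(x_i,\dots,x_l,x_i)$ is closed at time $n+1$: if $Y_{n+1}\le p(\gamma)$ the loop is kept and the walk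 stops; otherwise the loop is erased and the path becomes $(x_0,\dots,x_i)$. The rooting time $T_r$ is the first time a loop is kept (when no boundary condition is imposed), $T_W=\min\{k\ge0: X_k\in W\}$, and the ending time is $T_f=\min(T_r,T_W)$. The $p$-loop-erased random walk with boundary condition $W$ is the path at time $T_f$ (together with the kept loop if $T_f=T_r$). **Algorithm and $\mu_\phi$.** Let $(v_i)_{i\ge1}$ be the enumeration of $V$ given by $\phi$. Take independent families $(X^{(x)}_n)_n$, $(Y^{(x)}_n)_n$, $x\in V$, where for each $x\in V$, $(X^{(x)}_n)_n$ is a simple random walk on $G$ started at $x$ and $(Y^{(x)}_n)_n$ is a sequence of i.i.d. random variables uniform on $[0,1]$. Put $\mathsf F_0=\emptyset$ and $\mathsf F_i=\mathsf F_{i-1}\cup L(v_i)$, where $L(v_i)$ is the $p$-loop-erased random walk started at $v_i$ built from $(X^{(v_i)},Y^{(v_i)})$ with boundary condition $V(\mathsf F_{i-1})$ (vertices of $\mathsf F_{i-1}$). Then $\mathsf F=\bigcup_i\mathsf F_i$, and $\mu_\phi$ is the law of $\mathsf F$. **Weak convergence.** Subgraphs of $G$ are identified with elements of $\Omega=\{0,1\}^E$ (subgraphs of $G_n$ being extended by $0$), with product topology and cylinder $\sigma$-field. $\nu_n\to\nu$ weakly means $\int f\,d\nu_n\to\int f\,d\nu$ for every local $f$, i.e. every $f$ depending on finitely many edges. *)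

(* Defs.v *)
From HB Require Import structures.
From mathcomp Require Import all_boot all_order all_algebra finmap.
From mathcomp Require Import all_classical all_reals all_analysis.

Set Implicit Arguments.
Unset Strict Implicit.
Unset Printing Implicit Defensive.

Import Order.TTheory GRing.Theory Num.Theory.
Import numFieldNormedType.Exports.

Local Open Scope classical_set_scope.
Local Open Scope ring_scope.

(* A graph is a symmetric irreflexive relation [e] on its vertex type, an edge
   is a two-element finite set of vertices, and a finite subgraph with a given
   vertex set is a finite set of edges.  Every sequence indexed in the
   mathematics by n >= 1 is indexed here by [nat], index n standing for n + 1. *)

Section Graphs.
Variable V : countType.
Implicit Types (r e : rel V) (U W : {fset V}) (F C : {fset {fset V}}).
Implicit Types (s c : seq V).

Definition linked r (x y : V) : Prop := exists2 s, path r x s & y = last x s.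

Definition connected_on (A : set V) r : Prop :=
  A !=set0 /\ forall x y, A x -> A y -> linked r x y.

Definition locally_finite e : Prop :=
  forall x, finite_set [set y | e x y].

Definition degree e (x : V) : nat := #|` fset_set [set y | e x y]|.

Definition edge_set e : set {fset V} :=
  [set a | exists x y, e x y /\ a = [fset x; y]%fset].

Definition induced e U : rel V := fun x y => [&& x \in U, y \in U & e x y].

Definition induced_edges e U : {fset {fset V}} :=
  [fset a in fpowerset U | a \in edge_set e]%fset.

Definition boundary e U : {fset V} :=
  [fset v in U | `[< exists y, e v y /\ y \notin U >]]%fset.

(* [c] lists the vertices x_1, ..., x_m of the closed path
   (x_1, ..., x_m, x_1), without repeating x_1 at the end.  An oriented cycle
   is such a list up to rotation, and [rev c] has the opposite orientation. *)
Definition simple_cycle r c : bool := [&& (2 < size c)%N, uniq c & cycle r c].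

Definition path_edges s : {fset {fset V}} :=
  [fset [fset xy.1; xy.2] | xy in zip s (behead s)]%fset.

(* A simple cycle, up to rotation and reversal, is determined by its edges, so
   the edge set [cycle_edges c] stands for the unoriented cycle of [c]. *)
Definition cycle_edges c : {fset {fset V}} :=
  [fset [fset x; next c x] | x in c]%fset.

Definition subgraph_adj F : rel V := fun x y => [fset x; y]%fset \in F.

Definition cycles F : {fset {fset {fset V}}} :=
  [fset C in fpowerset F | `[< exists2 c,
     simple_cycle (subgraph_adj F) c & cycle_edges c = C >]]%fset.

Definition component U F (x : V) : set V :=
  [set y | y \in U /\ linked (subgraph_adj F) x y].

Definition cycles_in F (K : set V) : set {fset {fset V}} :=
  [set C | C \in cycles F /\ forall a, a \in C -> [set` a] `<=` K].

Definition unicyclic F (K : set V) : Prop := exists! C, cycles_in F K C.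

(* Used for connected components only, hence a tree as soon as acyclic. *)
Definition acyclic F (K : set V) : Prop := cycles_in F K = set0.

Definition is_CRSF U F : Prop :=
  forall x, x \in U -> unicyclic F (component U F x).

Definition is_ECRSF U W F : Prop :=
  forall x, x \in U -> let K := component U F x in
    (K `&` [set` W] = set0 /\ unicyclic F K) \/
    (acyclic F K /\ exists! w, (K `&` [set` W]) w).

Definition CRSFs e U : {fset {fset {fset V}}} :=
  [fset F in fpowerset (induced_edges e U) | `[< is_CRSF U F >]]%fset.

Definition ECRSFs e U W : {fset {fset {fset V}}} :=
  [fset F in fpowerset (induced_edges e U) | `[< is_ECRSF U W F >]]%fset.

Record infinite_graph e : Prop := InfiniteGraph {
  graph_sym : symmetric e;
  graph_irr : irreflexive e;
  graph_inf : infinite_set [set: V];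
  graph_conn : connected_on setT e;
  graph_lfin : locally_finite e }.

Record exhaustion e (G : nat -> {fset V}) : Prop := Exhaustion {
  exh_conn : forall n, connected_on [set` G n] (induced e (G n));
  exh_incr : forall n, (G n `<=` G n.+1)%fset;
  exh_union : \bigcup_n [set` G n] = setT }.

End Graphs.

Section Configurations.
Variables (V : countType) (e : rel V).

Definition cylinders : set (set (edge_set e -> bool)) :=
  [set A | exists a b, A = [set w | w a = b]].

Definition Omega := g_sigma_algebraType cylinders.

Definition config (F : set {fset V}) : Omega := fun a => `[< F (val a) >].

Definition is_local (R : Type) (f : Omega -> R) : Prop :=
  exists D : {fset edge_set e},
    forall w w' : Omega, (forall a, a \in D -> w a = w' a) -> f w = f w'.

Definition converges_weakly (R : realType) (mu : nat -> set Omega -> \bar R)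
    (nu : set Omega -> \bar R) : Prop :=
  forall f : Omega -> R, is_local f ->
    (fun n => (\int[mu n]_w (f w)%:E)%E) @ \oo --> (\int[nu]_w (f w)%:E)%E.

End Configurations.

(* A [0,1]-valued function on oriented cycles of the graph: only the values on
   lists [c] with [simple_cycle e c] matter, and these are invariant under a
   change of the base point. *)
Record cycle_weight (R : realType) (V : countType) (e : rel V) := CycleWeight {
  weight :> seq V -> R;
  weight_ge0 : forall c, simple_cycle e c -> 0 <= weight c;
  weight_le1 : forall c, simple_cycle e c -> weight c <= 1;
  weight_rot : forall c k, simple_cycle e c -> weight (rot k c) = weight c }.

Section FiniteVolume.
Variables (R : realType) (V : countType) (e : rel V) (p : cycle_weight R e).

(* The weight of a closed path, 0 for a back-and-forth path [:: v; u]. *)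
Definition loop_weight (c : seq V) : R := if simple_cycle e c then p c else 0.

(* p(c) + p(c^-1); the choice of [c] among the lists representing the
   unoriented cycle [C] is immaterial by rotation invariance. *)
Definition unoriented_weight (C : {fset {fset V}}) : R :=
  let c := xget [::] [set c | simple_cycle e c /\ cycle_edges c = C] in
  loop_weight c + loop_weight (rev c).

Definition forest_weight (F : {fset {fset V}}) : R :=
  \prod_(C <- cycles F) unoriented_weight C.

Lemma loop_weight_ge0 c : 0 <= loop_weight c.
Proof. by rewrite /loop_weight; case: ifPn => // /weight_ge0. Qed.

Lemma forest_weight_ge0 F : 0 <= forest_weight F.
Proof. by apply: prodr_ge0 => C _; rewrite addr_ge0 ?loop_weight_ge0. Qed.

(* The probability measure on the finite set [S] of subgraphs proportional to
   [forest_weight], carried to [Omega].  When the normalizing constant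
   vanishes, [mnormalize] returns its last argument, which is arbitrary. *)
Definition forest_measure (S : {fset {fset {fset V}}}) :
    set (Omega e) -> \bar R :=
  @mnormalize _ (Omega e) R
    (msum (fun i => mscale (NngNum (forest_weight_ge0 (nth fset0 S i)))
                           (dirac (config [set` nth fset0 S i])))
          #|` S|)
    (dirac (config set0)).

Definition free_measure (U : {fset V}) : set (Omega e) -> \bar R :=
  forest_measure (CRSFs e U).

Definition wired_measure (U : {fset V}) : set (Omega e) -> \bar R :=
  forest_measure (ECRSFs e U (boundary e U)).

End FiniteVolume.

Section RandomWalk.
Variables (R : realType) (V : countType) (e : rel V).

Definition srw_step (x y : V) : R := if e x y then (degree e x)%:R^-1 else 0.

(* P_v((X_1, ..., X_k) = s), k = size s. *)
Definition srw_cylinder (v : V) (s : seq V) : R :=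
  \prod_(xy <- zip (v :: s) s) srw_step xy.1 xy.2.

Definition loop_assumption (p : cycle_weight R e) (G : nat -> {fset V}) : Prop :=
  exists alpha beta : R, [/\ 0 < alpha, 0 < beta &
    forall n v, v \in boundary e (G n) ->
      exists c, [/\ simple_cycle e c,
        forall x, x \in c ->
          [/\ x \in G n.+1, x \notin G n & x \notin boundary e (G n.+1)],
        alpha <= p c &
        beta < srw_cylinder v (rcons c (head v c))]].

Context (d : measure_display) (T : measurableType d) (P : probability T R).

Record is_srw (v : V) (X : nat -> T -> V) : Prop := IsSrw {
  srw_measurable : forall n y, measurable [set w | X n w = y];
  srw_law : forall x s,
    P [set w | [seq X i w | i <- iota 0 (size s).+1] = x :: s] =
    ((x == v)%:R * srw_cylinder v s)%:E }.

Definition mutually_independent (I : choiceType) (A : I -> set (set T)) : Prop :=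
  forall (J : {fset I}) (B : I -> set T),
    (forall i, i \in J -> A i (B i)) ->
    P (\bigcap_(i in [set` J]) B i) = (\prod_(i <- J) P (B i))%E.

Definition sigma_of (S : Type) (Ms : set (set S)) (Z : T -> S) : set (set T) :=
  [set Z @^-1` B | B in Ms].

Definition process_sigma (S : Type) (Ms : set (set S)) (Z : nat -> T -> S) :
    set (set T) :=
  <<s \bigcup_n sigma_of Ms (Z n) >>.

Record iid_uniform (Y : nat -> {RV P >-> R}) : Prop := IidUniform {
  iid_law : forall n (A : set R), measurable A ->
    distribution P (Y n) A = uniform_prob (@ltr01 R) A;
  iid_indep : mutually_independent (fun n => sigma_of measurable (Y n)) }.

(* All the sequences X^(x) and Y^(x), x in V, are jointly independent;
   [inl x] indexes X^(x) and [inr x] indexes Y^(x). *)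
Record algorithm_input (X : V -> nat -> T -> V)
    (Y : V -> nat -> {RV P >-> R}) : Prop := AlgorithmInput {
  input_walk : forall x, is_srw x (X x);
  input_unif : forall x, iid_uniform (Y x);
  input_indep : mutually_independent (fun i : V + V =>
    match i with
    | inl x => process_sigma setT (X x)
    | inr x => process_sigma measurable (fun n => Y x n : T -> R)
    end) }.

End RandomWalk.

Section LoopErasedWalk.
Variables (R : realType) (V : countType) (e : rel V) (p : cycle_weight R e).
Implicit Types (xs : nat -> V) (ys : nat -> R) (W : {fset V}).

(* The current self-avoiding path, and the kept loop once there is one. *)
Definition lerw_state : Type := seq V * option (seq V).

Definition lerw_step (st : lerw_state) (x : V) (y : R) : lerw_state :=
  let: (s, kept) := st in
  if kept is Some _ then st
  else if x \notin s then (rcons s x, None)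
  else let i := index x s in
    let c := drop i s in
    if y <= loop_weight p c then (s, Some c) else (take i.+1 s, None).

(* The state at time [n] of the walk without boundary condition, frozen from
   the rooting time on. *)
Fixpoint lerw xs ys (n : nat) : lerw_state :=
  if n is m.+1 then lerw_step (lerw xs ys m) (xs n) (ys n)
  else ([:: xs 0%N], None).

Definition ended W xs ys (n : nat) : bool :=
  ((lerw xs ys n).2 != None) || (xs n \in W).

(* The path and kept loop at the ending time min(T_r, T_W).  If the walk never
   ends, the starting point alone is returned. *)
Definition lerw_final W xs ys : lerw_state :=
  match pselect (exists n, ended W xs ys n) with
  | left ex => lerw xs ys (ex_minn ex)
  | right _ => ([:: xs 0%N], None)
  end.

Definition state_vertices (st : lerw_state) : {fset V} := [fset x in st.1]%fset.

Definition state_edges (st : lerw_state) : {fset {fset V}} :=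
  (path_edges st.1 `|` (if st.2 is Some c then cycle_edges c else fset0))%fset.

(* Vertices and edges of F_i. *)
Fixpoint forest_step (phi : nat -> V) (xs : V -> nat -> V) (ys : V -> nat -> R)
    (i : nat) : {fset V} * {fset {fset V}} :=
  if i is j.+1 then
    let F := forest_step phi xs ys j in
    let L := lerw_final F.1 (xs (phi j)) (ys (phi j)) in
    ((F.1 `|` state_vertices L)%fset, (F.2 `|` state_edges L)%fset)
  else (fset0, fset0).

Definition limit_forest (phi : nat -> V) (xs : V -> nat -> V)
    (ys : V -> nat -> R) : Omega e :=
  config (\bigcup_i [set` (forest_step phi xs ys i).2]).

Definition algorithm_law (d : measure_display) (T : measurableType d)
    (P : probability T R) (phi : nat -> V) (X : V -> nat -> T -> V)
    (Y : V -> nat -> {RV P >-> R}) : set (Omega e) -> \bar R :=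
  pushforward P (fun w => limit_forest phi (fun x n => X x n w)
                                           (fun x n => Y x n w)).

End LoopErasedWalk.

(* Main.v *)
(** The probability that the algorithm on the infinite graph produces given
    loop-erased walks, all ended within [m] steps and inside a fixed finite set
    [U], bounds from below the probability of the corresponding event under any
    finite-volume measure on a [G_n] containing [U], with free or wired boundary
    condition.  Since the total mass of these events tends to 1, and since both
    an event and its complement are bounded from below, the finite-volume
    probabilities converge.

    The lower bound is Wilson's algorithm.  A forest with oriented cycles is a
    map [f] sending each vertex to a neighbour (roots are fixed), with weight
    the product of the [q x (f x)] over non-roots and of [p] over the cycles.
    Along the path x_0, x_1, ... followed by [f] from the starting vertex, move a
    pointer whose current vertex [x] has its cycle, if any, discarded from the
    weight: the weighted pairs (map, pointer) then satisfy the balance equation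
    of the expected visits of the loop-erased walk, because the discarded cycle
    [c] is restored with weight [p c] when it is kept and with weight [1 - p c]
    when it is erased.  As the walk killed outside [U] is involved, only an
    inequality is needed, and no recurrence argument.

    The total mass tends to 1 because almost surely every walk keeps a loop: the
    probability [h s] of never keeping one from the current path [s] is harmonic
    for the path-valued chain; the maximum principle carries the bound
    [1 - alpha * beta], which holds on the boundary of [G_n] by the loop
    assumption, to all paths, and [h <= 1 - alpha * beta] everywhere forces
    [h = 0]. *)

From mathcomp Require Import all_boot all_order all_algebra finmap.
From mathcomp Require Import all_classical all_reals all_analysis.
From mathcomp Require Import ring lra.
Require Import Defs.

Set Implicit Arguments.
Unset Strict Implicit.
Unset Printing Implicit Defensive.

Import Order.TTheory GRing.Theory Num.Theory.

Local Open Scope ring_scope.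

(** * Weights of functional graphs *)

(** Maps are used because each one orients the cycles of its forest. The maps with the edges of a
    given forest are obtained by reversing an arbitrary set of its cycles, and summing their weights
    expands the product of the factors [p(c) + p(c^-1)]. A pair with [f (f x) = x] would spoil this
    count, but a back-and-forth loop has weight 0. The other factor, a product of inverse degrees
    over the non-roots, is common to all these maps and cancels in the normalized measure. Free and
    wired conditions are treated together, a CRSF being an ECRSF with respect to the empty set.

    The obstacle is uniformity in [n]. The lower bound is therefore a number computed on the
    infinite graph from [U] and the horizon [m] alone, and it holds once [U] and its neighbours lie
    in [G n], for then [U] avoids the boundary. Steps carry degrees of the infinite graph, so they
    are only sub-stochastic in [G n]; this loss has the favourable sign. A local event is decided
    after finitely many walks, namely once the forest contains all the endpoints involved. *)

Section FunctionalGraph.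
Variables (R : realFieldType) (T : finType) (lw : seq T -> R).
Hypothesis lw_rot : forall c k, lw (rot k c) = lw c.
Implicit Types (f g : T -> T) (C : {set T}).

(* Fixed points stand for the roots of a forest and are not cycles. *)
Definition periodic f x := fconnect f (f x) x && (f x != x).

Definition orbit_set f x : {set T} := [set y in orbit f x].

Definition cycle_sets f : {set {set T}} :=
  [set orbit_set f x | x in [pred x | periodic f x]].

(** The vertex picked is immaterial: the orbits of the vertices of one cycle are rotations of each
    other and [lw] is rotation invariant, as [cycle_setsP] records. *)
Definition cycle_set_weight f C : R :=
  if [pick z in C] is Some z then lw (orbit f z) else 1.

Lemma mem_orbit_set f x : x \in orbit_set f x.
Proof. by rewrite inE in_orbit. Qed.

Lemma orbit_set_cycle f x : periodic f x -> orbit_set f x \in cycle_sets f.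
Proof. by move=> px; apply/imsetP; exists x. Qed.

Lemma orbit_set_rot f x z : periodic f x -> z \in orbit_set f x ->
  [/\ periodic f z, orbit_set f z = orbit_set f x &
    exists k, orbit f z = rot k (orbit f x)].
Proof.
move=> /andP[px fx]; rewrite inE => zx.
have cx : fcycle f (orbit f x) by rewrite -fconnect_f.
have [k ek] : {k | orbit f z = rot k (orbit f x)}.
  exact: (orbit_rot_cycle cx (orbit_uniq _ _) zx).
split; last by exists k.
- apply/andP; split; first by rewrite fconnect_f ek rot_cycle.
  (* A fixed point [z] in the orbit would have order 1, hence [x] too, and [x] would be fixed. *)
  apply: contra fx => /eqP fz.
  have e1 : order f x = order f z.
    by apply: (eq_order_cycle cx) => //; rewrite in_orbit.
  have : size (orbit f x) = 1%N.
    rewrite size_orbit e1 /order (eq_card (B := pred1 z)) ?card1 // => y.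
    rewrite !inE; apply/idP/idP => [/iter_findex <-|/eqP ->]; last first.
      exact: connect0.
    by apply/eqP; elim: (findex f z y) => //= n ->.
  have := mem_orbit (in_orbit f x); have := in_orbit f x.
  by case: (orbit f x) => [|a [|]] //; rewrite !inE => /eqP <- /eqP ->.
- by apply/setP => y; rewrite !inE ek mem_rot.
Qed.

Lemma cycle_setsP f C z : C \in cycle_sets f -> z \in C ->
  [/\ periodic f z, C = orbit_set f z & cycle_set_weight f C = lw (orbit f z)].
Proof.
move=> /imsetP[x px -> zx]; change (is_true (periodic f x)) in px.
have [pz ez [k ek]] := orbit_set_rot px zx; split => //.
rewrite /cycle_set_weight; case: pickP => [y yx|/(_ z)]; last by rewrite zx.
have [_ _ [l el]] := orbit_set_rot px yx.
by rewrite ek el !lw_rot.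
Qed.

(** A cycle uses only the arrows that leave its own vertices, so a change of the map elsewhere
    affects neither the cycle nor its weight. *)
Lemma cycle_sets_agree f g C : {in C, f =1 g} -> C \in cycle_sets f ->
  C \in cycle_sets g /\ cycle_set_weight f C = cycle_set_weight g C.
Proof.
move=> fg fC; case/imsetP: (fC) => x px eC; change (is_true (periodic f x)) in px.
have xC : x \in C by rewrite eC mem_orbit_set.
have /andP[cx fx] := px.
have cg : fcycle g (orbit f x).
  rewrite fconnect_f in cx; rewrite -(eq_in_cycle (P := mem C) (e := frel f)) //.
    by move=> a b aC bC /=; rewrite fg.
  by apply/allP => a ao; have : a \in C by rewrite eC inE.
have eo : orbit f x = orbit g x.
  by rewrite (orbitE cg (orbit_uniq _ _) (in_orbit _ _)) /orbit -orderSpred /= eqxx rot0.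
have pg : periodic g x.
  by rewrite /periodic fconnect_f -eo cg -fg.
have gC : C \in cycle_sets g.
  by rewrite eC /orbit_set eo; apply: orbit_set_cycle.
split=> //; have [_ _ ->] := cycle_setsP fC xC.
by have [_ _ ->] := cycle_setsP gC xC; rewrite eo.
Qed.

Variables (q : T -> T -> R) (W0 : pred T).

Definition arrow_weight f : R := \prod_(x | ~~ W0 x) q x (f x).

Definition map_weight f : R :=
  arrow_weight f * \prod_(C in cycle_sets f) cycle_set_weight f C.

Definition rooted_weight f x : R :=
  arrow_weight f * \prod_(C in cycle_sets f | x \notin C) cycle_set_weight f C.

Lemma map_weight_periodic f x : periodic f x ->
  map_weight f = lw (orbit f x) * rooted_weight f x.
Proof.
move=> px; have xC := orbit_set_cycle px.
rewrite /map_weight /rooted_weight (bigD1 (orbit_set f x)) //=.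
have [_ _ ->] := cycle_setsP xC (mem_orbit_set f x).
rewrite mulrCA; congr (_ * (_ * _)); apply: eq_bigl => C.
case fC : (C \in _) => //=; apply/idP/idP.
  by apply: contra => xC'; have [_ <- _] := cycle_setsP fC xC'.
by apply: contra => /eqP ->; apply: mem_orbit_set.
Qed.

Lemma map_weight_aperiodic f x : ~~ periodic f x ->
  map_weight f = rooted_weight f x.
Proof.
move=> px; rewrite /map_weight /rooted_weight; congr (_ * _); apply: eq_bigl => C.
case fC : (C \in _) => //=; apply/esym; apply: contra px => xC.
by have [] := cycle_setsP fC xC.
Qed.

Hypothesis q_ge0 : forall x y, 0 <= q x y.
Hypothesis lw_ge0 : forall c, 0 <= lw c.
Hypothesis lw_le1 : forall c, lw c <= 1.

Lemma cycle_set_weight_ge0 f C : 0 <= cycle_set_weight f C.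
Proof. by rewrite /cycle_set_weight; case: pickP. Qed.

Lemma map_weight_ge0 f : 0 <= map_weight f.
Proof.
by rewrite mulr_ge0 ?prodr_ge0 // => C _; apply: cycle_set_weight_ge0.
Qed.

Lemma rooted_weight_ge0 f x : 0 <= rooted_weight f x.
Proof.
by rewrite mulr_ge0 ?prodr_ge0 // => C _; apply: cycle_set_weight_ge0.
Qed.

Definition redirect f x y := fun z => if z == x then y else f z.

(** A cycle that uses the arrow at [x] contains [x] and has been discarded, so [q x (f x)] is the
    only factor that depends on this arrow. The identity is cross-multiplied because [q x (f x)] may
    vanish. *)
Lemma rooted_weight_redirect f x y : ~~ W0 x ->
  rooted_weight (redirect f x y) x * q x (f x) = rooted_weight f x * q x y.
Proof.
move=> W0x; rewrite /rooted_weight /arrow_weight !(bigD1 x W0x) /=.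
rewrite {1}/redirect eqxx.
rewrite [in LHS](eq_bigr (fun z => q z (f z))); last first.
  by move=> z /andP[_ zx]; rewrite /redirect (negbTE zx).
have agr C : x \notin C -> {in C, redirect f x y =1 f}.
  move=> xC z zC; rewrite /redirect; case: eqP => // zx.
  by rewrite -zx zC in xC.
have agr' C : x \notin C -> {in C, f =1 redirect f x y}.
  by move=> xC z zC; rewrite (agr C).
have -> : \prod_(C in cycle_sets (redirect f x y) | x \notin C)
     cycle_set_weight (redirect f x y) C =
   \prod_(C in cycle_sets f | x \notin C) cycle_set_weight f C.
  apply: eq_big => [C|C /andP[fC xC]].
    case xC : (x \notin C); rewrite ?andbF // !andbT.
    apply/idP/idP => H; first by have [] := cycle_sets_agree (agr _ xC) H.
    by have [] := cycle_sets_agree (agr' _ xC) H.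
  by have [] := cycle_sets_agree (agr _ xC) fC.
by ring.
Qed.

End FunctionalGraph.

(** * One loop-erased walk in a weighted set of maps *)

(** An index shift for a sequence [a] with jumps [b]. It is applied to the weight of the pointer
    along the followed path, which is constant if the path ends in [W] and otherwise jumps only at
    the entrance of the loop. *)
Lemma sum_shift (R : realFieldType) (m : nat) (c : R) (a b F : nat -> R) :
  a 0%N = c + b 0%N -> (forall j, (j < m)%N -> a j.+1 = a j + b j.+1) ->
  \sum_(j < m.+1) a j * F j =
  c * F 0%N + \sum_(j < m) a j * F j.+1 + \sum_(j < m.+1) b j * F j.
Proof.
move=> a0 aS; rewrite big_ord_recl [X in _ = _ + X]big_ord_recl /= a0.
have -> : \sum_(i < m) a (bump 0 i) * F (bump 0 i) =
   \sum_(j < m) a j * F j.+1 + \sum_(i < m) b (bump 0 i) * F (bump 0 i).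
  by rewrite -big_split /=; apply: eq_bigr => j _; rewrite aS // mulrDl.
by ring.
Qed.

Section OneWalk.
Variables (R : realFieldType) (T : finType) (lw : seq T -> R).
Hypothesis lw_rot : forall c k, lw (rot k c) = lw c.
Hypothesis lw_ge0 : forall c, 0 <= lw c.
Hypothesis lw_le1 : forall c, lw c <= 1.
Variables (q : T -> T -> R) (W0 : pred T).
Hypothesis q_ge0 : forall x y, 0 <= q x y.
Hypothesis q_irr : forall x, q x x = 0.
Hypothesis q_sum : forall x, \sum_y q x y <= 1.
Variables (v : T) (W U : pred T).
Hypothesis Wv : ~~ W v.
Hypothesis W0W : forall x, W0 x -> W x.

Local Notation Pi := (map_weight lw q W0).
Local Notation wt := (rooted_weight lw q W0).

Section Following.
Variable f : T -> T.
Hypothesis fW : forall x, W x -> W (f x).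

(** When the orbit misses [W], [find] returns its size, so this is the time of the first visit to
    [W] or, failing that, of the first return to a vertex already visited. *)
Definition exit_time := find W (orbit f v).

(** A loop met by the path is always recorded as kept; its possible erasure is accounted for in
    [step_value] only. *)
Definition followed : seq T * option (seq T) :=
  let w := traject f v exit_time in
  let y := iter exit_time f v in
  if W y then (rcons w y, None) else (w, Some (drop (index y w) w)).

Lemma exit_time_gt0 : (0 < exit_time)%N.
Proof. by rewrite /exit_time /orbit -orderSpred /= (negbTE Wv). Qed.

Lemma exit_time_le : (exit_time <= order f v)%N.
Proof. by rewrite -size_orbit find_size. Qed.

Lemma before_exit j : (j < exit_time)%N -> ~~ W (iter j f v).
Proof.
move=> jn; have := before_find v jn.
by rewrite nth_traject ?(leq_trans jn exit_time_le) // => ->.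
Qed.

Lemma traject_uniq j : (j <= exit_time)%N -> uniq (traject f v j).
Proof.
move=> jn; rewrite -(@take_traject _ _ (order f v)) ?(leq_trans jn exit_time_le) //.
exact/take_uniq/orbit_uniq.
Qed.

Lemma exit_or_loop : W (iter exit_time f v) \/
  ~~ W (iter exit_time f v) /\ iter exit_time f v \in traject f v exit_time.
Proof.
have [nn|] := ltnP exit_time (order f v).
  left; have : has W (orbit f v) by rewrite has_find size_orbit.
  by move/(nth_find v); rewrite nth_traject.
move=> no; have en : exit_time = order f v by apply/eqP; rewrite eqn_leq exit_time_le.
right; have := looping_order f v; rewrite en; split=> //.
have /trajectP[j jn ->] := looping_order f v.
by apply: before_exit; rewrite en.
Qed.

Lemma iter_next j : (j.+1 < exit_time)%N ->
  [/\ ~~ W (iter j.+1 f v), iter j.+1 f v \notin traject f v j.+1 &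
   rcons (traject f v j.+1) (iter j.+1 f v) = traject f v j.+2].
Proof.
move=> jn; split; first exact: before_exit; last by rewrite [RHS]trajectSr.
by have := traject_uniq jn; rewrite trajectSr rcons_uniq => /andP[].
Qed.

Lemma closed_iter x k : W x -> W (iter k f x).
Proof. by move=> Wx; elim: k => //= k /fW. Qed.

(** [W] is closed under [f], so a vertex on a cycle from which [W] is reached would itself lie in
    [W]. *)
Lemma exit_aperiodic j : W (iter exit_time f v) -> (j < exit_time)%N ->
  ~~ periodic f (iter j f v).
Proof.
move=> Wn jn; apply: contra (before_exit jn) => /andP[+ _].
rewrite fconnect_f => cx.
have nx : iter exit_time f v \in orbit f (iter j f v).
  by rewrite -(subnK (ltnW jn)) iterD -fconnect_orbit fconnect_iter.
have [k ->] : exists k, iter j f v = iter k f (iter exit_time f v).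
  exists (findex f (iter exit_time f v) (iter j f v)); rewrite iter_findex //.
  by rewrite (fconnect_cycle cx nx) in_orbit.
exact: closed_iter.
Qed.

Lemma rooted_weight_same_cycle x z : periodic f x -> z \in orbit_set f x ->
  wt f z = wt f x.
Proof.
move=> px zx; congr (_ * _); apply: eq_bigl => C.
case fC : (C \in _) => //=; congr (~~ _).
have ezx : orbit_set f z = orbit_set f x by have [] := orbit_set_rot px zx.
apply/idP/idP => H; have [_ -> _] := cycle_setsP lw_rot fC H => //.
  by rewrite ezx mem_orbit_set.
Qed.

Section Loop.
Variable i : nat.
Hypothesis i_lt : (i < exit_time)%N.
Hypothesis loop_i : iter exit_time f v = iter i f v.
Let p := drop i (traject f v exit_time).

Lemma loop_drop : p = traject f (iter i f v) (exit_time - i).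
Proof.
rewrite /p -{1}(subnKC (ltnW i_lt)) trajectD drop_size_cat //.
by rewrite size_traject.
Qed.

Lemma loop_cycle : fcycle f p.
Proof.
rewrite loop_drop; have : (0 < exit_time - i)%N by rewrite subn_gt0.
case e : (exit_time - i)%N => [//|k] _ /=.
rewrite rcons_path fpath_traject /= last_traject -iterS -e -iterD subnK.
  by rewrite loop_i.
exact: ltnW.
Qed.

Lemma loop_uniq : uniq p.
Proof. exact/drop_uniq/traject_uniq. Qed.

Lemma mem_loop j : (j < exit_time)%N -> (iter j f v \in p) = (i <= j)%N.
Proof.
move=> jn; have ej : iter j f v = nth v (traject f v exit_time) j by rewrite nth_traject.
have uw := traject_uniq (leqnn exit_time).
have := cat_take_drop i (traject f v exit_time); rewrite -/p => ew.
have st : size (take i (traject f v exit_time)) = i.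
  by rewrite size_takel // size_traject ltnW.
apply/idP/idP => [jp|ij].
  rewrite leqNgt; apply/negP => ji; move: uw; rewrite -ew cat_uniq.
  case/and3P => _ /hasPn/(_ _ jp) /=; rewrite take_traject ?(ltnW i_lt) //.
  by move=> /negP[]; apply/trajectP; exists j.
by rewrite ej -ew nth_cat st ltnNge ij /= mem_nth // size_drop size_traject ltn_sub2r.
Qed.

Lemma loop_periodic j : (i <= j < exit_time)%N ->
  iter exit_time f v != iter exit_time.-1 f v ->
  periodic f (iter j f v) /\ lw (orbit f (iter j f v)) = lw p.
Proof.
move=> /andP[ij jn] nfix; have jp : iter j f v \in p by rewrite mem_loop.
have [k ek] := orbit_rot_cycle loop_cycle loop_uniq jp; split; last by rewrite ek lw_rot.
rewrite /periodic fconnect_f ek rot_cycle loop_cycle /=.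
apply: contra nfix => /eqP fx.
have fixx : forall m, iter m f (iter j f v) = iter j f v by elim=> //= m ->.
have := exit_time_gt0; case en : exit_time => [//|n] _ /=; move: jn; rewrite en ltnS => jn.
by rewrite -(subnK jn) iterD !fixx fx.
Qed.

(** A vertex before the entrance that lay on a cycle would be reached again from the loop, but the
    loop is closed under [f] and does not contain it. *)
Lemma before_loop_aperiodic j : (j < i)%N -> ~~ periodic f (iter j f v).
Proof.
move=> ji; apply/negP => /andP[+ _]; rewrite fconnect_f => cx.
have jn := ltn_trans ji i_lt.
have ix : iter i f v \in orbit f (iter j f v).
  by rewrite -(subnK (ltnW ji)) iterD -fconnect_orbit fconnect_iter.
have : fconnect f (iter i f v) (iter j f v).
  by rewrite (fconnect_cycle cx ix) in_orbit.
rewrite (fconnect_cycle loop_cycle); last by rewrite mem_loop.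
by rewrite mem_loop // leqNgt ji.
Qed.

End Loop.

Variables (phi : seq T -> R) (Psi : seq T * option (seq T) -> R).
Hypothesis phi_ge0 : forall s, 0 <= phi s.
Hypothesis Psi_ge0 : forall L, 0 <= Psi L.

(* Expected payoff after a step to [y] from the current path [s], when the
   walk is ended by [W] or by keeping a loop, and killed outside [U]. *)
Definition step_value (s : seq T) (y : T) : R :=
  if ~~ U y then 0
  else if W y then Psi (rcons s y, None)
  else if y \in s then
    lw (drop (index y s) s) * Psi (s, Some (drop (index y s) s)) +
    (1 - lw (drop (index y s) s)) * phi (take (index y s).+1 s)
  else phi (rcons s y).

Lemma step_value_ge0 s y : 0 <= step_value s y.
Proof.
rewrite /step_value; case: ifP => // _; case: ifP => // _; case: ifP => // _.
by rewrite addr_ge0 ?mulr_ge0 ?subr_ge0.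
Qed.

Definition followed_payoff : R :=
  if U (iter exit_time f v) then Psi followed else 0.

(** For a fixed map, moving the pointer from one prefix to the next cancels the values term by term;
    there remain the start, of weight [Pi f], and the last arrow. If this arrow closes a loop [p]
    entered at index [i], then [Pi f = lw p * wt f (iter i f v)]: keeping the loop pays [Pi f] times
    the payoff, and erasing it supplies the missing share [1 - lw p] of the weight at index [i].
    Killing outside [U] only lowers the left side. *)
Lemma followed_balance :
  \sum_(j < exit_time)
     wt f (iter j f v) * step_value (traject f v j.+1) (iter j.+1 f v)
    + Pi f * phi [:: v] <=
  \sum_(j < exit_time) wt f (iter j f v) * phi (traject f v j.+1)
    + Pi f * followed_payoff.
Proof.
have wt0 x : 0 <= wt f x by exact: rooted_weight_ge0.
have Pi0 : 0 <= Pi f by exact: map_weight_ge0.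
(* If the arrow weight vanishes, both sides are 0. Otherwise [q_irr] excludes fixed points along the
   path, so a loop met at the end is a genuine cycle. *)
case: (altP (arrow_weight q W0 f =P 0)) => [Q0|Q0].
  have w0 x : wt f x = 0 by rewrite /rooted_weight Q0 mul0r.
  rewrite /map_weight Q0 !mul0r !addr0.
  by rewrite !big1 // => j _; rewrite w0 mul0r.
have nfix j : (j < exit_time)%N -> iter j.+1 f v != iter j f v.
  move=> jn; apply: contra Q0 => /eqP fx; apply/prodf_eq0.
  exists (iter j f v); first exact: contra (@W0W _) (before_exit jn).
  by rewrite -iterS fx q_irr.
have := exit_time_gt0; move en : exit_time => n n0.
case: n n0 en => // m _ en.
have inner (j : 'I_m) : step_value (traject f v j.+1) (iter j.+1 f v) <=
     phi (traject f v j.+2).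
  have [|nW ns es] := @iter_next j; first by rewrite en ltnS.
  rewrite /step_value; case: ifP => // _.
  by rewrite (negbTE nW) (negbTE ns) es.
have mono : \sum_(j < m) wt f (iter j f v) *
      step_value (traject f v j.+1) (iter j.+1 f v) <=
    \sum_(j < m) wt f (iter j f v) * phi (traject f v j.+2).
  by apply: ler_sum => j _; apply: ler_wpM2l.
rewrite big_ord_recr /=.
case: exit_or_loop => [Wn|[Wn /trajectP[i i_lt loop_i]]].
  have aw j : (j < exit_time)%N -> wt f (iter j f v) = Pi f.
    by move=> jn; rewrite -(map_weight_aperiodic lw_rot) // exit_aperiodic.
  rewrite (@sum_shift _ m (Pi f) (fun j => wt f (iter j f v)) (fun=> 0)
     (fun j => phi (traject f v j.+1))).
  - rewrite [X in _ <= _ + X + _]big1 ?addr0; last by move=> j _; rewrite mul0r.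
    rewrite aw ?en // /step_value /followed_payoff /followed.
    rewrite !en in Wn *; rewrite /= in Wn *; rewrite Wn.
    case: (U _) => /=; rewrite ?mulr0; lra.
  - by rewrite aw ?addr0 ?en.
  - by move=> j jm; rewrite !aw ?addr0 ?en // ltnS ltnW.
have [||per ei] := @loop_periodic i i_lt loop_i i _.
- by rewrite i_lt leqnn.
- by rewrite en; apply: (nfix m); rewrite en.
set p := drop i _ in ei.
have wtS j : (i <= j < exit_time)%N -> wt f (iter j f v) = wt f (iter i f v).
  move=> ij; apply: rooted_weight_same_cycle => //.
  have jp : iter j f v \in p by rewrite /p mem_loop //; case/andP: ij.
  rewrite inE -fconnect_orbit (fconnect_cycle (loop_cycle i_lt loop_i)) //.
  by rewrite mem_loop.
have wtB j : (j < i)%N -> wt f (iter j f v) = Pi f.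
  by move=> ji; rewrite -(map_weight_aperiodic lw_rot) // (before_loop_aperiodic i_lt).
have ePi : Pi f = lw p * wt f (iter i f v) by rewrite (map_weight_periodic lw_rot _ _ per) ei.
(* The weight passes from [lw p * w] to [w] at the entrance of the loop, where [w] is
   [wt f (iter i f v)]. *)
pose b j := if j == i then (1 - lw p) * wt f (iter i f v) else 0.
rewrite (@sum_shift _ m (Pi f) (fun j => wt f (iter j f v)) b
     (fun j => phi (traject f v j.+1))); first last.
- move=> j jm; rewrite /b; case: (ltngtP j.+1 i) => ji.
  + by rewrite !wtB ?addr0 // ltnW.
  + have ij : (i <= j)%N := ji.
    by rewrite !wtS ?addr0 // en ?ij ?(leqW ij) /= ltnS // ltnW.
  + have jlt : (j < i)%N by rewrite -ji.
    by rewrite ji (wtB j jlt) ePi; lra.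
- rewrite /b; case: (ltngtP 0%N i) => // [i0|i0]; first by rewrite wtB ?addr0.
  rewrite -i0 in ePi *; rewrite ePi; lra.
have -> : \sum_(j < m.+1) b j * phi (traject f v j.+1) =
    (1 - lw p) * wt f (iter i f v) * phi (traject f v i.+1).
  have im : (i < m.+1)%N by rewrite -en.
  rewrite (bigD1 (Ordinal im)) //= big1 ?addr0 /b ?eqxx // => j ji.
  by rewrite ifN ?mul0r.
have ewm : wt f (iter m f v) = wt f (iter i f v).
  by rewrite wtS // en leqnn andbT -ltnS -en.
have idx : index (iter exit_time f v) (traject f v exit_time) = i.
  rewrite loop_i -[X in index X _](nth_traject f i_lt) index_uniq //.
    by rewrite size_traject.
  exact: traject_uniq.
have tk : take i.+1 (traject f v exit_time) = traject f v i.+1 by rewrite take_traject.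
have memn : iter exit_time f v \in traject f v exit_time.
  by rewrite loop_i; apply/trajectP; exists i.
rewrite /step_value /followed_payoff /followed (negbTE Wn).
rewrite -/p in idx *.
have -> : v :: traject f (f v) m = traject f v exit_time by rewrite en.
have -> : f (iter m f v) = iter exit_time f v by rewrite en.
rewrite (negbTE Wn) memn idx -/p tk ewm.
have w0i := wt0 (iter i f v).
have l1 : 0 <= 1 - lw p by rewrite subr_ge0.
have := mulr_ge0 (mulr_ge0 l1 w0i) (phi_ge0 (traject f v i.+1)).
case: (U _) => /=; rewrite ePi ?mulr0; lra.
Qed.

End Following.

(** Whether the path is still running at [j] can be read from its first [j.+1] vertices, hence does
    not depend on the arrow at the last of them. *)
Lemma lt_exit_time f j : (j < exit_time f)%N =
  uniq (traject f v j.+1) && all (predC W) (traject f v j.+1).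
Proof.
apply/idP/andP => [jn|[uj nW]].
  split; first exact: traject_uniq.
  by apply/allP => _ /trajectP[k kj ->]; apply/before_exit/(leq_trans kj).
have jo : (j < order f v)%N.
  rewrite ltnNge; apply/negP => oj; move: uj; rewrite looping_uniq => /negP[].
  have : fconnect f v (iter j f v) by exact: fconnect_iter.
  rewrite fconnect_orbit => /trajectP[k ko e]; apply/trajectP; exists k => //.
  exact: leq_trans ko oj.
rewrite ltnNge; apply/negP => ej.
have hW : has W (orbit f v) by rewrite has_find size_orbit; apply: leq_ltn_trans jo.
have := nth_find v hW; rewrite nth_traject ?(leq_ltn_trans ej jo) // => We.
have /(allP nW) : iter (exit_time f) f v \in traject f v j.+1.
  by apply/trajectP; exists (exit_time f).
by rewrite /= We.
Qed.

Section Resampling.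
Variable f0 : T -> T.
Hypothesis f0W : forall x, W x -> W (f0 x).

Definition agree (f : T -> T) := [forall x, W x ==> (f x == f0 x)].

Lemma agree_closed (f : T -> T) : agree f -> forall x, W x -> W (f x).
Proof.
by move=> /forallP ok x Wx; have := ok x; rewrite Wx /= => /eqP ->; apply: f0W.
Qed.

Lemma redirect_exit (f f' : T -> T) j y : (j < exit_time f)%N ->
  f' =1 redirect f (iter j f v) y ->
  [/\ (j < exit_time f')%N, traject f' v j.+1 = traject f v j.+1,
    iter j f' v = iter j f v & agree f -> agree f'].
Proof.
move=> jn ef'.
have it k : (k <= j)%N -> iter k f' v = iter k f v.
  (* The prefix is self-avoiding, so none of its earlier arrows is the redirected one. *)
  elim: k => //= k IH kj; rewrite IH ?(ltnW kj) // ef' /redirect ifN //.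
  have := traject_uniq jn; apply: contraL => /eqP e.
  rewrite trajectSr rcons_uniq -e negb_and negbK; apply/orP; left.
  by apply/trajectP; exists k.
have et : traject f' v j.+1 = traject f v j.+1.
  apply: (eq_from_nth (x0 := v)); rewrite !size_traject // => k kj.
  by rewrite !nth_traject // it.
split=> //; last 2 first.
- exact: it.
- move/forallP => ok; apply/forallP => x; apply/implyP => Wx.
  have := ok x; rewrite Wx /= => /eqP <-; rewrite ef' /redirect ifN //.
  by apply: contraTneq Wx => ->; apply: before_exit.
- by move: jn; rewrite !lt_exit_time et.
Qed.

(* Exchanging the arrow at the [j]-th vertex with an independent copy of it is
   an involution of the pairs (map, copy) which preserves the first [j] steps. *)
Lemma resample (H : seq T -> T -> R) : (forall s y, 0 <= H s y) ->
  \sum_(f : {ffun T -> T} | agree f) \sum_(j < exit_time f)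
     wt f (iter j f v) * \sum_y q (iter j f v) y * H (traject f v j.+1) y <=
  \sum_(f : {ffun T -> T} | agree f) \sum_(j < exit_time f)
     wt f (iter j f v) * H (traject f v j.+1) (iter j.+1 f v).
Proof.
move=> H0; have widen (F : {ffun T -> T} -> nat -> R) :
    \sum_(f : {ffun T -> T} | agree f) \sum_(j < exit_time f) F f j =
    \sum_(j < #|T|) \sum_(f : {ffun T -> T} | agree f && (j < exit_time f)%N) F f j.
  rewrite [RHS](exchange_big_dep (fun f : {ffun T -> T} => agree f)) /=; last first.
    by move=> j f _ /andP[].
  apply: eq_bigr => f okf.
  rewrite (big_ord_widen #|T| (F f)) ?(leq_trans (exit_time_le f)) ?max_card //.
  by apply: eq_bigl => j; rewrite okf.
rewrite (widen (fun f j => wt f (iter j f v) * \sum_y q (iter j f v) y * H (traject f v j.+1) y)).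
rewrite (widen (fun f j => wt f (iter j f v) * H (traject f v j.+1) (iter j.+1 f v))).
apply: ler_sum => j _.
pose c (f : {ffun T -> T}) := agree f && (j < exit_time f)%N.
pose sg (p : {ffun T -> T} * T) : {ffun T -> T} * T :=
  ([ffun z => redirect p.1 (iter j p.1 v) p.2 z], p.1 (iter j p.1 v)).
have csg p : c p.1 -> [/\ c (sg p).1, traject (sg p).1 v j.+1 = traject p.1 v j.+1
    & iter j (sg p).1 v = iter j p.1 v].
  move=> /andP[okf jn].
  have [//|a b d e] := @redirect_exit p.1 (sg p).1 j p.2 jn; first by move=> z; rewrite ffunE.
  by split=> //; rewrite /c a e.
have sgK p : c p.1 -> sg (sg p) = p.
  case: p => f y cf; have [_ _ e] := csg (f, y) cf; rewrite /= in cf.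
  rewrite {1}/sg e /=; congr pair; last by rewrite ffunE /redirect eqxx.
  apply/ffunP => z; rewrite ffunE /redirect.
  by case: eqP => [-> //|/eqP zx]; rewrite ffunE /redirect (negbTE zx).
under eq_bigr => f _ do rewrite big_distrr.
rewrite pair_big_dep /= (reindex_onto sg sg) /=; last first.
  by move=> p /andP[cp _]; apply: sgK.
have -> : \sum_(p | c (sg p).1 && true && (sg (sg p) == p))
     wt (sg p).1 (iter j (sg p).1 v) *
       (q (iter j (sg p).1 v) (sg p).2 * H (traject (sg p).1 v j.+1) (sg p).2) =
   \sum_(p | c p.1) q (iter j p.1 v) p.2 *
       (wt p.1 (iter j p.1 v) * H (traject p.1 v j.+1) (iter j.+1 p.1 v)).
  apply: eq_big => [p|p].
    rewrite andbT; apply/andP/idP => [[cs /eqP <-]|cp]; first by case: (csg _ cs).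
    by split; [case: (csg p cp)|rewrite sgK].
  rewrite andbT => /andP[cs /eqP es].
  have cp : c p.1 by rewrite -es; case: (csg _ cs).
  have [_ -> ->] := csg p cp; case/andP: (cp) => okf jn.
  have nW0 : ~~ W0 (iter j p.1 v) by apply: contra (@W0W _) (before_exit jn).
  have := rooted_weight_redirect lw_rot q p.1 p.2 nW0.
  have -> : rooted_weight lw q W0 (sg p).1 (iter j p.1 v) =
            rooted_weight lw q W0 (redirect p.1 (iter j p.1 v) p.2) (iter j p.1 v).
    by congr (rooted_weight _ _ _ _ _); apply/funext => z; rewrite ffunE.
  by move=> e; rewrite /= mulrA e; ring.
have -> : \sum_(p | c p.1) q (iter j p.1 v) p.2 *
       (wt p.1 (iter j p.1 v) * H (traject p.1 v j.+1) (iter j.+1 p.1 v)) =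
   \sum_(f | c f) \sum_y q (iter j f v) y *
       (wt f (iter j f v) * H (traject f v j.+1) (iter j.+1 f v)).
  by rewrite pair_big_dep /=; apply: eq_bigl => p; rewrite andbT.
(* After the exchange the copy is free and has total mass at most 1; this is the only loss in the
   lemma. *)
apply: ler_sum => f _; rewrite -big_distrl /=.
rewrite -[leRHS]mul1r; apply: ler_wpM2r => //.
by rewrite mulr_ge0 ?rooted_weight_ge0.
Qed.

(** In the summed balance the visits to prefixes occur on the left with [step_value] along the arrow
    and on the right with [phi]. [resample] replaces the arrow by an independent step, and the
    hypothesis on [phi] compares that step with [phi]; the two sums then cancel, leaving the start
    and the end. The arrows on [W] stay prescribed through [agree]. *)
Theorem one_walk (phi : seq T -> R) (Psi : seq T * option (seq T) -> R) :
  (forall s, 0 <= phi s) -> (forall L, 0 <= Psi L) ->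
  (forall s, phi (v :: s) <=
     \sum_y q (last v s) y * step_value phi Psi (v :: s) y) ->
  phi [:: v] * \sum_(f : {ffun T -> T} | agree f) Pi f <=
  \sum_(f : {ffun T -> T} | agree f) Pi f * followed_payoff f Psi.
Proof.
move=> phi0 Psi0 phiS.
have sv0 := step_value_ge0 phi0 Psi0.
have bal : \sum_(f : {ffun T -> T} | agree f)
    (\sum_(j < exit_time f) wt f (iter j f v) *
      step_value phi Psi (traject f v j.+1) (iter j.+1 f v) + Pi f * phi [:: v]) <=
  \sum_(f : {ffun T -> T} | agree f)
    (\sum_(j < exit_time f) wt f (iter j f v) * phi (traject f v j.+1) +
      Pi f * followed_payoff f Psi).
  by apply: ler_sum => f /agree_closed fW; apply: followed_balance.
rewrite !big_split /= in bal; rewrite mulrC big_distrl /=.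
have := resample sv0.
set A := (X in _ <= X) => res.
have : \sum_(f : {ffun T -> T} | agree f)
    \sum_(j < exit_time f) wt f (iter j f v) * phi (traject f v j.+1) <= A.
  apply: le_trans res; apply: ler_sum => f _; apply: ler_sum => j _.
  apply: ler_wpM2l; first exact: rooted_weight_ge0.
  by have := phiS (traject f (f v) j); rewrite last_traject.
rewrite -/A in bal; lra.
Qed.

End Resampling.
End OneWalk.

(** * Successive walks in a finite volume *)

Section Values.
Variables (R : realType) (V : countType) (e : rel V) (p : cycle_weight R e).
Variables (U : {fset V}) (x0 : V).
Implicit Types (W : {fset V}) (s : seq V) (L : lerw_state V).
Implicit Types (F : {fset V} * {fset {fset V}}).

Lemma loop_weight_le1 c : loop_weight p c <= 1.
Proof. by rewrite /loop_weight; case: ifPn => // /weight_le1. Qed.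

Lemma simple_cycle_rot c k : simple_cycle e (rot k c) = simple_cycle e c.
Proof. by rewrite /simple_cycle size_rot rot_uniq rot_cycle. Qed.

Lemma loop_weight_rot c k : loop_weight p (rot k c) = loop_weight p c.
Proof.
rewrite /loop_weight simple_cycle_rot; case: ifP => // sc.
by rewrite weight_rot.
Qed.

Lemma srw_step_ge0 x y : 0 <= srw_step R e x y.
Proof. by rewrite /srw_step; case: ifP. Qed.

Definition add_state F L : {fset V} * {fset {fset V}} :=
  ((F.1 `|` state_vertices L)%fset, (F.2 `|` state_edges L)%fset).

Definition move_value W (Psi : lerw_state V -> R) (phi : seq V -> R) s y : R :=
  if y \in W then Psi (rcons s y, None)
  else if y \in s then
    loop_weight p (drop (index y s) s) * Psi (s, Some (drop (index y s) s)) +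
    (1 - loop_weight p (drop (index y s) s)) * phi (take (index y s).+1 s)
  else phi (rcons s y).

(* Expectation of [Psi] at the final state of the loop-erased walk with
   boundary condition [W], the current path being [s], on the event that it
   ends within [k] steps and stays in [U] until then. *)
Fixpoint killed_value W (Psi : lerw_state V -> R) (k : nat) s : R :=
  if k is k'.+1 then
    \sum_(y <- U) srw_step R e (last x0 s) y *
      move_value W Psi (killed_value W Psi k') s y
  else 0.

(* The same for [r] successive walks of at most [m] steps, started at
   [phi j], [phi j.+1], ..., [F] being the forest built so far. *)
Fixpoint forest_value (phi : nat -> V) (Phi : {fset {fset V}} -> R) (m r j : nat) F : R :=
  if r is r'.+1 then
    let next L := forest_value phi Phi m r' j.+1 (add_state F L) in
    if phi j \in F.1 then next ([:: phi j], None)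
    else killed_value F.1 next m [:: phi j]
  else Phi F.2.

Lemma move_value_ge0 W Psi phi s y :
  (forall L, 0 <= Psi L) -> (forall s, 0 <= phi s) ->
  0 <= move_value W Psi phi s y.
Proof.
move=> P0 f0; rewrite /move_value; case: ifP => // _; case: ifP => // _.
by rewrite addr_ge0 ?mulr_ge0 ?loop_weight_ge0 // subr_ge0 loop_weight_le1.
Qed.

Lemma le_move_value W Psi Psi' phi phi' s y :
  (forall L, Psi L <= Psi' L) -> (forall s, phi s <= phi' s) ->
  move_value W Psi phi s y <= move_value W Psi' phi' s y.
Proof.
move=> lP lf; rewrite /move_value; case: ifP => // _; case: ifP => // _.
by apply: lerD; apply: ler_wpM2l; rewrite ?loop_weight_ge0 ?subr_ge0 ?loop_weight_le1.
Qed.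

Lemma killed_value_ge0 W Psi k s : (forall L, 0 <= Psi L) ->
  0 <= killed_value W Psi k s.
Proof.
move=> P0; elim: k s => //= k IH s; apply: sumr_ge0 => y _.
by rewrite mulr_ge0 ?srw_step_ge0 // move_value_ge0.
Qed.

Lemma killed_value_le W Psi k s : (forall L, 0 <= Psi L) ->
  killed_value W Psi k s <= killed_value W Psi k.+1 s.
Proof.
move=> P0; elim: k s => [|k IH] s; first exact: killed_value_ge0.
apply: ler_sum => y _; apply: ler_wpM2l; first exact: srw_step_ge0.
exact: le_move_value.
Qed.

Lemma forest_value_ge0 phi Phi m r j F : (forall A, 0 <= Phi A) ->
  0 <= forest_value phi Phi m r j F.
Proof.
move=> P0; elim: r j F => //= r IH j F; case: ifP => // _.
exact: killed_value_ge0.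
Qed.

End Values.

Lemma sum_fset_sub (R : nmodType) (V : choiceType) (G U : {fset V}) (F : V -> R) :
  (U `<=` G)%fset ->
  \sum_(y <- U) F y = \sum_(y : G | val y \in U) F (val y).
Proof.
move=> UG.
have -> : \sum_(y : G | val y \in U) F (val y) =
    \sum_(y <- [seq val x | x <- enum {: G} & val x \in U]) F y.
  by rewrite big_map big_filter big_enum_cond.
apply: perm_big; apply: uniq_perm; first exact: fset_uniq.
  rewrite map_inj_uniq; first by rewrite filter_uniq ?enum_uniq.
  exact: fset_val_inj || exact: val_inj || by move=> a b; apply: val_inj.
move=> y; apply/idP/mapP => [yU|[x + ->]]; last by rewrite mem_filter => /andP[].
have yG := fsubsetP UG _ yU; exists (FSetSub yG) => //.
by rewrite mem_filter mem_enum /= yU.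
Qed.

Lemma srw_step_sum (R : realType) (V : countType) (e : rel V) (G : {fset V}) (x : V) :
  locally_finite e -> \sum_(y <- G) srw_step R e x y <= 1.
Proof.
move=> lf; rewrite /srw_step -big_mkcond /= big_const_seq iter_addr_0.
rewrite -[_^-1 *+ _]mulr_natl.
have [d0|d0] := eqVneq (degree e x) 0%N; first by rewrite d0 invr0 mulr0.
rewrite ler_pdivrMr ?mul1r ?ltr0n ?lt0n // ler_nat -size_filter.
rewrite /degree uniq_leq_size ?filter_uniq ?fset_uniq // => y; rewrite mem_filter => /andP[exy _].
by rewrite in_fset_set //; apply/mem_set.
Qed.

Lemma mem_path_edges (V : countType) (s : seq V) a :
  reflect (exists2 xy, xy \in zip s (behead s) & a = [fset xy.1; xy.2]%fset)
    (a \in path_edges s).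
Proof. by apply: (iffP (imfsetP _ _ _ _)). Qed.

Lemma mem_cycle_edges (V : countType) (c : seq V) a :
  reflect (exists2 x, x \in c & a = [fset x; next c x]%fset)
    (a \in cycle_edges c).
Proof. by apply: (iffP (imfsetP _ _ _ _)). Qed.

Lemma path_edges_traject (V : countType) (T : Type) (h : T -> V) (f : T -> T) x n a :
  reflect (exists2 j, (j < n)%N & a = [fset h (iter j f x); h (iter j.+1 f x)]%fset)
    (a \in path_edges (map h (traject f x n.+1))).
Proof.
apply: (iffP (mem_path_edges _ _)) => [[xy]|[j jn ->]].
  elim: n x => // n IH x; rewrite [traject _ _ _]/= [map _ _]/= [zip _ _]/= in_cons => /orP[/eqP -> /= ->|h1 h2].
    by exists 0%N.
  have [|j jn ->] := IH (f x) _ h2; first by [].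
  by exists j.+1 => //; rewrite -!iterSr.
exists (h (iter j f x), h (iter j.+1 f x)) => //.
elim: n x j jn => // n IH x [|j] jn; first by rewrite /= in_cons eqxx.
rewrite [traject _ _ _]/= [map _ _]/= [zip _ _]/= in_cons; apply/orP; right.
by have := IH (f x) j jn; rewrite -!iterSr.
Qed.

Section Followed.
Variables (V : countType) (T : finType) (h : T -> V).
Hypothesis h_inj : injective h.
Variables (v : T) (W : pred T) (f : T -> T).
Hypothesis Wv : ~~ W v.

Definition map_state (L : seq T * option (seq T)) : lerw_state V :=
  (map h L.1, omap (map h) L.2).

Lemma followed_vertices z :
  reflect ((exists2 j, (j < exit_time v W f)%N & z = h (iter j f v)) \/
     (W (iter (exit_time v W f) f v) /\ z = h (iter (exit_time v W f) f v)))
  (z \in state_vertices (map_state (followed v W f))).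
Proof.
rewrite /state_vertices /followed; set n := exit_time v W f.
apply: (iffP (imfsetP _ _ _ _)).
  case=> y ym ->; move: ym; case: ifP => Wn /=.
    rewrite -trajectSr => /mapP[_ /trajectP[j + ->] ->] /=.
    by rewrite ltnS leq_eqVlt => /orP[/eqP -> |jn]; [right|left; exists j].
  by move=> /mapP[_ /trajectP[j jn ->] ->]; left; exists j.
case: ifP => Wn /=; last first.
  case=> [[j jn ->]|[//]]; exists (h (iter j f v)) => //.
  by apply: map_f; apply/trajectP; exists j.
case=> [[j jn ->]|[_ ->]].
  exists (h (iter j f v)) => //.
  by rewrite -trajectSr; apply: map_f; apply/trajectP; exists j => //; apply: ltnW.
exists (h (iter n f v)) => //.
by rewrite -trajectSr; apply: map_f; apply/trajectP; exists n.
Qed.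

Lemma followed_edges a :
  a \in state_edges (map_state (followed v W f)) <->
  exists2 j, (j < exit_time v W f)%N &
      a = [fset h (iter j f v); h (iter j.+1 f v)]%fset.
Proof.
rewrite /state_edges /followed; set n := exit_time v W f.
have n0 : (0 < n)%N by apply: exit_time_gt0.
case: ifP => Wn; rewrite in_fsetU /=.
  rewrite in_fset0 orbF -trajectSr; split=> /path_edges_traject //.
have [|[_]] := exit_or_loop v W f; first by rewrite Wn.
rewrite -/n => /trajectP[i i_lt loop_i].
have idx : index (iter n f v) (traject f v n) = i.
  rewrite loop_i -[X in index X _](nth_traject f i_lt) index_uniq ?size_traject //.
  exact: (traject_uniq (leqnn _)).
rewrite idx; set c := drop i _.
have cyc : fcycle f c by apply: (loop_cycle i_lt loop_i).
have uc : uniq c by apply/drop_uniq/(traject_uniq (leqnn _)).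
have memc j : (j < n)%N -> (iter j f v \in c) = (i <= j)%N.
  by move=> jn; rewrite (mem_loop i_lt jn).
have nx x : x \in c -> next (map h c) (h x) = h (f x).
  by move=> xc; rewrite next_map // (eqP (next_cycle cyc xc)).
split=> [/orP[]|[j jn ->]]; last apply/orP.
- rewrite -{1}(prednK n0) => /path_edges_traject[j jn ->]; exists j => //.
  exact: leq_trans (leq_pred _).
- case/mem_cycle_edges => _ /mapP[x xc ->] ->; rewrite nx //.
  have /trajectP[j jn ex] : x \in traject f v n by apply: mem_drop xc.
  by exists j => //; rewrite ex.
(* The edges of the path account for all arrows but the last one, which closes the loop and is found
   among the cycle edges. *)
- have [jn1|] := ltnP j n.-1.
    by left; rewrite -{1}(prednK n0); apply/path_edges_traject; exists j.
  move=> nj; right; apply/mem_cycle_edges.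
  have jc : iter j f v \in c.
    by rewrite memc // -ltnS (leq_trans i_lt) // -(prednK n0) ltnS.
  by exists (h (iter j f v)); [apply: map_f|rewrite nx].
Qed.

Lemma followed_agree (g : T -> T) :
  (forall x, W x -> g x = f x) ->
  (forall j, (j < exit_time v W f)%N -> g (iter j f v) = f (iter j f v)) ->
  exit_time v W g = exit_time v W f /\
  (forall j, (j <= exit_time v W f)%N -> iter j g v = iter j f v).
Proof.
move=> gW gf; set n := exit_time v W f.
have it j : (j <= n)%N -> iter j g v = iter j f v.
  by elim: j => //= j IH jn; rewrite IH ?(ltnW jn) // gf.
have tr j : (j <= n)%N -> traject g v j.+1 = traject f v j.+1.
  move=> jn; apply: (eq_from_nth (x0 := v)); rewrite !size_traject // => k kj.
  by rewrite !nth_traject // it // (leq_trans _ jn).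
split=> //; apply/eqP; rewrite eqn_leq; apply/andP; split.
  by rewrite leqNgt lt_exit_time // tr // -lt_exit_time // ltnn.
have n0 : (0 < n)%N by apply: exit_time_gt0.
by rewrite -[leqLHS](prednK n0) lt_exit_time // tr ?leq_pred // -lt_exit_time // prednK.
Qed.

End Followed.

Section ManyWalks.
Variables (R : realType) (V : countType) (e : rel V) (p : cycle_weight R e).
Hypothesis e_irr : irreflexive e.
Hypothesis e_lf : locally_finite e.
Variables (G U W0 : {fset V}) (x0 : V).
Hypothesis UG : (U `<=` G)%fset.
Hypothesis UW0 : forall x, x \in U -> x \notin W0.

Definition vertex_loop_weight (s : seq G) : R := loop_weight p (map val s).
Definition vertex_step (x y : G) : R := srw_step R e (val x) (val y).
Definition is_root : pred G := fun x => val x \in W0.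

Definition map_edges (f : G -> G) : {fset {fset V}} :=
  [fset [fset val x; val (f x)]%fset | x in [pred x : G | ~~ is_root x]]%fset.

Local Notation Pi := (map_weight vertex_loop_weight vertex_step is_root).

Lemma mem_map_edges f a :
  reflect (exists2 x, ~~ is_root x & a = [fset val x; val (f x)]%fset)
    (a \in map_edges f).
Proof. by apply: (iffP (imfsetP _ _ _ _)). Qed.

Lemma vertex_loop_weight_rot c k :
  vertex_loop_weight (rot k c) = vertex_loop_weight c.
Proof. by rewrite /vertex_loop_weight map_rot loop_weight_rot. Qed.

Lemma vertex_loop_weight_ge0 c : 0 <= vertex_loop_weight c.
Proof. exact: loop_weight_ge0. Qed.

Lemma vertex_loop_weight_le1 c : vertex_loop_weight c <= 1.
Proof. exact: loop_weight_le1. Qed.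

Lemma vertex_step_ge0 x y : 0 <= vertex_step x y.
Proof. exact: srw_step_ge0. Qed.

Lemma vertex_step_irr x : vertex_step x x = 0.
Proof. by rewrite /vertex_step /srw_step e_irr. Qed.

Lemma vertex_step_sum x : \sum_y vertex_step x y <= 1.
Proof.
have := @srw_step_sum R V e G (val x) e_lf.
by rewrite (@sum_fset_sub _ _ G G) //; under eq_bigl do rewrite fsvalP.
Qed.

Definition bound_vertices (F : {fset V} * {fset {fset V}}) : pred G :=
  fun x => is_root x || (val x \in F.1).

(* [f] records the arrows followed so far; its values off [F.1] are irrelevant
   except that the roots are its fixed points. *)
Definition encodes (f : G -> G) (F : {fset V} * {fset {fset V}}) : Prop :=
  [/\ (F.1 `<=` G)%fset,
    (forall x, val x \in F.1 -> ~~ is_root x /\ val (f x) \in F.1),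
    (forall x, is_root x -> f x = x) &
    forall a, a \in F.2 <-> exists2 x : G, val x \in F.1 & a = [fset val x; val (f x)]%fset].

Lemma encodes_closed f F : encodes f F ->
  forall x, bound_vertices F x -> bound_vertices F (f x).
Proof.
case=> _ fF fr _ x /orP[rx|xF]; apply/orP; first by left; rewrite fr.
by right; have [] := fF x xF.
Qed.

(** [one_walk] needs a single function of the path, whereas [killed_value] has a horizon. Since it
    increases with the horizon, the value with [k] steps left is at most the one with [k.+1], which
    is a one-step expectation of the former. *)
Lemma killed_value_step (F : {fset V} * {fset {fset V}})
  (Psi : lerw_state V -> R) k (v : G) (s : seq G) : (forall L, 0 <= Psi L) ->
  killed_value p U x0 F.1 Psi k (map val (v :: s)) <=
  \sum_y vertex_step (last v s) y *
     step_value vertex_loop_weight (bound_vertices F) (fun y => val y \in U)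
       (fun s => killed_value p U x0 F.1 Psi k (map val s))
       (fun L => Psi (map_state val L)) (v :: s) y.
Proof.
move=> P0; apply: (le_trans (killed_value_le _ _ _ _ _ _ P0)) => /=.
rewrite (sum_fset_sub _ UG) big_mkcond; apply: ler_sum => y _.
rewrite last_map /step_value /vertex_step; case: ifP => yU /=; last by rewrite mulr0.
apply: ler_wpM2l; first exact: srw_step_ge0.
rewrite /move_value /bound_vertices /is_root (negbTE (UW0 yU)) /=.
case: ifP => _; first by rewrite /map_state /= map_rcons.
rewrite -[val v :: map val s]/(map val (v :: s)) mem_map; last exact: val_inj.
rewrite index_map; last exact: val_inj.
case: ifP => _; last by rewrite -map_rcons.
by rewrite -map_drop -map_take.
Qed.

Section Phi.
Variables (phi : nat -> V) (Phi : {fset {fset V}} -> R) (m i : nat) (D : {fset V}).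
Hypothesis Phi_ge0 : forall A, 0 <= Phi A.
Hypothesis Phi_local : forall A B,
  (forall a, (a `<=` D)%fset -> (a \in A) = (a \in B)) -> Phi A = Phi B.
Hypothesis phiU : forall j, (j < i)%N -> phi j \in U.
Hypothesis phiD : forall x, x \in D -> exists2 j, (j < i)%N & x = phi j.

(** An edge inside [D] drawn by [f] is the arrow of an endpoint in [D], hence in [F.1]; the arrows
    not yet revealed add no edge inside [D]. *)
Lemma encodes_edges f F : encodes f F -> {subset D <= F.1} ->
  Phi F.2 = Phi (map_edges f).
Proof.
case=> FG fF fr F2 DF; apply: Phi_local => a aD.
apply/idP/mem_map_edges => [/F2[x xF ->]|[x rx ea]].
  by exists x => //; have [] := fF x xF.
apply/F2; exists x => //; apply: DF; apply: (fsubsetP aD).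
by rewrite ea !inE eqxx.
Qed.

Lemma encodes_followed (F : {fset V} * {fset {fset V}}) (v : G) (f : G -> G) :
  let W := bound_vertices F in
  ~~ W v -> encodes f F -> val (iter (exit_time v W f) f v) \in U ->
  encodes f (add_state F (map_state val (followed v W f))) /\
  bound_vertices (add_state F (map_state val (followed v W f))) =1
   (fun x => W x || (x \in traject f v (exit_time v W f))).
Proof.
move=> W Wv fF nU; have [FG fc fr F2] := fF; have fW := encodes_closed fF.
set n := exit_time v W f.
(* The exit vertex lies in [U], which contains no root, so it can only belong to the forest. *)
have Un (Wn : W (iter n f v)) : val (iter n f v) \in F.1.
  by case/orP: Wn => // rn; have := UW0 nU; rewrite -/n -/(is_root _) rn.
have memF z : val z \in (add_state F (map_state val (followed v W f))).1 <->
    (val z \in F.1) || (z \in traject f v n).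
  rewrite in_fsetU; split=> /orP[->//|].
    case/followed_vertices => [[j jn /val_inj ->]|[/Un Wn /val_inj ->]].
      by apply/orP; right; apply/trajectP; exists j.
    by rewrite Wn.
  move=> /trajectP[j jn ->]; apply/orP; right.
  by apply/followed_vertices; left; exists j.
have nr j : (j < n)%N -> ~~ is_root (iter j f v).
  by move=> jn; apply: contra (before_exit jn) => rj; apply/orP; left.
split; last first.
  by move=> x; rewrite /bound_vertices /W /bound_vertices -orbA; congr (_ || _); apply/idP/idP => /memF.
split=> //.
- rewrite fsubUset FG; apply/fsubsetP => z.
  by case/followed_vertices => [[j _ ->]|[_ ->]]; apply: fsvalP.
- move=> x /memF /orP[xF|/trajectP[j jn ->]].
    by have [rx fx] := fc x xF; split => //; apply/memF; rewrite fx.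
  split; first exact: nr.
  apply/memF; rewrite -iterS; move: jn; rewrite leq_eqVlt => /orP[/eqP ->|jn].
    have [/Un -> //|[_ ->]] := exit_or_loop v W f; by rewrite orbT.
  by apply/orP; right; apply/trajectP; exists j.+1.
- move=> a; rewrite in_fsetU; split=> [/orP[/F2[x xF ->]|/(followed_edges (@val_inj _ _ _) f Wv)[j jn ->]]|[x /memF/orP[xF|/trajectP[j jn ->]] ->]].
  + by exists x => //; apply/memF; rewrite xF.
  + by exists (iter j f v) => //; apply/memF/orP; right; apply/trajectP; exists j.
  + by apply/orP; left; apply/F2; exists x.
  + by apply/orP; right; apply/(followed_edges (@val_inj _ _ _) f Wv); exists j.
Qed.

Lemma encodes_agree f g F : encodes f F -> agree (bound_vertices F) f g -> encodes g F.
Proof.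
case=> FG fF fr F2 /forallP ok.
have gf x : bound_vertices F x -> g x = f x.
  by move=> Wx; have := ok x; rewrite Wx => /eqP.
split=> //.
- by move=> x xF; have /gf -> : bound_vertices F x by [apply/orP; right]; apply: fF.
- by move=> x rx; have /gf -> : bound_vertices F x by [apply/orP; left]; apply: fr.
- move=> a; rewrite F2; split=> -[x xF ->]; exists x => //; have /gf -> // : bound_vertices F x by apply/orP; right.
Qed.

(** The sum over maps that agree with [f0] on the bound vertices plays the role of conditioning on
    the arrows already revealed. In this form the statement reproduces itself after each walk, and
    the induction is on the number [r] of walks left. *)
Theorem many_walks r j F f0 : (r + j = i)%N -> encodes f0 F ->
  (forall l, (l < j)%N -> phi l \in F.1) ->
  forest_value p U x0 phi Phi m r j F *
    \sum_(f : {ffun G -> G} | agree (bound_vertices F) f0 f) Pi f <=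
  \sum_(f : {ffun G -> G} | agree (bound_vertices F) f0 f) Pi f * Phi (map_edges f).
Proof.
have Pi0 (f : G -> G) : 0 <= Pi f.
  by apply: map_weight_ge0; [exact: vertex_step_ge0|exact: vertex_loop_weight_ge0].
elim: r j F f0 => [|r IH] j F f0 rj f0F phiF /=.
  rewrite big_distrr /=; apply: ler_sum => f okf.
  rewrite mulrC (encodes_edges (encodes_agree f0F okf)) //.
  by move=> x /phiD[l li ->]; apply: phiF; rewrite -[j]add0n rj.
have ji : (j < i)%N by rewrite -rj addSn ltnS leq_addl.
set next := fun L => _.
case: ifP => [jF|jF].
  (* A walk started in the forest ends at time 0 and adds nothing. *)
  have eF : add_state F ([:: phi j], None) = F.
    case: F jF {f0F phiF next} => F1 F2 /= jF; congr pair => /=.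
      by apply/fsetUidPl/fsubsetP => z /imfsetP[y /=]; rewrite inE => /eqP -> ->.
    by apply/fsetP => a; rewrite !inE /= orbF; case: (mem_path_edges _ _) => [[]|]; rewrite ?orbF.
  rewrite /next eF; apply: IH; rewrite ?addnS // => l.
  by rewrite ltnS leq_eqVlt => /orP[/eqP -> //|]; apply: phiF.
have jG : phi j \in G := fsubsetP UG _ (phiU ji).
pose v : G := FSetSub jG.
pose W := bound_vertices F.
have Wv : ~~ W v by rewrite /W /bound_vertices /is_root negb_or /= UW0 ?phiU // jF.
have next0 L : 0 <= next L by apply: forest_value_ge0.
have W0W x : is_root x -> W x by move=> rx; apply/orP; left.
have phis k s : 0 <= killed_value p U x0 F.1 next k (map val (s : seq G)).
  exact: killed_value_ge0.
have := @one_walk R _ _ vertex_loop_weight_rot vertex_loop_weight_ge0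
  vertex_loop_weight_le1 _ is_root vertex_step_ge0 vertex_step_irr vertex_step_sum
  v W (fun y => val y \in U) Wv W0W f0 (encodes_closed f0F)
  (fun s => killed_value p U x0 F.1 next m (map val s))
  (fun L => next (map_state val L)) (phis m) (fun L => next0 _)
  (fun s => killed_value_step F m v s next0).
move=> /= H; apply: (le_trans H) => {H}.
(* Maps are grouped by the arrows known once the new walk has been followed. On each class the
   payoff is constant, and the class is again of the form [agree], with the followed path added to
   the prescribed vertices. *)
pose key (f : {ffun G -> G}) : {ffun G -> option G} :=
  [ffun x => if W x || (x \in traject f v (exit_time v W f)) then Some (f x) else None].
rewrite (partition_big key xpredT) // [leRHS](partition_big key xpredT) //=.
apply: ler_sum => K _.
have [f1 /andP[okf1 /eqP kf1]|none] :=
  pickP (fun f : {ffun G -> G} => agree W f0 f && (key f == K)); last first.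
  by rewrite !big_pred0.
have f1F := encodes_agree f0F okf1.
pose W1 x := W x || (x \in traject f1 v (exit_time v W f1)).
have agr_fol (f : {ffun G -> G}) : agree W1 f1 f ->
    exit_time v W f = exit_time v W f1 /\
    (forall l, (l <= exit_time v W f1)%N -> iter l f v = iter l f1 v).
  move=> /forallP ok; apply: followed_agree => // [x Wx|l ln].
    by apply/eqP; have := ok x; rewrite /W1 Wx.
  apply/eqP; have := ok (iter l f1 v); rewrite /W1.
  suff -> : iter l f1 v \in traject f1 v (exit_time v W f1) by rewrite orbT.
  by apply/trajectP; exists l.
have agr_tr (f : {ffun G -> G}) : agree W1 f1 f ->
    traject f v (exit_time v W f) = traject f1 v (exit_time v W f1).
  move=> /agr_fol[-> it]; apply: (eq_from_nth (x0 := v)); rewrite !size_traject // => k kj.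
  by rewrite !nth_traject // it // ltnW.
have keyE (f : {ffun G -> G}) : agree W f0 f && (key f == K) = agree W1 f1 f.
  apply/andP/idP => [[okf /eqP kf]|ok].
    apply/forallP => x; apply/implyP => W1x.
    have /ffunP/(_ x) : key f1 = key f by rewrite kf1 kf.
    by rewrite !ffunE -/(W1 x) W1x; case: ifP => // _ [->].
  split.
    apply/forallP => x; apply/implyP => Wx; move/forallP/(_ x): ok.
    by rewrite /W1 Wx => /eqP ->; move/forallP/(_ x): okf1; rewrite Wx.
  apply/eqP/ffunP => x; rewrite -kf1 !ffunE (agr_tr f ok).
  by case: ifP => // W1x; move/forallP/(_ x): ok; rewrite /W1 W1x => /eqP ->.
rewrite (eq_bigl _ _ keyE) [leRHS](eq_bigl _ _ keyE).
have folE (f : {ffun G -> G}) : agree W1 f1 f ->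
    Pi f * followed_payoff v W (fun y => val y \in U) f (fun L => next (map_state val L)) =
    followed_payoff v W (fun y => val y \in U) f1 (fun L => next (map_state val L)) * Pi f.
  move=> ok; rewrite mulrC; congr (_ * _); have [en it] := agr_fol f ok.
  by rewrite /followed_payoff /followed (agr_tr f ok) en it.
rewrite (eq_bigr _ folE) -big_distrr /= /followed_payoff.
case: ifP => nU; last first.
  by rewrite mul0r; apply: sumr_ge0 => f _; rewrite mulr_ge0.
have [enc eW1] := encodes_followed Wv f1F nU.
have eA : agree W1 f1 =1 agree (bound_vertices (add_state F (map_state val (followed v W f1)))) f1.
  by move=> f; apply: eq_forallb => x; rewrite eW1.
under eq_bigl do rewrite eA.
under [leRHS]eq_bigl do rewrite eA.
apply: IH => //; first by rewrite addnS.
move=> l; rewrite ltnS leq_eqVlt in_fsetU => /orP[/eqP ->|/phiF -> //].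
apply/orP; right; apply/followed_vertices; left.
by exists 0%N => //; apply: exit_time_gt0.
Qed.

End Phi.
End ManyWalks.

(** * Forests as functional graphs *)

Section CyclicLists.
Variable T : eqType.
Implicit Types (c : seq T) (f : T -> T).

Lemma next_closed c (P : pred T) x : uniq c -> x \in c ->
  (forall y, y \in c -> P y -> P (next c y)) -> P x -> {in c, forall y, P y}.
Proof.
move=> uc xc cl Px.
have cyc : cycle (fun a b => P a ==> P b) c.
  by apply: cycle_from_next => // y yc; apply/implyP; apply: cl.
have [i s es] := rot_to xc.
rewrite -(rot_cycle i) es /= rcons_path in cyc.
have tr : transitive (fun a b => P a ==> P b).
  by move=> b a d /implyP ab /implyP bd; apply/implyP => /ab /bd.
case/andP: cyc => /(order_path_min tr) /allP al _ y.
by rewrite -(mem_rot i) es inE => /orP[/eqP -> //|/al /implyP]; apply.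
Qed.

Lemma next_next_neq c x : uniq c -> (2 < size c)%N -> x \in c ->
  next c (next c x) != x.
Proof.
move=> uc sc xc; have [i s es] := rot_to xc.
have ur : uniq (x :: s) by rewrite -es rot_uniq.
rewrite -!(next_rot i uc) es.
have sr : (2 < size (x :: s))%N by rewrite -es size_rot.
case: s ur sr {es} => [|y [|z s]] //=.
rewrite !inE !negb_or => /and4P[/and3P[xy xz xs] /andP[yz ys] zs us] _.
by rewrite eqxx (eq_sym y x) (negbTE xy) eqxx eq_sym.
Qed.

(* Around a simple cycle, [f] cannot map one vertex to both of its neighbours,
   hence the direction of the arrows is the same on all edges. *)
Lemma oriented_or_reversed c f : uniq c -> (2 < size c)%N ->
  cycle (fun x y => (f x == y) || (f y == x)) c ->
  cycle (frel f) c \/ cycle (frel f) (rev c).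
Proof.
move=> uc sc cyc.
have [allA|/allPn[x xc nA]] := boolP (all (fun x => f x == next c x) c).
  by left; apply: cycle_from_next => // x xc; apply: (allP allA).
right.
have nAll : {in c, forall y, f y != next c y}.
  apply: (@next_closed c (fun y => f y != next c y) x) => // y yc; apply: contraNneq => fy.
  have := next_cycle cyc yc => /orP[//|].
  rewrite fy => /eqP e; have := next_next_neq uc sc yc.
  by rewrite e eqxx.
apply: cycle_from_next; first by rewrite rev_uniq.
move=> y; rewrite mem_rev => yc; rewrite next_rev //=.
have pc : prev c y \in c by rewrite mem_prev.
have := next_cycle cyc pc; rewrite /= (negbTE (nAll _ pc)) /=.
by rewrite next_prev.
Qed.

End CyclicLists.

Lemma cycle_edges_rot (V : countType) (c : seq V) k : uniq c ->
  cycle_edges (rot k c) = cycle_edges c.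
Proof.
move=> uc; apply/fsetP => a; apply/mem_cycle_edges/mem_cycle_edges => -[x xc ->];
  by exists x; rewrite ?next_rot // ?mem_rot // -(mem_rot k).
Qed.

Lemma cycle_edges_rev (V : countType) (c : seq V) : uniq c ->
  cycle_edges (rev c) = cycle_edges c.
Proof.
move=> uc; apply/fsetP => a; apply/mem_cycle_edges/mem_cycle_edges => -[x xc ->].
  rewrite mem_rev in xc; exists (prev c x); first by rewrite mem_prev.
  by rewrite next_rev // next_prev // fsetUC.
exists (next c x); first by rewrite mem_rev mem_next.
by rewrite next_rev // prev_next // fsetUC.
Qed.

Lemma mem_cycles (V : countType) (F : {fset {fset V}}) C :
  reflect (exists2 c, simple_cycle (subgraph_adj F) c & cycle_edges c = C)
    (C \in cycles F).
Proof.
apply: (iffP idP) => [|[c sc ec]]; rewrite /cycles ?in_fset /= inE.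
  by case/andP => _ /asboolP.
apply/andP; split; last by apply/asboolP; exists c.
rewrite fpowersetE -ec; apply/fsubsetP => a /mem_cycle_edges[x xc ->].
by case/and3P: sc => _ _ /next_cycle/(_ xc).
Qed.

Lemma fset_seq (V : choiceType) (G : {fset V}) (s : seq V) :
  {subset s <= G} -> exists s' : seq G, s = map val s'.
Proof.
elim: s => [|z s IH] sG; first by exists [::].
have [|s' ->] := IH; first by move=> y ys; apply: sG; rewrite inE ys orbT.
by exists (FSetSub (sG _ (mem_head z s)) :: s').
Qed.

(** * Cycles and weight of the graph drawn by an admissible map *)

Section Arrows.
Variables (R : realType) (V : countType) (e : rel V) (p : cycle_weight R e).
Hypothesis e_sym : symmetric e.
Hypothesis e_irr : irreflexive e.
Variables (G W0 : {fset V}).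
Implicit Types (f g : G -> G) (x y : G).

Local Notation is_root := (@is_root V G W0).
Local Notation map_edges := (@map_edges V G W0).
Local Notation lw := (@vertex_loop_weight R V e p G).

(** Forbidding [f (f x) = x] loses no weight, since such a pair has loop weight 0, and it makes
    distinct non-roots draw distinct edges. *)
Definition admissible f :=
  [forall x, if is_root x then f x == x else e (val x) (val (f x)) && (f (f x) != x)].

Lemma admissibleP f : reflect
  ((forall x, is_root x -> f x = x) /\
   (forall x, ~~ is_root x -> e (val x) (val (f x)) /\ f (f x) != x))
  (admissible f).
Proof.
apply: (iffP forallP) => [H|[H1 H2] x].
  split=> x rx; have := H x; first by rewrite rx => /eqP.
  by rewrite (negbTE rx) => /andP.
by case: ifPn => rx; [rewrite H1|have [-> ->] := H2 x rx].
Qed.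

Lemma val_fset_eq (x y a b : V) :
  [fset x; y]%fset = [fset a; b]%fset -> x = a /\ y = b \/ x = b /\ y = a.
Proof.
move=> E; have: x \in [fset a; b]%fset by rewrite -E !inE eqxx.
have: y \in [fset a; b]%fset by rewrite -E !inE eqxx orbT.
have: a \in [fset x; y]%fset by rewrite E !inE eqxx.
have: b \in [fset x; y]%fset by rewrite E !inE eqxx orbT.
rewrite !inE => /orP[]/eqP h1 /orP[]/eqP h2 /orP[]/eqP h3 /orP[]/eqP h4;
  by [left; split; congruence|right; split; congruence].
Qed.

Section Admissible.
Variable f : G -> G.
Hypothesis fadm : admissible f.

Lemma periodic_nonroot x : periodic f x -> ~~ is_root x.
Proof.
have [fr _] := admissibleP _ fadm.
by case/andP => _; apply: contra => /fr ->.
Qed.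

Lemma nonroot_neq x : ~~ is_root x -> f x != x.
Proof.
have [_ fn] := admissibleP _ fadm => /fn[+ _].
by apply: contraTneq => ->; rewrite e_irr.
Qed.

Lemma orbit_periodic x : periodic f x ->
  [/\ fcycle f (orbit f x), uniq (orbit f x) & (2 < size (orbit f x))%N].
Proof.
move=> px; have cx : fcycle f (orbit f x) by rewrite -fconnect_f; case/andP: px.
split; rewrite ?orbit_uniq //.
have [_ fn] := admissibleP _ fadm; have [_ ffx] := fn x (periodic_nonroot px).
have fx : f x != x by case/andP: px.
have := iter_order_cycle cx (in_orbit f x) (in_orbit f x).
rewrite size_orbit; case: (order f x) (order_gt0 f x) => [|[|[|n]]] //= _ /eqP.
  by rewrite (negbTE fx).
by rewrite (negbTE ffx).
Qed.

Lemma orbit_nonroot x y : periodic f x -> y \in orbit f x -> periodic f y /\ ~~ is_root y.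
Proof.
move=> px yx; have yx' : y \in orbit_set f x by rewrite inE.
by have [py _ _] := orbit_set_rot px yx'; split=> //; apply: periodic_nonroot.
Qed.

Definition orbit_edges x : {fset {fset V}} := cycle_edges (map val (orbit f x)).

Lemma next_orbit x y : periodic f x -> y \in orbit f x ->
  next (map val (orbit f x)) (val y) = val (f y).
Proof.
move=> px yx; have [cx ux _] := orbit_periodic px.
rewrite (next_map val_inj) //.
by rewrite (eqP (next_cycle cx yx)).
Qed.

Lemma mem_orbit_edges x a : periodic f x ->
  reflect (exists2 y, y \in orbit f x & a = [fset val y; val (f y)]%fset)
    (a \in orbit_edges x).
Proof.
move=> px; apply: (iffP (mem_cycle_edges _ _)) => [[_ /mapP[y yx ->] ->]|[y yx ->]].
  by exists y => //; rewrite next_orbit.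
by exists (val y); [apply: map_f|rewrite next_orbit].
Qed.

Lemma orbit_simple_cycle x : periodic f x ->
  simple_cycle (subgraph_adj (map_edges f)) (map val (orbit f x)).
Proof.
move=> px; have [cx ux sx] := orbit_periodic px.
apply/and3P; split; first by rewrite size_map.
  by rewrite (map_inj_uniq val_inj).
apply: cycle_from_next; first by rewrite (map_inj_uniq val_inj).
move=> _ /mapP[y yx ->]; rewrite next_orbit // /subgraph_adj.
by apply/mem_map_edges; exists y => //; have [] := orbit_nonroot px yx.
Qed.

Lemma map_edges_sub : subrel (subgraph_adj (map_edges f)) e.
Proof.
have [fr fn] := admissibleP _ fadm.
move=> x y /mem_map_edges[z /fn[ez _] /val_fset_eq[[-> ->]|[-> ->]]] //.
by rewrite e_sym.
Qed.

(** Every edge of the cycle is an arrow in one of its two directions, and [oriented_or_reversed]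
    makes these directions agree; the list is then an orbit read forwards or backwards. *)
Lemma simple_cycle_map_edges c :
  simple_cycle (subgraph_adj (map_edges f)) c ->
  exists x, periodic f x /\ exists k,
    c = map val (rot k (orbit f x)) \/ c = map val (rot k (rev (orbit f x))).
Proof.
case/and3P => sc uc cyc.
have cG z : z \in c -> z \in G.
  move=> zc; have := next_cycle cyc zc => /mem_map_edges[y _ E].
  have : z \in [fset val y; val (f y)]%fset by rewrite -E !inE eqxx.
  by rewrite !inE => /orP[]/eqP ->; apply: fsvalP.
have [c' ec] := fset_seq cG.
have uc' : uniq c' by move: uc; rewrite ec (map_inj_uniq val_inj).
have sc' : (2 < size c')%N by move: sc; rewrite ec size_map.
have cyc' : cycle (fun x y => (f x == y) || (f y == x)) c'.
  move: cyc; rewrite ec cycle_map; apply: sub_cycle => x y /mem_map_edges[z rz].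
  by move=> /val_fset_eq[[/val_inj -> /val_inj ->]|[/val_inj -> /val_inj ->]]; rewrite eqxx ?orbT.
have main c1 : uniq c1 -> (2 < size c1)%N -> fcycle f c1 ->
    exists x, periodic f x /\ exists k, c1 = rot k (orbit f x).
  case: c1 => // x c1 u1 s1 f1; exists x.
  have xc : x \in x :: c1 by rewrite mem_head.
  have eo : orbit f x = x :: c1.
    by rewrite (orbitE f1 u1 xc) /= eqxx rot0.
  split; last by exists 0%N; rewrite rot0.
  rewrite /periodic fconnect_f eo f1 /=; apply/negP => /eqP fx.
  have /eqP nx : f x == next (x :: c1) x := next_cycle f1 xc.
  by have := next_next_neq u1 s1 xc; rewrite -nx fx -nx fx eqxx.
have [f1|f1] := oriented_or_reversed uc' sc' cyc'.
  have [x [px [k ek]]] := main c' uc' sc' f1; exists x; split => //.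
  by exists k; left; rewrite ec ek.
have [||x [px [k ek]]] := main (rev c') _ _ f1; rewrite ?rev_uniq ?size_rev //.
exists x; split=> //; exists (size (orbit f x) - k)%N; right.
rewrite ec -[c' in LHS]revK ek rev_rot; congr (map _ _).
by rewrite /rotr size_rev.
Qed.

Lemma orbit_uniq_val x : uniq (map val (orbit f x)).
Proof. by rewrite (map_inj_uniq val_inj) orbit_uniq. Qed.

Lemma simple_cycle_edges x k c : 
  c = map val (rot k (orbit f x)) \/ c = map val (rot k (rev (orbit f x))) ->
  cycle_edges c = orbit_edges x.
Proof.
have ux := orbit_uniq_val x.
case=> ->; rewrite map_rot; first exact: cycle_edges_rot.
by rewrite map_rev cycle_edges_rot ?rev_uniq // cycle_edges_rev.
Qed.

Lemma cycles_map_edges C : reflect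
  (exists2 x, periodic f x & C = orbit_edges x) (C \in cycles (map_edges f)).
Proof.
apply: (iffP (mem_cycles _ _)) => [[c sc <-]|[x px ->]]; last first.
  by exists (map val (orbit f x)) => //; apply: orbit_simple_cycle.
have [x [px [k ek]]] := simple_cycle_map_edges sc.
by exists x => //; apply: simple_cycle_edges ek.
Qed.

Lemma orbit_edges_vertex x y : periodic f x -> periodic f y ->
  orbit_edges x = orbit_edges y -> orbit_set f x = orbit_set f y.
Proof.
move=> px py exy.
have : [fset val x; val (f x)]%fset \in orbit_edges y.
  by rewrite -exy; apply/mem_orbit_edges => //; exists x; rewrite ?in_orbit.
case/(mem_orbit_edges _ py) => z zy /val_fset_eq[[/val_inj ez _]|[/val_inj ez _]].
  by have [_ ->] : [/\ periodic f x, orbit_set f x = orbit_set f y & True]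
    by have [] := @orbit_set_rot _ f y x py; rewrite ?inE ez //.
have fzy := mem_orbit zy.
have [] := @orbit_set_rot _ f y x py; rewrite ?inE ez //.
Qed.

(** The representative chosen by [xget] is a rotation of the orbit or of its reverse, and the sum is
    symmetric in the two orientations. *)
Lemma unoriented_weight_orbit x : periodic f x ->
  unoriented_weight p (orbit_edges x) = lw (orbit f x) + lw (rev (orbit f x)).
Proof.
move=> px; rewrite /unoriented_weight.
set c := xget _ _.
have [sc ec] : simple_cycle e c /\ cycle_edges c = orbit_edges x.
  apply: (@xgetPex _ [::] [set c | simple_cycle e c /\ cycle_edges c = orbit_edges x]%classic).
  exists (map val (orbit f x)); split=> //.
  have /and3P[s1 u1 c1] := orbit_simple_cycle px.
  by apply/and3P; split=> //; apply: sub_cycle c1; apply: map_edges_sub.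
have [x' [px' [k ek]]] : exists x', periodic f x' /\ exists k,
    c = map val (rot k (orbit f x')) \/ c = map val (rot k (rev (orbit f x'))).
  apply: simple_cycle_map_edges; case/and3P: sc => s1 u1 c1.
  apply/and3P; split=> //; apply: cycle_from_next => // z zc.
  have : [fset z; next c z]%fset \in orbit_edges x.
    by rewrite -ec; apply/mem_cycle_edges; exists z.
  case/(mem_orbit_edges _ px) => y yx E.
  rewrite /subgraph_adj E; apply/mem_map_edges; exists y => //.
  by have [] := orbit_nonroot px yx.
have es : orbit_set f x' = orbit_set f x.
  by apply: orbit_edges_vertex => //; rewrite -(simple_cycle_edges ek).
have [_ _ [l el]] : [/\ periodic f x', orbit_set f x' = orbit_set f x &
    exists k, orbit f x' = rot k (orbit f x)].
  by apply: orbit_set_rot => //; rewrite -es mem_orbit_set.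
have lwrot s n : loop_weight p (map val (rot n s)) = lw s.
  by rewrite map_rot loop_weight_rot.
have rrot (s : seq G) n : exists n', rev (rot n s) = rot n' (rev s).
  by rewrite rev_rot /rotr; eexists.
case: ek => ->.
  rewrite -map_rev lwrot; have [n ->] := rrot (orbit f x') k; rewrite lwrot.
  by rewrite el; have [n' ->] := rrot (orbit f x) l; rewrite !/lw !lwrot.
rewrite -map_rev lwrot; have [n ->] := rrot (rev (orbit f x')) k; rewrite lwrot revK.
by rewrite el; have [n' ->] := rrot (orbit f x) l; rewrite addrC !/lw !lwrot.
Qed.

(** [E] sends the vertex set of an orbit to its edge set; it is injective on [cycle_sets f] and its
    image is the set of cycles of the graph. *)
Lemma forest_weight_map_edges :
  forest_weight p (map_edges f) =
  \prod_(C in cycle_sets f)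
     (if [pick x in C] is Some x then lw (orbit f x) + lw (rev (orbit f x)) else 1).
Proof.
pose E (C : {set G}) := if [pick x in C] is Some x then orbit_edges x else fset0.
have EC C : C \in cycle_sets f -> exists x, [/\ periodic f x, C = orbit_set f x & [pick x in C] = Some x].
  move=> fC; case: pickP => [x xC|none].
    by have [px eC _] := cycle_setsP (@vertex_loop_weight_rot R V e p G) fC xC; exists x.
  by case/imsetP: fC none => x _ -> /(_ x); rewrite mem_orbit_set.
have E_inj : {in cycle_sets f &, injective E}.
  move=> C C' /EC[x [px eC pC]] /EC[x' [px' eC' pC']].
  by rewrite /E pC pC' eC eC'; apply: orbit_edges_vertex.
have pe : perm_eq (cycles (map_edges f)) [seq E C | C <- enum (cycle_sets f)].
  apply: uniq_perm; first exact: fset_uniq.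
    by rewrite map_inj_in_uniq ?enum_uniq // => C C'; rewrite !mem_enum; apply: E_inj.
  move=> C; apply/idP/mapP => [/cycles_map_edges[x px ->]|[S]].
    exists (orbit_set f x); first by rewrite mem_enum; apply: orbit_set_cycle.
    have [x' [px' eC pC]] := EC _ (orbit_set_cycle px).
    have oe z : (z \in orbit f x) = (z \in orbit f x').
      by have /setP/(_ z) := eC; rewrite !inE.
    rewrite /E pC; apply/fsetP => a.
    by apply/mem_orbit_edges/mem_orbit_edges => // -[y yx ->]; exists y; rewrite // ?oe // -oe.
  rewrite mem_enum => /EC[x [px eS pS]] ->.
  by rewrite /E pS; apply/cycles_map_edges; exists x.
rewrite /forest_weight (perm_big _ pe) big_map big_enum; apply: eq_bigr => C /EC[x [px eC pC]].
by rewrite /E pC unoriented_weight_orbit.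
Qed.

End Admissible.
End Arrows.

Lemma prod_add_subsets (R : comPzRingType) (I : finType) (A : {set I}) (a b : I -> R) :
  \prod_(i in A) (a i + b i) =
  \sum_(S : {set I} | S \subset A) \prod_(i in A) (if i \in S then b i else a i).
Proof.
rewrite big_mkcond /= (eq_bigr (fun i => (if i \in A then b i else 0) +
   (if i \in A then a i else 1))); last by move=> i _; case: ifP; rewrite ?add0r 1?addrC.
rewrite bigA_distr [RHS]big_mkcond /=; apply: eq_bigr => S _; case: ifP => [SA|/negbT SA].
  rewrite [RHS]big_mkcond /=; apply: eq_bigr => i _.
  case: ifP => iS; last by [].
  by rewrite (fintype.subsetP SA).
have /subsetPn[i iS iA] := SA.
by rewrite (bigD1 i) //= iS (negbTE iA) mul0r.
Qed.

(** * Maps with the same edges differ by reversed cycles *)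

Section Flips.
Variables (R : realType) (V : countType) (e : rel V) (p : cycle_weight R e).
Hypothesis e_sym : symmetric e.
Hypothesis e_irr : irreflexive e.
Variables (G W0 : {fset V}).

Local Notation is_root := (@is_root V G W0).
Local Notation map_edges := (@map_edges V G W0).
Local Notation admissible := (@admissible V e G W0).
Local Notation lw := (@vertex_loop_weight R V e p G).
Let lw_rot := @vertex_loop_weight_rot R V e p G.

Variable f0 : G -> G.
Hypothesis f0adm : admissible f0.

Let f0_root x : is_root x -> f0 x = x.
Proof. by have [+ _] := admissibleP _ _ _ f0adm; apply. Qed.

Let f0_edge x : ~~ is_root x -> e (val x) (val (f0 x)).
Proof. by have [_ fn] := admissibleP _ _ _ f0adm => /fn[]. Qed.

Let f0_neq2 x : ~~ is_root x -> f0 (f0 x) != x.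
Proof. by have [_ fn] := admissibleP _ _ _ f0adm => /fn[]. Qed.

(** On a cycle, [finv f0] is the predecessor, so this reverses exactly the cycles of [S]. *)
Definition flip (S : {set {set G}}) (x : G) : G :=
  if x \in finset.cover S then finv f0 x else f0 x.

Lemma cycle_set_finv C x : C \in cycle_sets f0 -> x \in C ->
  [/\ ~~ is_root x, f0 x \in C, finv f0 x \in C,
    f0 (finv f0 x) = x & finv f0 (f0 x) = x].
Proof.
move=> fC xC; have [px eC _] := cycle_setsP lw_rot fC xC.
have [cx ux _] := orbit_periodic f0adm px.
have xo := in_orbit f0 x.
split; first exact: (periodic_nonroot f0adm).
- by rewrite eC inE mem_orbit.
- by rewrite eC inE; apply: finv_cycle.
- exact: (f_finv_cycle cx).
- exact: (finv_f_cycle cx).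
Qed.

Lemma cycle_sets_eq C C' x : C \in cycle_sets f0 -> C' \in cycle_sets f0 ->
  x \in C -> x \in C' -> C = C'.
Proof.
move=> fC fC' xC xC'; have [_ -> _] := cycle_setsP lw_rot fC xC.
by have [_ -> _] := cycle_setsP lw_rot fC' xC'.
Qed.

Section FlipSet.
Variable S : {set {set G}}.
Hypothesis S_sub : S \subset cycle_sets f0.

Lemma mem_cover_cycle C x : C \in cycle_sets f0 -> x \in C ->
  (x \in finset.cover S) = (C \in S).
Proof.
move=> fC xC; apply/finset.bigcupP/idP => [[C' SC' xC']|SC]; last by exists C.
by rewrite (@cycle_sets_eq C C' x) // (fintype.subsetP S_sub).
Qed.

Lemma coverP x : x \in finset.cover S -> exists C, [/\ C \in S, C \in cycle_sets f0 & x \in C].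
Proof. by case/finset.bigcupP => C SC xC; exists C; split=> //; apply: (fintype.subsetP S_sub). Qed.

Lemma flip_admissible : admissible (flip S).
Proof.
apply/admissibleP; split=> x rx; rewrite /flip; case: ifP => xS.
- have [C [_ fC xC]] := coverP xS.
  by have [] := cycle_set_finv fC xC; rewrite rx.
- exact: f0_root.
- have [C [SC fC xC]] := coverP xS.
  have [_ _ yC fy _] := cycle_set_finv fC xC.
  have [ry _ zC fz _] := cycle_set_finv fC yC.
  rewrite (mem_cover_cycle fC yC) SC; split.
    by have := f0_edge ry; rewrite fy e_sym.
  apply: contra (f0_neq2 rx) => /eqP zx.
  by rewrite zx in fz; rewrite fz fy.
- split; first exact: f0_edge.
  case: ifP => yS; last exact: f0_neq2.
  have [C [SC fC yC]] := coverP yS.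
  have [_ _ zC _ _] := cycle_set_finv fC yC.
  by apply: contraFneq xS => zx; rewrite -zx (mem_cover_cycle fC zC).
Qed.

Lemma flip_edges : map_edges (flip S) = map_edges f0.
Proof.
apply/fsetP => a; apply/mem_map_edges/mem_map_edges => -[x rx ->].
  rewrite /flip; case: ifP => xS; last by exists x.
  have [C [SC fC xC]] := coverP xS.
  have [_ _ yC fy _] := cycle_set_finv fC xC.
  have [ry _ _ _ _] := cycle_set_finv fC yC.
  by exists (finv f0 x) => //; rewrite fy fsetUC.
have [xS|xS] := boolP (x \in finset.cover S); last by exists x; rewrite // /flip (negbTE xS).
have [C [SC fC xC]] := coverP xS.
have [_ yC _ _ fy] := cycle_set_finv fC xC.
have [ry _ _ _ _] := cycle_set_finv fC yC.
by exists (f0 x); rewrite // /flip (mem_cover_cycle fC yC) SC fy fsetUC.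
Qed.

Definition reversed_weight (C : {set G}) : R :=
  if [pick x in C] is Some x then lw (rev (orbit f0 x)) else 0.

Lemma flip_cycle_set C : C \in cycle_sets f0 ->
  C \in cycle_sets (flip S) /\
  cycle_set_weight lw (flip S) C =
    if C \in S then reversed_weight C else cycle_set_weight lw f0 C.
Proof.
move=> fC; case: ifPn => SC; last first.
  have agr : {in C, f0 =1 flip S}.
    by move=> x xC; rewrite /flip (mem_cover_cycle fC xC) (negbTE SC).
  by have [? ->] := cycle_sets_agree lw_rot agr fC.
have [x xC] : exists x, x \in C.
  by case/imsetP: (fC) => x _ ->; exists x; apply: mem_orbit_set.
rewrite /reversed_weight; case: pickP => [{xC} {}x xC|/(_ x)]; last by rewrite xC.
have [px eC _] := cycle_setsP lw_rot fC xC.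
have [cx ux sx] := orbit_periodic f0adm px.
have memC z : (z \in orbit f0 x) = (z \in C) by rewrite eC inE.
have cr : fcycle (flip S) (rev (orbit f0 x)).
  apply: cycle_from_next; first by rewrite rev_uniq.
  move=> z; rewrite mem_rev => zo; rewrite next_rev //= (prevE cx) //.
  by rewrite /flip (mem_cover_cycle fC) ?SC // -memC.
have ur : uniq (rev (orbit f0 x)) by rewrite rev_uniq.
have xr : x \in rev (orbit f0 x) by rewrite mem_rev in_orbit.
have eo := orbitE cr ur xr.
have pf : periodic (flip S) x.
  rewrite /periodic fconnect_f eo rot_cycle cr /=.
  apply: (nonroot_neq e_irr flip_admissible); exact: (periodic_nonroot f0adm px).
have eS : orbit_set (flip S) x = C.
  by apply/setP => z; rewrite inE eo mem_rot mem_rev memC.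
have fS : C \in cycle_sets (flip S) by rewrite -eS; apply: orbit_set_cycle.
split=> //; have [_ _ ->] := cycle_setsP lw_rot fS xC.
by rewrite eo lw_rot.
Qed.

Lemma flip_cycle_sets : cycle_sets (flip S) = cycle_sets f0.
Proof.
apply/setP => C; apply/idP/idP => [SC|fC]; last by have [] := flip_cycle_set fC.
have [/exists_inP[z zC zS]|none] := boolP [exists z in C, z \in finset.cover S].
  have [C' [SC' fC' zC']] := coverP zS; have [SfC' _] := flip_cycle_set fC'.
  have [_ -> _] := cycle_setsP lw_rot SC zC.
  by have [_ <- _] := cycle_setsP lw_rot SfC' zC'.
have agr : {in C, flip S =1 f0}.
  move=> z zC; rewrite /flip ifN //; apply: contra none => zS.
  by apply/exists_inP; exists z.
by have [] := cycle_sets_agree lw_rot agr SC.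
Qed.

End FlipSet.

Definition flipped (f : G -> G) : {set {set G}} :=
  [set C in cycle_sets f0 | [exists x in C, f x != f0 x]].

Lemma flippedK (S : {set {set G}}) : S \subset cycle_sets f0 -> flipped (flip S) = S.
Proof.
move=> SS; apply/setP => C; rewrite inE; apply/andP/idP => [[fC /exists_inP[x xC]]|SC].
  rewrite /flip; case: ifP; rewrite ?eqxx // => xS _.
  by rewrite -(mem_cover_cycle SS fC xC).
have fC := fintype.subsetP SS _ SC; split=> //.
have [x xC] : exists x, x \in C.
  by case/imsetP: (fC) => x _ ->; exists x; apply: mem_orbit_set.
apply/exists_inP; exists x => //; rewrite /flip (mem_cover_cycle SS fC xC) SC.
have [rx _ _ fy _] := cycle_set_finv fC xC.
by apply: contra (f0_neq2 rx) => /eqP <-; rewrite fy.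
Qed.

(* If two maps have the same edges, then where they differ each inverts the
   other, so the set where they differ consists of whole cycles. *)
Lemma flip_flipped f : admissible f -> map_edges f = map_edges f0 ->
  flip (flipped f) =1 f.
Proof.
move=> fadm ef.
have [fr fn] := admissibleP _ _ _ fadm.
have back x : f x != f0 x -> f (f0 x) = x.
  move=> ne; have rx : ~~ is_root x.
    by apply: contra ne => rx; rewrite fr // f0_root.
  have : [fset val x; val (f0 x)]%fset \in map_edges f.
    by rewrite ef; apply/mem_map_edges; exists x.
  case/mem_map_edges => y ry /val_fset_eq[[/val_inj exy /val_inj e2]|[/val_inj exy /val_inj e2]].
    by rewrite exy in e2 ne *; rewrite e2 eqxx in ne.
  by rewrite e2.
pose D := [pred x | f x != f0 x].
have Dnr x : x \in D -> ~~ is_root x.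
  by apply: contra => rx; rewrite fr // f0_root.
have Dcl : {homo f0 : x / x \in D}.
  move=> x xD; rewrite inE /= back //; apply: contra (f0_neq2 (Dnr x xD)) => /eqP <-.
  by [].
have Dinj : {in D &, injective f0}.
  by move=> x y xD yD exy; rewrite -(back x xD) exy back.
have Dcyc x : x \in D -> periodic f0 x.
  move=> xD; rewrite /periodic fconnect_f (cycle_orbit_in Dcl Dinj xD) /=.
  exact: (nonroot_neq e_irr f0adm (Dnr x xD)).
have Dorb x y : x \in D -> y \in orbit f0 x -> y \in D.
  move=> xD; rewrite -fconnect_orbit => /iter_findex <-.
  by elim: (findex _ _ _) => //= n; apply: Dcl.
move=> x; rewrite /flip; case: ifP => xS.
  have /finset.bigcupP[C] := xS; rewrite inE => /andP[fC /exists_inP[z zC zD]] xC.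
  have [_ eC _] := cycle_setsP lw_rot fC zC.
  have xD : x \in D by apply: (Dorb z) => //; rewrite -[_ \in _]andTb; move: xC; rewrite eC inE.
  have yD := finv_in Dcl xD.
  by rewrite -[in RHS](f_finv_in Dcl Dinj xD) back.
apply/esym/eqP; apply: contraFT xS => xD.
apply/finset.bigcupP; exists (orbit_set f0 x); last exact: mem_orbit_set.
rewrite inE orbit_set_cycle ?Dcyc //=.
by apply/exists_inP; exists x => //; apply: mem_orbit_set.
Qed.

(** [prod_add_subsets] expands the product over cycles of the two orientation weights into a sum
    over the sets [S] of reversed cycles; [flip], with inverse [flipped], matches these sets with
    the maps that have the given edges. *)
Lemma sum_same_edges :
  \sum_(f : {ffun G -> G} | admissible f && (map_edges f == map_edges f0))
     \prod_(C in cycle_sets f) cycle_set_weight lw f C =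
  forest_weight p (map_edges f0).
Proof.
rewrite (forest_weight_map_edges p e_sym f0adm).
rewrite (eq_bigr (fun C => cycle_set_weight lw f0 C + reversed_weight C)); last first.
  move=> C fC; rewrite /cycle_set_weight /reversed_weight.
  case: pickP => // none; case/imsetP: fC none => x _ -> /(_ x).
  by rewrite mem_orbit_set.
rewrite prod_add_subsets (reindex_onto (fun S => [ffun x => flip S x])
  (fun f : {ffun G -> G} => flipped f)) /=; last first.
  move=> f /andP[fadm /eqP ef]; apply/ffunP => x; rewrite ffunE.
  exact: flip_flipped.
have ext (S : {set {set G}}) : ([ffun x => flip S x] : G -> G) = flip S.
  by apply/funext => x; rewrite ffunE.
apply: eq_big => S; rewrite ext.
  apply/andP/idP => [[_ /eqP <-]|SS]; first by apply/fintype.subsetP => C; rewrite inE => /andP[].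
  by rewrite flip_admissible // flip_edges // flippedK // !eqxx.
move=> /andP[_ /eqP eS].
have SS : S \subset cycle_sets f0 by rewrite -eS; apply/fintype.subsetP => C; rewrite inE => /andP[].
rewrite flip_cycle_sets //; apply: eq_bigr => C fC.
by have [_ ->] := flip_cycle_set SS fC.
Qed.

End Flips.

(** Induction on the complement of [K]: a path towards [K] contains a step that enters it; the tail
    of this step receives it as its arrow and joins [K]. *)
Lemma extend_to_closed (T : finType) (r : rel T) (K : {set T}) (g : T -> T) :
  (forall x, x \in K -> g x \in K) ->
  (forall x, exists2 y, y \in K & connect r x y) ->
  exists f : T -> T, [/\ forall x, x \in K -> f x = g x,
    forall x, x \notin K -> r x (f x) & forall x, exists n, iter n f x \in K].
Proof.
move: {2}#|~: K| (leqnn #|~: K|) => n; elim: n K g => [|n IH] K g.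
  rewrite leqn0 cards_eq0 => /eqP K0 _ _; exists g.
  have KT x : x \in K by apply: contraFT (finset.in_set0 x) => xK; rewrite -K0 inE.
  by split=> // [x|x]; [rewrite KT|exists 0%N; apply: KT].
move=> Kn gK rK.
have [K0|[z]] := set_0Vmem (~: K).
  by apply: IH => //; rewrite K0 cards0.
rewrite inE => zK.
have [x [y [xK yK rxy]]] : exists x y, [/\ x \notin K, y \in K & r x y].
  have [y yK /connectP[s]] := rK z; elim: s z zK => [|a s IHs] z zK /=.
    by move=> _ e; rewrite -e yK in zK.
  case/andP => rza pa ey; have [aK|aK] := boolP (a \in K).
    by exists z, a.
  exact: (IHs a).
have xyF : (y == x) = false by apply: contraNF xK => /eqP <-.
have [||x'|f [fg rf reach]] := IH (x |: K) (fun z => if z == x then y else g z).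
- rewrite -ltnS (leq_trans _ Kn) // proper_card //; apply/properP; split.
    by apply/fintype.subsetP => a; rewrite !inE negb_or => /andP[].
  by exists x; rewrite !inE ?xK ?eqxx.
- move=> a; rewrite !inE => /orP[aK|aK]; first by rewrite aK yK orbT.
  by have [_|_] := eqVneq a x; apply/orP; right; [exact: yK|exact: gK].
- by have [b bK cb] := rK x'; exists b; rewrite // !inE bK orbT.
exists f; split=> [a aK|a aK|a].
- rewrite fg ?inE ?aK ?orbT //; case: eqP => // eax.
  by rewrite eax (negbTE xK) in aK.
- have [->|ax] := eqVneq a x; last by apply: rf; rewrite !inE negb_or ax.
  by rewrite fg ?inE ?eqxx.
- have [k] := reach a; rewrite !inE => /orP[/eqP ek|]; last by exists k.
  by exists k.+1; rewrite /= ek fg ?inE ?eqxx.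
Qed.

Section Linked.
Variables (V : countType) (r : rel V).

Lemma linked_refl x : linked r x x.
Proof. by exists [::]. Qed.

Lemma linked1 x y : r x y -> linked r x y.
Proof. by move=> rxy; exists [:: y]; rewrite //= rxy. Qed.

Lemma linked_trans x y z : linked r x y -> linked r y z -> linked r x z.
Proof.
move=> [s ps ->] [t pt ->]; exists (s ++ t); last by rewrite last_cat.
by rewrite cat_path ps.
Qed.

Lemma linked_sym x y : symmetric r -> linked r x y -> linked r y x.
Proof.
move=> rs [s]; elim: s x => [|a s IH] x /= => [_ ->|]; first exact: linked_refl.
case/andP => rxa /IH{}IH /IH /linked_trans; apply; apply: linked1.
by rewrite rs.
Qed.

Lemma cycle_linked c x y : cycle r c -> x \in c -> y \in c -> linked r x y.
Proof.
move=> cyc xc yc; have [i s es] := rot_to xc.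
rewrite -(rot_cycle i) es /= in cyc.
have ys : y \in x :: rcons s x.
  by rewrite -(mem_rot i) es in yc; rewrite inE mem_rcons; move: yc; rewrite !inE => ->; rewrite orbT.
move: cyc; case/splitPl: ys => s1 s2 <-; rewrite cat_path => /andP[ps _].
by exists s1.
Qed.

End Linked.

Lemma linked_sub (V : countType) (r r' : rel V) x y :
  subrel r r' -> linked r x y -> linked r' x y.
Proof. by move=> rr [s ps ->]; exists s => //; apply: sub_path ps. Qed.

Lemma subgraph_adj_sym (V : countType) (F : {fset {fset V}}) :
  symmetric (subgraph_adj F).
Proof. by move=> x y; rewrite /subgraph_adj fsetUC. Qed.

(** * The graph of an admissible map is an ECRSF *)

Section ECRSF.
Variables (R : realType) (V : countType) (e : rel V) (p : cycle_weight R e).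
Hypothesis e_sym : symmetric e.
Hypothesis e_irr : irreflexive e.
Variables (G W0 : {fset V}).

Local Notation is_root := (@is_root V G W0).
Local Notation map_edges := (@map_edges V G W0).
Local Notation admissible := (@admissible V e G W0).
Local Notation lw := (@vertex_loop_weight R V e p G).
Let lw_rot := @vertex_loop_weight_rot R V e p G.

Section FromMap.
Variable f : G -> G.
Hypothesis fadm : admissible f.

(** The recurrent vertices reached from [x]: a single root or the vertices of one cycle. Being
    unchanged along arrows, this set labels the connected components. *)
Definition limit_set x z := fconnect f x z && fconnect f (f z) z.

Lemma limit_set_next x : limit_set (f x) =1 limit_set x.
Proof.
move=> z; rewrite /limit_set (fconnect_eqVf f x z).
by case: (eqVneq x z) => [<-|] //; rewrite andbb.
Qed.

Lemma limit_set_exists x : exists z, limit_set x z.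
Proof.
have /trajectP[i io e0] := looping_order f x.
exists (iter i f x); rewrite /limit_set fconnect_iter /=.
have {2}-> : iter i f x = iter (order f x - i.+1) f (f (iter i f x)).
  by rewrite -iterS -iterD subnK.
exact: fconnect_iter.
Qed.

Lemma limit_set_recurrent x z : limit_set x z -> limit_set z =1 limit_set x.
Proof.
case/andP => /iter_findex <- _ a; elim: (findex _ _ _) => //= n IH.
by rewrite limit_set_next.
Qed.

Lemma limit_set_linked x b : linked (subgraph_adj (map_edges f)) (val x) b ->
  exists2 y : G, b = val y & limit_set y =1 limit_set x.
Proof.
case=> s; elim: s x => [|a s IH] x /= => [_ ->|]; first by exists x.
case/andP => /mem_map_edges[z rz].
case/val_fset_eq => [[/val_inj -> ->]|[/val_inj -> ->]] ps eb.
  have [y ey Ly] := IH (f z) ps eb; exists y => // t.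
  by rewrite Ly limit_set_next.
have [y ey Ly] := IH z ps eb; exists y => // t.
by rewrite Ly limit_set_next.
Qed.

Lemma fconnect_linked x y : fconnect f x y ->
  linked (subgraph_adj (map_edges f)) (val x) (val y).
Proof.
move=> /iter_findex <-; elim: (findex _ _ _) => [|n IH] /=; first exact: linked_refl.
apply: (linked_trans IH); set z := iter n f x.
have [rz|rz] := boolP (is_root z).
  have [fr _] := admissibleP _ _ _ fadm; rewrite fr //; exact: linked_refl.
by apply: linked1; apply/mem_map_edges; exists z.
Qed.

(** Vertices with the same limit set are joined through one of its elements; conversely each edge is
    an arrow, and arrows preserve the limit set. *)
Lemma mem_component x y :
  component G (map_edges f) (val x) (val y) <-> limit_set y =1 limit_set x.
Proof.
split=> [[_ /limit_set_linked[y' /val_inj ->]] //|L]; split; first exact: fsvalP.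
have [z zx] := limit_set_exists x.
have /andP[/fconnect_linked xz _] := zx.
have : limit_set y z by rewrite L.
case/andP => /fconnect_linked yz _.
by apply: (linked_trans xz); apply: linked_sym => //; apply: subgraph_adj_sym.
Qed.

Lemma limit_set_periodic x : periodic f x -> limit_set x x.
Proof. by case/andP => px _; rewrite /limit_set px connect0. Qed.

Lemma limit_set_root w : is_root w -> limit_set w =1 pred1 w.
Proof.
have [fr _] := admissibleP _ _ _ fadm => rw z; rewrite /limit_set /=.
apply/andP/eqP => [[/iter_findex <- _]|->]; last by rewrite fr // connect0.
by elim: (findex _ _ _) => //= n ->; rewrite fr.
Qed.

Lemma cycles_in_map_edges C x : cycles_in (map_edges f) (component G (map_edges f) (val x)) C ->
  exists2 y, periodic f y /\ limit_set y =1 limit_set x & C = orbit_edges f y.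
Proof.
case=> /(cycles_map_edges fadm)[y py ->] sub; exists y => //; split=> //.
apply/mem_component; apply: (sub [fset val y; val (f y)]%fset).
  by apply/(mem_orbit_edges fadm) => //; exists y; rewrite ?in_orbit.
by rewrite /= !inE eqxx.
Qed.

Lemma admissible_ECRSF : is_ECRSF G W0 (map_edges f).
Proof.
move=> x0 x0G K; pose x : G := FSetSub x0G.
have eK : K = component G (map_edges f) (val x) by [].
have [z Lz] := limit_set_exists x.
have Lzx := limit_set_recurrent Lz.
have KG a : K a -> exists y : G, a = val y.
  by case=> aG _; exists (FSetSub aG).
have [rz|rz] := boolP (is_root z).
  right; split.
    apply/seteqP; split=> // C; rewrite eK => /cycles_in_map_edges[y [py Ly] _].
    have : limit_set z y by rewrite Lzx -Ly limit_set_periodic.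
    rewrite limit_set_root //= => /eqP eyz.
    by have := periodic_nonroot fadm py; rewrite eyz rz.
  exists (val z); split; first by split=> //; rewrite eK; apply/mem_component.
  move=> a [Ka aW]; have [y ey] := KG _ Ka; rewrite ey; congr val.
  have ry : is_root y by rewrite /is_root -ey.
  have Ly : limit_set y =1 limit_set x by apply/mem_component; rewrite -ey.
  have : limit_set z y by rewrite Lzx -Ly limit_set_root /=.
  by rewrite limit_set_root //= => /eqP.
have pz : periodic f z.
  by case/andP: Lz => _ cz; rewrite /periodic cz (nonroot_neq e_irr fadm).
left; split.
  apply/seteqP; split=> // a [Ka aW]; have [y ey] := KG _ Ka.
  have ry : is_root y by rewrite /is_root -ey.
  have Ly : limit_set y =1 limit_set x by apply/mem_component; rewrite -ey.
  have : limit_set y z by rewrite Ly.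
  by rewrite limit_set_root //= => /eqP eyz; rewrite eyz ry in rz.
exists (orbit_edges f z); split.
  split; first by apply/(cycles_map_edges fadm); exists z.
  move=> a /(mem_orbit_edges fadm _ pz)[y yz ->] b /=.
  have Ly : limit_set y =1 limit_set x.
    move=> t; rewrite -Lzx; move: yz; rewrite -fconnect_orbit => /iter_findex <-.
    by elim: (findex _ _ _) => //= n <-; rewrite limit_set_next.
  rewrite !inE => /orP[]/eqP ->; rewrite eK; apply/mem_component => // t.
  by rewrite limit_set_next.
move=> C; rewrite eK => /cycles_in_map_edges[y [py Ly] ->].
have : limit_set z y by rewrite Lzx -Ly limit_set_periodic.
case/andP => zy _.
have yz : y \in orbit_set f z by rewrite inE -fconnect_orbit.
have [_ es _] := orbit_set_rot pz yz.
have oe t : (t \in orbit f z) = (t \in orbit f y).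
  by have /setP/(_ t) := es; rewrite !inE => ->.
apply/fsetP => a.
by apply/(mem_orbit_edges fadm)/(mem_orbit_edges fadm) => // -[t tz ->];
  exists t; rewrite // ?oe // -oe.
Qed.

Lemma map_edges_induced : (map_edges f `<=` induced_edges e G)%fset.
Proof.
have [fr fn] := admissibleP _ _ _ fadm.
apply/fsubsetP => a /mem_map_edges[x /fn[ex _] ->].
rewrite !inE /=; apply/andP; split.
  by rewrite fpowersetE; apply/fsubsetP => b; rewrite !inE => /orP[]/eqP ->; apply: fsvalP.
by apply/mem_set; exists (val x), (val (f x)).
Qed.

End FromMap.
End ECRSF.

(** * Every ECRSF is the graph of an admissible map *)

Section FromForest.
Variables (V : countType) (e : rel V).
Hypothesis e_sym : symmetric e.
Hypothesis e_irr : irreflexive e.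
Variables (G W0 : {fset V}) (F : {fset {fset V}}).
Hypothesis F_sub : (F `<=` induced_edges e G)%fset.
Hypothesis F_forest : is_ECRSF G W0 F.

Local Notation is_root := (@is_root V G W0).
Local Notation map_edges := (@map_edges V G W0).
Local Notation admissible := (@admissible V e G W0).
Local Notation adj := (subgraph_adj F).

Lemma forest_adj x y : adj x y -> [/\ x \in G, y \in G & e x y].
Proof.
move=> /(fsubsetP F_sub); rewrite !inE /= fpowersetE => /andP[/fsubsetP sG].
move=> /set_mem[a [b [eab /val_fset_eq E]]].
by split; [apply: sG; rewrite !inE eqxx|apply: sG; rewrite !inE eqxx orbT|
  case: E => -[-> ->] //; rewrite e_sym].
Qed.

Definition cycle_list (C : {fset {fset V}}) : seq V :=
  xget [::] [set c | simple_cycle adj c /\ cycle_edges c = C]%classic.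

Lemma cycle_listP C : C \in cycles F ->
  simple_cycle adj (cycle_list C) /\ cycle_edges (cycle_list C) = C.
Proof.
case/mem_cycles => c sc ec.
by apply: (@xgetPex _ [::] [set c | simple_cycle adj c /\ cycle_edges c = C]%classic); exists c.
Qed.

Lemma cycle_list_G C x : C \in cycles F -> x \in cycle_list C ->
  [/\ x \in G, next (cycle_list C) x \in cycle_list C & adj x (next (cycle_list C) x)].
Proof.
move=> /cycle_listP[/and3P[_ uc cyc] _] xc; have xn := next_cycle cyc xc.
by split; rewrite ?mem_next //; case: (forest_adj xn).
Qed.

Lemma cycles_in_component c x y : simple_cycle adj c -> x \in c ->
  linked adj y x -> cycles_in F (component G F y) (cycle_edges c).
Proof.
move=> sc xc yx; have [_ uc cyc] := and3P sc.
split; first by apply/mem_cycles; exists c.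
have Gc z : z \in c -> z \in G by move=> zc; case: (forest_adj (next_cycle cyc zc)).
move=> a /mem_cycle_edges[z zc ->] b /=; rewrite !inE => /orP[]/eqP ->; split.
- exact: Gc.
- exact/(linked_trans yx)/(cycle_linked cyc).
- by apply: Gc; rewrite mem_next.
- by apply/(linked_trans yx)/(cycle_linked cyc) => //; rewrite mem_next.
Qed.

Lemma cycle_component c x y : simple_cycle adj c -> x \in c -> y \in G ->
  linked adj y x -> (component G F y `&` [set` W0])%classic = set0 /\
  forall C, cycles_in F (component G F y) C -> C = cycle_edges c.
Proof.
move=> sc xc yG yx; have inc := cycles_in_component sc xc yx.
case: (F_forest yG) => /= [[K0 [C [_ uC]]]|[K0 _]].
  by split=> // C' /uC <-; apply: uC.
by have : set0 (cycle_edges c) by rewrite -K0.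
Qed.

Lemma cycle_list_uniq C C' x : C \in cycles F -> C' \in cycles F ->
  x \in cycle_list C -> x \in cycle_list C' -> C = C' /\ x \notin W0.
Proof.
move=> FC FC' xC xC'.
have [sc ec] := cycle_listP FC; have [sc' ec'] := cycle_listP FC'.
have [xG _ _] := cycle_list_G FC xC.
have [K0 uC] := cycle_component sc xC xG (linked_refl _ _).
split; first by rewrite -ec -ec'; apply/esym/uC/(cycles_in_component sc' xC')/linked_refl.
apply/negP => xW; have : set0 x by rewrite -K0; split=> //; split=> //; exact: linked_refl.
by [].
Qed.

Definition on_cycle (x : V) (C : {fset {fset V}}) := C \in cycles F /\ x \in cycle_list C.

Definition core : {set G} :=
  [set x : G | is_root x || `[< exists C, on_cycle (val x) C >]].

(** On a cycle, [cycle_list] selects one of the two orientations, and [insubd] brings the next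
    vertex back into the type [G]. *)
Definition core_map (x : G) : G :=
  if is_root x then x
  else insubd x (next (cycle_list (xget fset0 (on_cycle (val x)))) (val x)).

Lemma core_mapE x C : on_cycle (val x) C ->
  [/\ ~~ is_root x, val (core_map x) = next (cycle_list C) (val x) & on_cycle (val (core_map x)) C].
Proof.
move=> [FC xC]; have [_ xW] := cycle_list_uniq FC FC xC xC.
have [FC' xC'] : on_cycle (val x) (xget fset0 (on_cycle (val x))).
  by apply: xgetPex; exists C.
have [eC _] := cycle_list_uniq FC FC' xC xC'.
have [_ nC nadj] := cycle_list_G FC xC.
have em : val (core_map x) = next (cycle_list C) (val x).
  rewrite /core_map /is_root (negbTE xW) -eC val_insubd.
  by have [_ -> _] := forest_adj nadj.
by split=> //; split=> //; rewrite em.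
Qed.

Lemma core_root x : is_root x -> core_map x = x.
Proof. by move=> rx; rewrite /core_map rx. Qed.

Lemma core_closed x : x \in core -> core_map x \in core.
Proof.
rewrite !inE => /orP[rx|/asboolP[C xC]]; first by rewrite core_root ?rx.
by apply/orP; right; apply/asboolP; exists C; have [] := core_mapE xC.
Qed.

Lemma linked_connect (x : G) b : linked adj (val x) b ->
  exists2 y : G, b = val y & connect (fun x y : G => adj (val x) (val y)) x y.
Proof.
case=> s; elim: s x => [|a s IH] x /= => [_ ->|]; first by exists x; rewrite ?connect0.
case/andP => xa pa eb; have [_ aG _] := forest_adj xa.
have [y ey ay] := IH (FSetSub aG) pa eb.
by exists y => //; apply: connect_trans ay; apply: connect1.
Qed.

Lemma core_reached (x : G) :
  exists2 y, y \in core & connect (fun x y : G => adj (val x) (val y)) x y.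
Proof.
case: (F_forest (fsvalP x)) => /= [[_ [C [[FC sub] _]]]|[_ [w [[[_ xw] wW] _]]]].
  have [sc ec] := cycle_listP FC.
  have [y yc] : exists y, y \in cycle_list C.
    by case/and3P: sc; case: (cycle_list C) => // y s; exists y; rewrite mem_head.
  have [_ xy] : component G F (val x) y.
    apply: (sub [fset y; next (cycle_list C) y]%fset); last by rewrite /= !inE eqxx.
    by rewrite -[X in _ \in X]ec; apply/mem_cycle_edges; exists y.
  have [y' ey xy'] := linked_connect xy; exists y' => //.
  by rewrite inE; apply/orP; right; apply/asboolP; exists C; rewrite -ey.
have [y ey xy] := linked_connect xw; exists y => //.
by rewrite inE /is_root -ey; apply/orP; left.
Qed.

(** Orient the cycles, fix the roots and let every other vertex point towards them along edges of
    [F]. An edge of [F] missed by the arrows would join two vertices already connected by arrows and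
    thus close a cycle that its component, with a root or with its one oriented cycle, cannot
    have. *)
Lemma ECRSF_admissible : exists f : {ffun G -> G}, admissible f /\ map_edges f = F.
Proof.
have [f0 [f0c f0r f0reach]] := extend_to_closed core_closed core_reached.
pose f := [ffun x => f0 x].
have fc x : x \in core -> f x = core_map x by rewrite ffunE; apply: f0c.
have fr x : x \notin core -> adj (val x) (val (f x)) by rewrite ffunE; apply: f0r.
have reach x : exists n, iter n f x \in core.
  have [n xn] := f0reach x; exists n; rewrite (eq_iter (f' := f0)) // => y.
  by rewrite ffunE.
have fcore x : x \in core -> f x \in core by move=> xc; rewrite fc //; apply: core_closed.
have froot x : is_root x -> f x = x.
  by move=> rx; rewrite fc ?core_root // inE rx.
have fadj x : ~~ is_root x -> adj (val x) (val (f x)).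
  move=> rx; have [xc|xc] := boolP (x \in core); last exact: fr.
  rewrite fc //; move: xc; rewrite inE (negbTE rx) => /asboolP[C xC].
  by have [_ -> _] := core_mapE xC; case: xC => FC xC; case: (cycle_list_G FC xC).
have fadm : admissible f.
  apply/admissibleP; split=> // x rx; split; first by case: (forest_adj (fadj x rx)).
  have [xc|xc] := boolP (x \in core).
    move: (xc); rewrite inE (negbTE rx) => /asboolP[C xC].
    have [_ e1 fC] := core_mapE xC; have [_ e2 _] := core_mapE fC.
    rewrite -val_eqE /= (fc _ xc) fc ?core_closed // e2 e1.
    case: xC => FC xC; have [/and3P[sz uc _] _] := cycle_listP FC.
    exact: next_next_neq.
  (* The iterates of [x] would alternate between [x] and [f x]; since they reach the core, which is
     closed under [f], [x] would lie in it. *)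
  apply: contra xc => /eqP ffx; have [n xn] := reach x.
  have : (iter n f x == x) || (iter n f x == f x).
    by elim: n {xn} => [|n]; rewrite ?eqxx //= => /orP[]/eqP ->; rewrite ?ffx ?eqxx ?orbT.
  case/orP=> /eqP ex; rewrite ex in xn; first exact: xn.
  by have := fcore _ xn; rewrite ffx.
exists f; split=> //; apply/eqP; rewrite eqEfsubset; apply/andP; split.
  by apply/fsubsetP => a /mem_map_edges[x /fadj ax ->].
apply/fsubsetP => a aF; apply/negPn/negP => na.
have [x [y [ea exy]]] : exists x y : G, a = [fset val x; val y]%fset /\ e (val x) (val y).
  have := fsubsetP F_sub a aF; rewrite !inE /= => /andP[_ /set_mem[x [y [exy ea]]]].
  have xyF : adj x y by rewrite /subgraph_adj -ea.
  by have [xG yG _] := forest_adj xyF; exists (FSetSub xG), (FSetSub yG).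
have xyF : adj (val x) (val y) by rewrite /subgraph_adj -ea.
have subF : subrel (subgraph_adj (map_edges f)) adj.
  by move=> b c /mem_map_edges[z /fadj zF E]; rewrite /subgraph_adj E.
have to_core (z : G) : exists2 k, k \in core & linked (subgraph_adj (map_edges f)) (val z) (val k).
  have [n zn] := reach z; exists (iter n f z) => //.
  by apply: (fconnect_linked fadm); apply: fconnect_iter.
have [k kc xk] := to_core x; have [l lc yl] := to_core y.
have xkF := linked_sub subF xk; have ylF := linked_sub subF yl.
have xlF : linked adj (val x) (val l) by apply: linked_trans ylF; apply: linked1.
(* [k] and [l] lie in one component of [F]: two roots coincide, a root and a cycle exclude each
   other, and two cycles are the same one. *)
have kl : linked (subgraph_adj (map_edges f)) (val k) (val l).
  move: (kc) (lc); rewrite !inE => /orP[rk|/asboolP[C kC]] /orP[rl|/asboolP[C' lC]].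
  - case: (F_forest (fsvalP x)) => /= [[K0 _]|[_ [w [_ uw]]]].
      have : set0 (val k) by rewrite -K0; split => //; split => //; apply: fsvalP.
      by [].
    rewrite -(uw (val k)); last by split => //; split => //; apply: fsvalP.
    rewrite -(uw (val l)); last by split => //; split => //; apply: fsvalP.
    exact: linked_refl.
  - case: lC => FC lC; have [sc _] := cycle_listP FC.
    have [K0 _] := cycle_component sc lC (fsvalP x) xlF.
    have : set0 (val k) by rewrite -K0; split => //; split => //; apply: fsvalP.
    by [].
  - case: kC => FC kC; have [sc _] := cycle_listP FC.
    have [K0 _] := cycle_component sc kC (fsvalP x) xkF.
    have : set0 (val l) by rewrite -K0; split => //; split => //; apply: fsvalP.
    by [].
  - case: kC lC => FC kC [FC' lC].
    have [sc ec] := cycle_listP FC; have [sc' ec'] := cycle_listP FC'.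
    have [_ uC] := cycle_component sc kC (fsvalP x) xkF.
    have eC : C' = C by rewrite -ec -ec'; apply/uC/(cycles_in_component sc' lC xlF).
    rewrite eC in lC; have /and3P[_ uc cyc] := sc.
    apply: (@cycle_linked _ _ (cycle_list C)) => //.
    apply: cycle_from_next => // b bC; have [bG _ _] := cycle_list_G FC bC.
    have onb : on_cycle (val (FSetSub bG : G)) C by [].
    have [rb eb _] := core_mapE onb.
    apply/mem_map_edges; exists (FSetSub bG) => //.
    by rewrite fc ?eb // inE; apply/orP; right; apply/asboolP; exists C.
have xy : linked (subgraph_adj (map_edges f)) (val x) (val y).
  apply: (linked_trans xk); apply: (linked_trans kl).
  by apply: linked_sym => //; apply: subgraph_adj_sym.
case: xy => s ps; case/shortenP: ps => s' ps' us _ ey.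
(* A path of a single edge would be [a] itself, which no arrow draws. *)
have sz : (1 < size s')%N.
  case: s' ps' us ey => [_ _ /= ey|b [|c s'] //=].
    by move: exy; rewrite (_ : val y = val x) ?e_irr.
  by rewrite andbT => + _ eb; rewrite -eb => bF; move: na; rewrite ea => /negP[].
have sc : simple_cycle adj (val x :: s').
  apply/and3P; split=> //=; rewrite rcons_path (sub_path subF ps') /= -ey.
  by rewrite /subgraph_adj fsetUC -ea.
have aC : a \in cycle_edges (val x :: s').
  apply/mem_cycle_edges; exists (val y); first by rewrite ey mem_last.
  rewrite ea fsetUC; congr [fset _; _]%fset.
  by rewrite [val y in RHS]ey next_nth mem_last index_last // nth_default.
have xin : val x \in val x :: s' by rewrite mem_head.
have [K0 uC] := cycle_component sc xin (fsvalP x) (linked_refl _ _).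
(* A root contradicts [K0]; otherwise the cycle through [a] is the oriented one, all of whose edges
   are drawn by [core_map]. *)
move: kc; rewrite inE => /orP[rk|/asboolP[C [FC kC]]].
  have : set0 (val k) by rewrite -K0; split => //; split => //; apply: fsvalP.
  by [].
have [sC eC] := cycle_listP FC.
have eaC : cycle_edges (cycle_list C) = cycle_edges (val x :: s').
  by apply/uC/(cycles_in_component sC kC xkF).
move: aC; rewrite -eaC => /mem_cycle_edges[z zC eaz].
have [zG _ _] := cycle_list_G FC zC.
have onz : on_cycle (val (FSetSub zG : G)) C by [].
have [rz ez _] := core_mapE onz.
move/negP: na; apply; apply/mem_map_edges; exists (FSetSub zG) => //.
by rewrite fc ?ez // inE; apply/orP; right; apply/asboolP; exists C.
Qed.

End FromForest.

(** * From maps to forest sums; positivity of the normalizing constants *)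

Section FiniteVolumeSum.
Variables (R : realType) (V : countType) (e : rel V) (p : cycle_weight R e).
Hypothesis e_sym : symmetric e.
Hypothesis e_irr : irreflexive e.
Hypothesis e_lf : locally_finite e.
Hypothesis e_deg : forall x, (0 < degree e x)%N.
Variables (G W0 : {fset V}).

Local Notation is_root := (@is_root V G W0).
Local Notation map_edges := (@map_edges V G W0).
Local Notation admissible := (@admissible V e G W0).
Local Notation lw := (@vertex_loop_weight R V e p G).
Local Notation Pi := (map_weight lw (@vertex_step R V e G) is_root).
Let lw_rot := @vertex_loop_weight_rot R V e p G.

Definition degree_weight : R := \prod_(x : G | ~~ is_root x) (degree e (val x))%:R^-1.

Lemma degree_weight_gt0 : 0 < degree_weight.
Proof. by apply: prodr_gt0 => x _; rewrite invr_gt0 ltr0n. Qed.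

Lemma mem_ECRSFs F : reflect ((F `<=` induced_edges e G)%fset /\ is_ECRSF G W0 F)
  (F \in ECRSFs e G W0).
Proof.
rewrite /ECRSFs !inE /= fpowersetE.
by apply: (iffP andP) => -[? /asboolP].
Qed.

Lemma map_weight_admissible f : admissible f ->
  Pi f = degree_weight * \prod_(C in cycle_sets f) cycle_set_weight lw f C.
Proof.
case/admissibleP => fr fn; congr (_ * _); apply: eq_bigr => x rx.
by rewrite /vertex_step /srw_step; have [-> _] := fn x rx.
Qed.

(** There are three ways to fail: an arrow along no edge and a fixed non-root have step weight 0,
    and a back-and-forth pair has loop weight 0. *)
Lemma map_weight_not_admissible f : agree is_root id f -> ~~ admissible f -> Pi f = 0.
Proof.
move=> /forallP fr /forallPn[x]; case: ifPn => rx.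
  by have := fr x; rewrite rx /= => /eqP ->; rewrite eqxx.
rewrite negb_and negbK => /orP[ne|/eqP ffx].
  rewrite /map_weight /arrow_weight (bigD1 x rx) /=.
  by rewrite /vertex_step /srw_step (negbTE ne) !mul0r.
have [fx|fx] := eqVneq (f x) x.
  rewrite /map_weight /arrow_weight (bigD1 x rx) /=.
  by rewrite fx vertex_step_irr // !mul0r.
have cx : fcycle f [:: x; f x] by rewrite /= ffx !eqxx.
have px : periodic f x.
  by rewrite /periodic fx andbT -{2}ffx; apply: fconnect1.
rewrite (map_weight_periodic lw_rot _ _ px).
have : (order f x <= 2)%N by apply: (order_le_cycle cx); rewrite mem_head.
rewrite -size_orbit => so.
by rewrite /vertex_loop_weight /loop_weight /simple_cycle size_map ltnNge so mul0r.
Qed.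

(** Admissible maps are sorted by their edges: each ECRSF is drawn by some map, by
    [ECRSF_admissible], and the cycle weights of the maps that draw it add up to [forest_weight], by
    [sum_same_edges]. *)
Lemma sum_agree (Phi : {fset {fset V}} -> R) :
  \sum_(f : {ffun G -> G} | agree is_root id f) Pi f * Phi (map_edges f) =
  degree_weight * \sum_(F <- ECRSFs e G W0) forest_weight p F * Phi F.
Proof.
have adm_agree (f : G -> G) : admissible f -> agree is_root id f.
  case/admissibleP => fr _; apply/forallP => x; apply/implyP => /fr ->.
  exact: eqxx.
rewrite (bigID (fun f : {ffun G -> G} => admissible f)) /= [X in _ + X]big1 ?addr0; last first.
  by move=> f /andP[af nf]; rewrite map_weight_not_admissible ?mul0r.
transitivity (\sum_(f : {ffun G -> G} | admissible f) \sum_(F <- ECRSFs e G W0 | map_edges f == F)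
    degree_weight * (\prod_(C in cycle_sets f) cycle_set_weight lw f C * Phi F)).
  apply: eq_big => [f|f /andP[_ fadm]].
    by apply: andb_idl; apply: adm_agree.
  rewrite (eq_bigl (fun F => F == map_edges f)); last by move=> F; rewrite eq_sym.
  rewrite -big_filter (@filter_pred1_uniq _ _ (map_edges f)).
  - by rewrite big_seq1 map_weight_admissible // mulrA.
  - exact: fset_uniq.
  - by apply/mem_ECRSFs; split; [apply: map_edges_induced|apply: admissible_ECRSF].
rewrite (exchange_big_dep xpredT) //= mulr_sumr; apply: eq_big_seq => F FE.
rewrite -big_distrr -big_distrl /=; congr (_ * (_ * _)).
have [Fs Ff] := mem_ECRSFs _ FE.
have [f0 [f0adm <-]] := ECRSF_admissible e_sym e_irr Fs Ff.
exact: sum_same_edges.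
Qed.

(** [many_walks] is started from the empty forest, with [id] prescribing that the roots are fixed.
    The first factor involves neither [G] nor [W0], which gives uniformity in the volume. *)
Theorem finite_volume_bound (U : {fset V}) (x0 : V) (phi : nat -> V)
    (Phi : {fset {fset V}} -> R) (m i : nat) (D : {fset V}) :
  (U `<=` G)%fset -> (forall x, x \in U -> x \notin W0) ->
  (forall A, 0 <= Phi A) ->
  (forall A B, (forall a, (a `<=` D)%fset -> (a \in A) = (a \in B)) -> Phi A = Phi B) ->
  (forall j, (j < i)%N -> phi j \in U) ->
  (forall x, x \in D -> exists2 j, (j < i)%N & x = phi j) ->
  forest_value p U x0 phi Phi m i 0 (fset0, fset0) *
    \sum_(F <- ECRSFs e G W0) forest_weight p F <=
  \sum_(F <- ECRSFs e G W0) forest_weight p F * Phi F.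
Proof.
move=> UG UW0 Phi0 Phil phiU phiD.
have enc : encodes W0 (id : G -> G) (fset0, fset0).
  split=> [|x|//|a] /=; first exact: fsub0set.
    by rewrite in_fset0.
  by rewrite in_fset0; split=> // -[x]; rewrite in_fset0.
have := @many_walks R V e p e_irr e_lf G U W0 x0 UG UW0 phi Phi m i D Phi0 Phil
  phiU phiD i 0 (fset0, fset0) id (addn0 i) enc.
have eb : bound_vertices W0 (fset0, fset0) =1 is_root.
  by move=> x; rewrite /bound_vertices /= in_fset0 orbF.
have ea (f : {ffun G -> G}) : agree (bound_vertices W0 (fset0, fset0)) id f = agree is_root id f.
  by apply: eq_forallb => x; rewrite eb.
rewrite !(eq_bigl _ _ ea) sum_agree => /(_ (fun l => ltac:(done))) H.
have e1 : \sum_(f : {ffun G -> G} | agree is_root id f) Pi f =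
    degree_weight * \sum_(F <- ECRSFs e G W0) forest_weight p F.
  rewrite (eq_bigr (fun f : {ffun G -> G} => Pi f * 1)); last by move=> f _; rewrite mulr1.
  rewrite (sum_agree (fun=> 1)); congr (_ * _).
  by apply: eq_bigr => F _; rewrite mulr1.
by move: H; rewrite e1 mulrCA ler_pM2l // degree_weight_gt0.
Qed.

Lemma forest_weight_gt0 (f : G -> G) : admissible f ->
  (forall x, periodic f x -> 0 < lw (orbit f x)) ->
  0 < \sum_(F <- ECRSFs e G W0) forest_weight p F.
Proof.
move=> fadm lwpos.
have FE : map_edges f \in ECRSFs e G W0.
  by apply/mem_ECRSFs; split; [apply: map_edges_induced|apply: admissible_ECRSF].
rewrite (bigD1_seq (map_edges f)) ?fset_uniq //=; apply: ltr_wpDr.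
  by apply: sumr_ge0 => F _; apply: forest_weight_ge0.
rewrite (forest_weight_map_edges p e_sym fadm); apply: prodr_gt0 => C fC.
case: pickP => // x xC; have [px _ _] := cycle_setsP lw_rot fC xC.
by rewrite ltr_wpDr ?lwpos // vertex_loop_weight_ge0.
Qed.

(** A positive normalizing constant needs one map of positive weight. A map prescribed on [K], which
    will be the set of roots or one cycle, is extended by arrows leading to [K], and these create no
    further cycle. *)
Lemma extend_admissible (K : {set G}) (g : G -> G) :
  connected_on [set` G]%classic (induced e G) -> K != finset.set0 ->
  (forall x, is_root x -> x \in K /\ g x = x) ->
  (forall x, x \in K -> g x \in K) ->
  (forall x, x \in K -> ~~ is_root x -> e (val x) (val (g x)) /\ g (g x) != x) ->
  exists f : G -> G, [/\ admissible f, (forall x, x \in K -> f x = g x) &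
    forall x, periodic f x -> x \in K].
Proof.
move=> [_ conn] /finset.set0Pn[k kK] gr gK gK2.
have reachK (x : G) : exists2 y, y \in K & connect (fun x y : G => e (val x) (val y)) x y.
  exists k => //; case: (conn _ _ (fsvalP x) (fsvalP k)) => s.
  elim: s x => [|a s IH] x /=.
    by move=> _ /val_inj ->; apply: connect0.
  case/andP => /and3P[_ aG xa] pa ea; apply: connect_trans (IH (FSetSub aG) pa ea).
  exact: connect1.
have [f [fg fe reach]] := extend_to_closed gK reachK.
have fK x : x \in K -> f x \in K by move=> xK; rewrite fg ?gK.
have perK x : fconnect f (f x) x -> x \in K.
  have [n xn] := reach x; rewrite fconnect_f => cx.
  have nx : iter n f x \in orbit f x by rewrite -fconnect_orbit fconnect_iter.
  have : fconnect f (iter n f x) x by rewrite (fconnect_cycle cx nx) in_orbit.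
  by move=> /iter_findex <-; elim: (findex _ _ _) => //= l; apply: fK.
exists f; split=> //; last by move=> x /andP[/perK].
apply/admissibleP; split=> x rx; first by have [xK gx] := gr x rx; rewrite fg.
have [xK|xK] := boolP (x \in K).
  by rewrite (fg _ xK) fg ?gK //; apply: gK2.
split; first exact: fe.
apply: contra xK => /eqP ffx; apply: perK; rewrite -{2}ffx; exact: fconnect1.
Qed.

Lemma wired_weight_gt0 : connected_on [set` G]%classic (induced e G) ->
  (exists2 w, w \in G & w \in W0) ->
  0 < \sum_(F <- ECRSFs e G W0) forest_weight p F.
Proof.
move=> conn [w wG wW].
have [||||f [fadm _ perK]] := @extend_admissible [set x | is_root x] id conn.
- by apply/finset.set0Pn; exists (FSetSub wG); rewrite inE.
- by move=> x rx; rewrite inE.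
- by [].
- by move=> x; rewrite inE => ->.
apply: (forest_weight_gt0 fadm) => x px.
by have := perK x px; rewrite inE (negbTE (periodic_nonroot fadm px)).
Qed.

Lemma free_weight_gt0 c : W0 = fset0 -> connected_on [set` G]%classic (induced e G) ->
  simple_cycle e c -> (forall x, x \in c -> x \in G) -> 0 < p c ->
  0 < \sum_(F <- ECRSFs e G W0) forest_weight p F.
Proof.
move=> W00 conn sc cG pc; have /and3P[sz uc cyc] := sc.
have noroot x : is_root x = false by rewrite /is_root W00 in_fset0.
pose g (x : G) : G := insubd x (next c (val x)).
have gE x : val x \in c -> val (g x) = next c (val x).
  by move=> xc; rewrite val_insubd cG ?mem_next.
have [||||f [fadm fg perK]] := @extend_admissible [set x : G | val x \in c] g conn.
- have [y yc] : exists y, y \in c by case: (c) sz => // y s; exists y; rewrite mem_head.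
  by apply/finset.set0Pn; exists (FSetSub (cG y yc)); rewrite inE.
- by move=> x; rewrite noroot.
- by move=> x; rewrite !inE => xc; rewrite gE // mem_next.
- move=> x; rewrite inE => xc _; rewrite gE //; split; first exact: next_cycle cyc xc.
  by rewrite -val_eqE /= !gE ?mem_next //; apply: next_next_neq.
apply: (forest_weight_gt0 fadm) => x px.
have xK := perK x px; have := xK; rewrite inE => xc.
have [c' ec] := fset_seq cG.
have uc' : uniq c' by move: uc; rewrite ec (map_inj_uniq val_inj).
have fc' : fcycle f c'.
  apply: cycle_from_next => // y yc; rewrite /= fg ?inE ?ec; last by apply: map_f.
  by rewrite -val_eqE /= gE ec ?(next_map val_inj) //; apply: map_f.
have xc' : x \in c' by move: xc; rewrite ec (mem_map val_inj).
have [k ->] := orbit_rot_cycle fc' uc' xc'.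
by rewrite lw_rot /vertex_loop_weight -ec /loop_weight sc.
Qed.

End FiniteVolumeSum.

Lemma is_CRSF_ECRSF (V : countType) (G : {fset V}) F :
  is_CRSF G F <-> is_ECRSF G fset0 F.
Proof.
split=> H x xG; first by left; split; [apply/seteqP; split=> // y []|apply: H].
by case: (H x xG) => [[]//|[_ [w [[]]]]].
Qed.

Lemma CRSFs_ECRSFs (V : countType) (e : rel V) (G : {fset V}) :
  CRSFs e G = ECRSFs e G fset0.
Proof.
apply/fsetP => F; rewrite /CRSFs /ECRSFs !inE /=; congr (_ && _).
by apply: asbool_equiv_eq; apply: is_CRSF_ECRSF.
Qed.

(** * Almost sure rooting *)

Import numFieldNormedType.Exports.
Local Open Scope classical_set_scope.
Local Open Scope ring_scope.

Section Survival.
Variables (R : realType) (V : countType) (e : rel V) (p : cycle_weight R e).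
Hypothesis e_lf : locally_finite e.
Hypothesis e_deg : forall x, (0 < degree e x)%N.
Variable x0 : V.

Definition neighbours (x : V) : {fset V} := fset_set [set y | e x y].

Lemma mem_neighbours x y : (y \in neighbours x) = e x y.
Proof. by rewrite in_fset_set //; apply/idP/idP => [/set_mem|?]; last exact/mem_set. Qed.

Lemma srw_step_neighbours x : \sum_(y <- neighbours x) srw_step R e x y = 1.
Proof.
rewrite (eq_big_seq (fun=> (degree e x)%:R^-1)); last first.
  by move=> y; rewrite mem_neighbours /srw_step => ->.
rewrite big_const_seq count_predT iter_addr_0 -[_^-1 *+ _]mulr_natl.
by rewrite mulfV // pnatr_eq0 -lt0n; apply: e_deg.
Qed.

Definition erase_prob (s : seq V) (y : V) : R :=
  if y \in s then 1 - loop_weight p (drop (index y s) s) else 1.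

Definition erase_step (s : seq V) (y : V) : seq V :=
  if y \in s then take (index y s).+1 s else rcons s y.

Lemma last_erase_step s y : last x0 (erase_step s y) = y.
Proof.
rewrite /erase_step; case: ifP => ys; last by rewrite last_rcons.
by rewrite (take_nth x0) ?index_mem // last_rcons nth_index.
Qed.

Lemma erase_step_uniq s y : uniq s -> uniq (erase_step s y).
Proof.
by move=> us; rewrite /erase_step; case: ifP => ys; rewrite ?take_uniq // rcons_uniq ys.
Qed.

Lemma erase_step_neq0 s y : erase_step s y != [::].
Proof. by rewrite /erase_step; case: ifP; case: s. Qed.

Lemma mem_erase_step s y z : z \in erase_step s y -> z \in y :: s.
Proof.
rewrite /erase_step; case: ifP => _; last by rewrite mem_rcons.
by move=> /mem_take zs; rewrite inE zs orbT.
Qed.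

Lemma erase_prob_ge0 s y : 0 <= erase_prob s y.
Proof. by rewrite /erase_prob; case: ifP => _ //; rewrite subr_ge0 loop_weight_le1. Qed.

Lemma erase_prob_le1 s y : erase_prob s y <= 1.
Proof. by rewrite /erase_prob; case: ifP => _ //; rewrite gerBl loop_weight_ge0. Qed.

(* The probability that no loop is kept during the next [m] steps. *)
Fixpoint survival (m : nat) (s : seq V) : R :=
  if m is m'.+1 then
    \sum_(y <- neighbours (last x0 s)) srw_step R e (last x0 s) y *
      (erase_prob s y * survival m' (erase_step s y))
  else 1.

Lemma survival_ge0 m s : 0 <= survival m s.
Proof.
elim: m s => //= m IH s; apply: sumr_ge0 => y _.
by rewrite !mulr_ge0 ?srw_step_ge0 ?erase_prob_ge0.
Qed.

Lemma survival_leS m s : survival m.+1 s <= survival m s.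
Proof.
elim: m s => [|m IH] s; last first.
  apply: ler_sum => y _; apply: ler_wpM2l; first exact: srw_step_ge0.
  by apply: ler_wpM2l; [exact: erase_prob_ge0|exact: IH].
rewrite /= -[leRHS](srw_step_neighbours (last x0 s)); apply: ler_sum => y _.
by rewrite mulr1 ler_piMr ?srw_step_ge0 ?erase_prob_le1.
Qed.

Lemma survival_nonincreasing s : nonincreasing_seq (survival ^~ s).
Proof. by apply/nonincreasing_seqP => n; apply: survival_leS. Qed.

Definition survival_lim (s : seq V) : R := limn (survival ^~ s).
Local Notation h := survival_lim.

Lemma survival_cvg s : survival ^~ s @ \oo --> h s.
Proof.
apply: nonincreasing_is_cvgn; first exact: survival_nonincreasing.
by exists 0 => _ [n _ <-]; apply: survival_ge0.
Qed.

Lemma survival_lim_le m s : h s <= survival m s.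
Proof.
apply: nonincreasing_cvgn_ge; first exact: survival_nonincreasing.
by apply/cvg_ex; exists (h s); apply: survival_cvg.
Qed.

Lemma survival_lim_ge0 s : 0 <= h s.
Proof.
apply: limr_ge; first by apply/cvg_ex; exists (h s); apply: survival_cvg.
by apply: nearW => n; apply: survival_ge0.
Qed.

Lemma survival_lim_le1 s : h s <= 1.
Proof. exact: (survival_lim_le 0). Qed.

Lemma survival_lim_step s : h s = \sum_(y <- neighbours (last x0 s))
  srw_step R e (last x0 s) y * (erase_prob s y * h (erase_step s y)).
Proof.
apply: (@cvg_unique _ _ (survival ^~ s @ \oo)) => //; first exact: survival_cvg.
have : [sequence survival n.+1 s]_n @ \oo --> \sum_(y <- neighbours (last x0 s))
    srw_step R e (last x0 s) y * (erase_prob s y * h (erase_step s y)).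
  apply: cvg_big => //= [|y _]; first exact: add_continuous.
  by apply: cvgMl_tmp; apply: cvgMl_tmp; apply: survival_cvg.
by move=> H; exact: (eq_ind _ id H _ (cvg_shiftS (survival ^~ s) _)).
Qed.

(** All outcomes other than the step to [y] are bounded by 1. *)
Lemma survival_lim_follow s y :
  h s <= 1 - srw_step R e (last x0 s) y * (1 - erase_prob s y * h (erase_step s y)).
Proof.
have [ey|ey] := boolP (e (last x0 s) y); last first.
  by rewrite /srw_step (negbTE ey) mul0r subr0 survival_lim_le1.
have yN : y \in neighbours (last x0 s) by rewrite mem_neighbours.
rewrite -{1}(srw_step_neighbours (last x0 s)) survival_lim_step.
rewrite (bigD1_seq y) ?fset_uniq //= [X in _ <= X - _](bigD1_seq y) ?fset_uniq //=.
set q := srw_step R e _ y; set A := \sum_(_ <- _ | _) _; set B := \sum_(_ <- _ | _) _.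
have AB : A <= B.
  apply: ler_sum => z _; rewrite ler_piMr ?srw_step_ge0 //.
  by rewrite mulr_ile1 ?erase_prob_ge0 ?erase_prob_le1 ?survival_lim_ge0 ?survival_lim_le1.
lra.
Qed.

Lemma srw_cylinder_cons v y t :
  srw_cylinder R e v (y :: t) = srw_step R e v y * srw_cylinder R e y t.
Proof. by rewrite /srw_cylinder /= big_cons. Qed.

(** As [s ++ t] is self-avoiding, no loop closes while the walk follows [t]; the deficit [K] of the
    last step is carried back multiplied by the probability of the path. *)
Lemma survival_lim_path s t z K : s != [::] -> uniq (s ++ t) ->
  h (s ++ t) <= 1 - srw_step R e (last x0 (s ++ t)) z * K ->
  h s <= 1 - srw_cylinder R e (last x0 s) (rcons t z) * K.
Proof.
elim: t s => [|y t IH] s s0 us H.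
  by rewrite cats0 in H; rewrite /srw_cylinder /= big_seq1.
rewrite rcons_cons srw_cylinder_cons.
have ys : y \in s = false.
  by move: us; rewrite cat_uniq => /and3P[_ /hasPn/(_ y)]; rewrite mem_head => /(_ isT)/negbTE.
apply: (le_trans (survival_lim_follow s y)).
rewrite /erase_prob /erase_step ys mul1r.
have := IH (rcons s y); rewrite cat_rcons last_rcons => /(_ _ us H).
have -> : rcons s y != [::] by case: (s).
move=> /(_ isT) IHs; have q0 := srw_step_ge0 R e (last x0 s) y.
have : srw_step R e (last x0 s) y * (srw_cylinder R e y (rcons t z) * K) <=
   srw_step R e (last x0 s) y * (1 - h (rcons s y)).
  by apply: ler_wpM2l => //; lra.
rewrite mulrA; lra.
Qed.

(** From the tip of [s] the walk runs through [c] and back to its head with probability above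
    [beta]. Since [c] avoids [s], the loop closed is exactly [c], and it is kept with probability
    [p c], at least [alpha]. *)
Lemma survival_lim_loop s v c (alpha beta : R) : 0 < alpha -> 0 < beta ->
  s != [::] -> uniq s -> last x0 s = v -> simple_cycle e c -> {in c, forall x, x \notin s} ->
  alpha <= p c -> beta < srw_cylinder R e v (rcons c (head v c)) ->
  h s <= 1 - alpha * beta.
Proof.
move=> a0 b0 s0 us ls sc cs ac bc; have /and3P[sz uc _] := sc.
have usc : uniq (s ++ c).
  by rewrite cat_uniq us uc andbT; apply/hasPn => x xc; apply: cs.
have : h s <= 1 - srw_cylinder R e (last x0 s) (rcons c (head v c)) * p c.
  apply: survival_lim_path => //.
  have hc : head v c \in c by case: (c) sz => // a l _; rewrite mem_head.
  have hs : head v c \notin s by apply: cs.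
  have ix : index (head v c) (s ++ c) = size s.
    by rewrite index_cat (negbTE hs); case: (c) sz => //= a l _; rewrite eqxx addn0.
  have hin : head v c \in s ++ c by rewrite mem_cat hc orbT.
  apply: (le_trans (survival_lim_follow _ (head v c))).
  rewrite /erase_prob hin ix drop_size_cat // /loop_weight sc.
  rewrite lerD2l lerN2; apply: ler_wpM2l; first exact: srw_step_ge0.
  set H := h _; have H0 : 0 <= H by exact: survival_lim_ge0.
  have H1 : H <= 1 by exact: survival_lim_le1.
  have p1 := weight_le1 p sc.
  have : 0 <= (1 - p c) * (1 - H) by rewrite mulr_ge0 ?subr_ge0.
  lra.
rewrite ls => hle; apply: (le_trans hle); rewrite lerD2l lerN2 mulrC.
by apply: ler_pM => //; [exact: ltW|exact: ltW|exact: ltW].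
Qed.

Section Exhausted.
Variable G : nat -> {fset V}.
Hypothesis e_conn : connected_on setT e.
Hypothesis V_inf : infinite_set [set: V].
Hypothesis G_exh : exhaustion e G.

Lemma mem_boundary n v :
  reflect (v \in G n /\ exists y, e v y /\ y \notin G n) (v \in boundary e (G n)).
Proof. by rewrite /boundary !inE /=; apply: (iffP andP) => -[? /asboolP]. Qed.

(** [V] is infinite and connected, so some path leaves [G n]; its last vertex before the first exit
    is on the boundary. *)
Lemma boundary_reached n x : x \in G n ->
  exists2 s, path (induced e (G n)) x s & last x s \in boundary e (G n).
Proof.
move=> xG; have [y yG] : exists y, y \notin G n.
  apply: contrapT => none; apply: V_inf.
  have -> : [set: V] = [set` G n].
    apply/seteqP; split=> // z _ /=; apply: contrapT => zG; apply: none.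
    by exists z; apply/negP.
  exact: finite_fset.
have [s ps ey] := e_conn.2 x y I I.
elim: s x xG ps ey => [|a s IH] x xG /=; first by move=> _ ey; rewrite ey xG in yG.
case/andP => exa pa ey; have [aG|aG] := boolP (a \in G n).
  have [t pt lt] := IH a aG pa ey; exists (a :: t) => //=.
  by rewrite pt /induced xG aG exa.
exists [::] => //=; apply/mem_boundary; split=> //.
by exists a.
Qed.

(* Maximum principle: [h] is harmonic for the path-valued chain, so its maximum
   over the paths in [G n] propagates along the walk up to the boundary. *)
Lemma survival_lim_max n (b : R) : 0 <= b ->
  (forall s, s != [::] -> uniq s -> {subset s <= G n} ->
    last x0 s \in boundary e (G n) -> h s <= b) ->
  forall s, s != [::] -> uniq s -> {subset s <= G n} -> h s <= b.
Proof.
move=> b0 bd s s0 us sG.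
(* Self-avoiding paths in [G n] have bounded length and form a finite type, on which the maximum is
   attained. *)
pose T := {bseq #|{: G n}| of {: G n}}.
pose ok (t : T) := (map val t != [::] :> seq V) && uniq (map val t).
have lift (t : seq V) : t != [::] -> uniq t -> {subset t <= G n} ->
    exists2 t' : T, ok t' & map val t' = t.
  move=> t0 ut tG.
  have [t1 et] := fset_seq tG.
  have ut1 : uniq t1 by move: ut; rewrite et (map_inj_uniq val_inj).
  have st1 : (size t1 <= #|{: G n}|)%N.
    by rewrite -(card_uniqP ut1) max_card.
  by exists (Bseq st1); rewrite /ok /= -et ?t0.
have [t0 okt0 et0] := lift s s0 us sG.
case: (@arg_maxP _ _ _ t0 ok (fun t : T => h (map val t)) okt0) => t okt tmax.
rewrite -et0; apply: (le_trans (tmax _ okt0)).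
set M := h (map val t) in tmax *.
rewrite leNgt; apply/negP => bM.
have key : forall w u, u != [::] -> uniq u -> {subset u <= G n} -> h u = M ->
   path (induced e (G n)) (last x0 u) w -> last (last x0 u) w \in boundary e (G n) -> False.
  elim=> [|y w IH] u u0 uu uG hu /=.
    by move=> _ lb; have := bd u u0 uu uG lb; rewrite hu leNgt bM.
  case/andP => /and3P[lG yG ly] pw lw.
  have [lb|lb] := boolP (last x0 u \in boundary e (G n)).
    by have := bd u u0 uu uG lb; rewrite hu leNgt bM.
  have nbG z : z \in neighbours (last x0 u) -> z \in G n.
    rewrite mem_neighbours => lz; apply: contraNT lb => zG.
    by apply/mem_boundary; split=> //; exists z.
  have stepM z : z \in neighbours (last x0 u) -> h (erase_step u z) <= M.
    move=> zN; have [||t' okt' <-] := lift (erase_step u z) (erase_step_neq0 u z).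
    - exact: erase_step_uniq.
    - move=> a /mem_erase_step; rewrite inE => /orP[/eqP -> |]; first exact: nbG.
      exact: uG.
    exact: tmax.
  apply: (IH (erase_step u y)).
  - exact: erase_step_neq0.
  - exact: erase_step_uniq.
  - by move=> a /mem_erase_step; rewrite inE => /orP[/eqP -> //|]; apply: uG.
  (* [M] is an average of terms at most [M], with positive weight at [y], so the value after the
     step to [y] is again [M]. *)
  - apply/eqP; rewrite eq_le stepM ?mem_neighbours //=.
    have yN : y \in neighbours (last x0 u) by rewrite mem_neighbours.
    have M0 : 0 <= M by exact: survival_lim_ge0.
    have q0 : 0 < srw_step R e (last x0 u) y.
      by rewrite /srw_step ly invr_gt0 ltr0n.
    have term z : z \in neighbours (last x0 u) ->
        erase_prob u z * h (erase_step u z) <= M.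
      move=> zN; apply: (le_trans _ (stepM z zN)).
      by rewrite ler_piMl ?survival_lim_ge0 ?erase_prob_le1.
    have : h u = \sum_(z <- neighbours (last x0 u))
       srw_step R e (last x0 u) z * (erase_prob u z * h (erase_step u z)).
      exact: survival_lim_step.
    have : M = \sum_(z <- neighbours (last x0 u)) srw_step R e (last x0 u) z * M.
      by rewrite -big_distrl /= srw_step_neighbours mul1r.
    rewrite hu !(bigD1_seq y) ?fset_uniq //=.
    set A := \sum_(_ <- _ | _) _; set B := \sum_(_ <- _ | _) _ => eM eh.
    have BA : B <= A.
      rewrite /A /B big_seq_cond [leRHS]big_seq_cond; apply: ler_sum => z /andP[zN _].
      by apply: ler_wpM2l; [exact: srw_step_ge0|exact: term].
    have : srw_step R e (last x0 u) y * M <=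
        srw_step R e (last x0 u) y * (erase_prob u y * h (erase_step u y)) by lra.
    rewrite ler_pM2l // => /le_trans; apply.
    by rewrite ler_piMl ?survival_lim_ge0 ?erase_prob_le1.
  - by rewrite last_erase_step.
  - by rewrite last_erase_step.
have /andP[tn tu] := okt.
have tG : {subset map val t <= G n} by move=> _ /mapP[z _ ->]; apply: fsvalP.
have lG : last x0 (map val t) \in G n.
  have lin (l : seq V) : l != [::] -> last x0 l \in l.
    by case: l => // a l _; rewrite /= mem_last.
  by apply: tG; apply: lin.
have [w pw lw] := boundary_reached lG.
exact: (key w _ tn tu tG).
Qed.

Lemma exhaustion_le n m : (n <= m)%N -> (G n `<=` G m)%fset.
Proof.
move=> /subnK <-; elim: (m - n)%N => // k IH; rewrite addSn.
exact: fsubset_trans IH (exh_incr G_exh _).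
Qed.

Lemma exhaustion_cover (A : seq V) : exists n, {subset A <= G n}.
Proof.
elim: A => [|x A [n An]]; first by exists 0%N.
have [m _ xm] : (\bigcup_n [set` G n]) x by rewrite (exh_union G_exh).
exists (maxn n m) => y; rewrite inE => /orP[/eqP ->|/An yn].
  exact: (fsubsetP (exhaustion_le (leq_maxr n m))).
exact: (fsubsetP (exhaustion_le (leq_maxl n m))).
Qed.

(** The loops at the boundary of [G n] lie outside [G n], hence avoid every path inside it.
    Induction on [k] along the harmonic relation improves the uniform bound to
    [h <= (1 - dl) * survival k], and in the limit [h <= (1 - dl) * h]. *)
Theorem survival_lim_eq0 s : loop_assumption p G -> s != [::] -> uniq s -> h s = 0.
Proof.
move=> [alpha [beta [a0 b0 loops]]].
pose dl := alpha * beta; have dl0 : 0 < dl by rewrite mulr_gt0.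
have bound s' : s' != [::] -> uniq s' -> h s' <= 1 - dl.
  move=> s0 us; have [n sG] := exhaustion_cover s'.
  have bdry t : t != [::] -> uniq t -> {subset t <= G n} ->
      last x0 t \in boundary e (G n) -> h t <= 1 - dl.
    move=> t0 ut tG lb; have [c [sc cG ac bc]] := loops n _ lb.
    apply: (survival_lim_loop a0 b0 t0 ut erefl sc _ ac bc) => x xc.
    by have [_ xG _] := cG x xc; apply: contra xG; apply: tG.
  apply: (survival_lim_max _ bdry) => //.
  (* That [1 - dl] is nonnegative follows from the bound for the one-vertex path at a boundary
     vertex, [h] being nonnegative. *)
  have [xs lx] : exists x, x \in s' by case: (s') s0 => // a l _; exists a; rewrite mem_head.
  have [t pt lt] := boundary_reached (sG _ lx).
  apply: (le_trans (survival_lim_ge0 [:: last xs t])); apply: bdry => //.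
  by move=> z; rewrite inE => /eqP ->; case/mem_boundary: lt.
have scaled k : forall s', s' != [::] -> uniq s' -> h s' <= (1 - dl) * survival k s'.
  elim: k => [|k IH] s' s0 us; first by rewrite mulr1; apply: bound.
  rewrite survival_lim_step /= mulr_sumr; apply: ler_sum => y _.
  rewrite [leRHS]mulrCA; apply: ler_wpM2l; first exact: srw_step_ge0.
  rewrite [leRHS]mulrCA; apply: ler_wpM2l; first exact: erase_prob_ge0.
  by apply: IH; [exact: erase_step_neq0|exact: erase_step_uniq].
move=> s0 us; have h0 := survival_lim_ge0 s.
have : h s <= (1 - dl) * h s.
  have cv : cvgn (fun n => (1 - dl) * survival n s).
    by apply/cvg_ex; exists ((1 - dl) * h s); apply: cvgMl_tmp; apply: survival_cvg.
  have -> : (1 - dl) * h s = limn (fun n => (1 - dl) * survival n s).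
    by apply/esym/cvg_lim => //; apply: cvgMl_tmp; apply: survival_cvg.
  by apply: limr_ge => //; apply: nearW => n; apply: scaled.
rewrite mulrBl mul1r => hle.
have : dl * h s <= 0 by lra.
by rewrite pmulr_rle0 // => hn; apply/eqP; rewrite eq_le hn.
Qed.

End Exhausted.
End Survival.

(** * The algorithm on the infinite graph *)

Section Discrete.
Context (d : measure_display) (T : measurableType d).

Definition discrete_rv (A : Type) (f : T -> A) := forall a, measurable [set w | f w = a].

Lemma discrete_preimage (A : countType) (f : T -> A) (B : set A) :
  discrete_rv f -> measurable (f @^-1` B).
Proof.
move=> mf; have -> : f @^-1` B =
    \bigcup_n (if @choice.unpickle A n is Some a then [set w | f w = a /\ B a] else set0).
  apply/seteqP; split=> [w Bw|w [n _]].
    by exists (choice.pickle (f w)) => //; rewrite choice.pickleK.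
  by case: (@choice.unpickle A n) => // a [<-].
apply: bigcupT_measurable => n; case: (@choice.unpickle A n) => [a|]; last exact: measurable0.
have [Ba|Ba] := pselect (B a).
  by rewrite (_ : [set w | _] = [set w | f w = a]) //; apply/seteqP; split=> w // -[].
by rewrite (_ : [set w | _] = set0); [exact: measurable0|apply/seteqP; split=> w // -[]].
Qed.

(** Splitting over the countably many values of [f] allows the remaining dependence on [w] to be
    treated with that value frozen; the states of the walk and of the forest are shown measurable in
    this way. *)
Lemma discrete_compose (A : countType) (f : T -> A) (Q : A -> T -> Prop) :
  discrete_rv f -> (forall a, measurable [set w | Q a w]) ->
  measurable [set w | Q (f w) w].
Proof.
move=> mf mQ; have -> : [set w | Q (f w) w] =
    \bigcup_n (if @choice.unpickle A n is Some a then [set w | f w = a] `&` [set w | Q a w] else set0).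
  apply/seteqP; split=> [w Qw|w [n _]].
    by exists (choice.pickle (f w)) => //; rewrite choice.pickleK.
  by case: (@choice.unpickle A n) => // a [/= <-].
apply: bigcupT_measurable => n; case: (@choice.unpickle A n) => [a|]; last exact: measurable0.
exact: measurableI.
Qed.

End Discrete.

Section Real_probability.
Context (d : measure_display) (T : measurableType d) (R : realType) (P : probability T R).

Definition pr (A : set T) : R := fine (P A).

Lemma prE A : measurable A -> P A = (pr A)%:E.
Proof. by move=> mA; rewrite /pr fineK // fin_num_measure. Qed.

Lemma pr_ge0 A : 0 <= pr A.
Proof. by rewrite /pr fine_ge0. Qed.

Lemma pr_eq A x : P A = x%:E -> pr A = x.
Proof. by rewrite /pr => ->. Qed.

Lemma pr_le A B : measurable A -> measurable B -> A `<=` B -> pr A <= pr B.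
Proof.
by move=> mA mB AB; rewrite -lee_fin -!prE //; apply: le_measure => //; rewrite inE.
Qed.

Lemma pr_setT : pr setT = 1.
Proof. by apply: pr_eq; rewrite probability_setT. Qed.

Lemma pr_set0 : pr set0 = 0.
Proof. by apply: pr_eq; rewrite measure0. Qed.

Lemma pr_setC A : measurable A -> pr (~` A) = 1 - pr A.
Proof. by move=> mA; apply: pr_eq; rewrite probability_setC // prE. Qed.

Lemma pr_setU A B : measurable A -> measurable B -> pr (A `|` B) <= pr A + pr B.
Proof.
move=> mA mB; rewrite -lee_fin EFinD -!prE //; last exact: measurableU.
exact: measureU2.
Qed.

Lemma pr_setU_disjoint A B : measurable A -> measurable B -> A `&` B = set0 ->
  pr (A `|` B) = pr A + pr B.
Proof.
move=> mA mB AB; apply: pr_eq; rewrite EFinD -!prE //; exact: measureU.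
Qed.

Lemma pr_cover (I : eqType) (s : seq I) (A : set T) (F : I -> set T) :
  measurable A -> (forall i, measurable (F i)) ->
  (forall w, A w -> exists2 i, i \in s & F i w) -> pr A <= \sum_(i <- s) pr (F i).
Proof.
move=> + mF; elim: s A => [|i s IH] A mA AF.
  rewrite big_nil (_ : A = set0) ?pr_set0 //.
  by apply/seteqP; split=> // w /AF[].
rewrite big_cons.
apply: (@le_trans _ _ (pr (F i `|` (A `\` F i)))).
  apply: pr_le => //; first by apply: measurableU => //; apply: measurableD.
  by move=> w Aw; have [Fw|Fw] := pselect (F i w); [left|right].
apply: (le_trans (pr_setU (mF i) (measurableD mA (mF i)))).
rewrite lerD2l; apply: IH; first exact: measurableD.
move=> w [/AF[j]]; rewrite inE => /orP[/eqP -> //|js Fj] _.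
by exists j.
Qed.

End Real_probability.

Section Uniform.
Variable R : realType.

Lemma uniform_prob_le (c : R) : 0 <= c <= 1 ->
  uniform_prob (@ltr01 R) [set y | y <= c] = c%:E.
Proof.
move=> /andP[c0 c1]; rewrite /uniform_prob integral_uniform_pdf.
have -> : [set y | y <= c] `&` `[0, 1]%classic = `[0, c]%classic.
  apply/seteqP; split=> y /=; rewrite !in_itv /=.
    by case=> yc /andP[-> _].
  by move=> /andP[y0 yc]; rewrite y0 yc (le_trans yc).
rewrite (eq_integral (fun=> 1%:E)); last first.
  move=> y; rewrite inE /= in_itv /= /uniform_pdf => /andP[-> yc].
  by rewrite (le_trans yc) // subr0 invr1.
rewrite integral_cst //= mul1e lebesgue_measure_itv /= lte_fin.
have [_|c0'] := ltP 0 c; first by rewrite oppr0 addr0.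
by congr (_%:E); apply/eqP; rewrite eq_le c0.
Qed.

Lemma uniform_prob_gt (c : R) : 0 <= c <= 1 ->
  uniform_prob (@ltr01 R) [set y | c < y] = (1 - c)%:E.
Proof.
move=> c01; have -> : [set y | c < y] = ~` [set y | y <= c].
  by apply/seteqP; split=> y /=; rewrite ltNge => /negP.
have mA : measurable [set y : R | y <= c].
  rewrite (_ : [set y | y <= c] = `]-oo, c]%classic); first exact: measurable_itv.
  by apply/seteqP; split=> y /=; rewrite in_itv.
rewrite probability_setC // [X in (1 - X)%E](_ : _ = c%:E) //.
exact: uniform_prob_le.
Qed.

End Uniform.

(** * Product rules from the independence of the input *)

Section Input.
Variables (R : realType) (V : countType) (e : rel V).
Context (d : measure_display) (T : measurableType d) (P : probability T R).
Variables (X : V -> nat -> T -> V) (Y : V -> nat -> {RV P >-> R}).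
Hypothesis input : algorithm_input e X Y.

Definition input_sigma (i : V + V) : set (set T) :=
  match i with
  | inl x => process_sigma setT (X x)
  | inr x => process_sigma measurable (fun n => Y x n : T -> R)
  end.

Lemma walk_discrete v n : discrete_rv (X v n).
Proof. by move=> y; apply: srw_measurable (input_walk input v) n y. Qed.

Lemma input_sigma_measurable i A : input_sigma i A -> measurable A.
Proof.
case: i => v /=; apply: smallest_sub; rewrite ?setTD; try exact: sigma_algebra_measurable.
  by move=> _ [n _ [B _ <-]]; apply/discrete_preimage/walk_discrete.
by move=> _ [n _ [B mB <-]]; rewrite -[_ @^-1` _]setTI; apply: measurable_funP.
Qed.

Lemma input_sigma_setI i A B : input_sigma i A -> input_sigma i B -> input_sigma i (A `&` B).
Proof.
by case: i => v /=; apply: (@measurableI _ (g_sigma_algebraType _)).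
Qed.

Lemma input_sigma_walk v n B : input_sigma (inl v) (X v n @^-1` B).
Proof. by apply: sub_sigma_algebra; exists n => //; exists B. Qed.

Lemma input_sigma_unif v n B : measurable B -> input_sigma (inr v) (Y v n @^-1` B).
Proof. by move=> mB; apply: sub_sigma_algebra; exists n => //; exists B. Qed.

(* The events depending only on the input sequences indexed by [K], one
   sequence at a time. *)
Definition past (K : {fset (V + V)}) (H : set T) : Prop :=
  exists C : V + V -> set T, (forall i, i \in K -> input_sigma i (C i)) /\
    H = \bigcap_(i in [set` K]) C i.

Lemma past_setT : past fset0 setT.
Proof.
exists (fun=> setT); split=> [i|]; first by rewrite in_fset0.
by apply/seteqP; split.
Qed.

Lemma past_measurable K H : past K H -> measurable H.
Proof.
case=> C [CK ->]; apply: fin_bigcap_measurable; first exact: finite_fset.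
by move=> i iK; apply/input_sigma_measurable/CK.
Qed.

(** [K] records the sequences already consulted; joint independence is applied to [K] with and
    without the fresh index [i]. *)
Lemma past_extend K H i S : past K H -> i \notin K -> input_sigma i S ->
  P (H `&` S) = (P H * P S)%E /\ past (i |` K)%fset (H `&` S).
Proof.
case=> C [CK ->] iK Si.
pose C' j := if j == i then S else C j.
have CK' j : j \in (i |` K)%fset -> input_sigma j (C' j).
  by rewrite /C' !inE; case: eqP => [->|_] //=; apply: CK.
have eC j : j \in K -> C' j = C j.
  by move=> jK; rewrite /C'; case: eqP => // ji; rewrite -ji jK in iK.
have eI : \bigcap_(j in [set` K]) C j `&` S = \bigcap_(j in [set` (i |` K)%fset]) C' j.
  apply/seteqP; split=> [w [Cw Sw] j|w Cw].
    rewrite /= !inE => /orP[/eqP ->|jK]; first by rewrite /C' eqxx.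
    by rewrite eC //; apply: Cw.
  split; last by have := Cw i; rewrite /C' eqxx; apply; rewrite /= !inE eqxx.
  by move=> j jK; rewrite -eC //; apply: Cw; rewrite /= !inE; apply/orP; right.
split; last by exists C'.
rewrite eI (input_indep input CK') big_fsetU1 //= {1}/C' eqxx muleC.
rewrite (input_indep input CK); congr (_ * _)%E.
by apply: eq_big_seq => j jK; rewrite eC.
Qed.

Definition trajectory (v : V) (t : seq V) : set T :=
  [set w | [seq X v i w | i <- iota 0 (size t).+1] = v :: t].

Lemma trajectory_nil v : trajectory v [::] = [set w | X v 0%N w = v].
Proof. by apply/seteqP; split=> w /=; [case|rewrite /trajectory /= => ->]. Qed.

Lemma trajectory_rcons v t y :
  trajectory v (rcons t y) = trajectory v t `&` (X v (size t).+1 @^-1` [set y]).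
Proof.
have E w : [seq X v i w | i <- iota 0 (size t).+2] =
    rcons [seq X v i w | i <- iota 0 (size t).+1] (X v (size t).+1 w).
  by rewrite -[in LHS](addn1 (size t).+1) iotaD map_cat cats1.
apply/seteqP; split=> w; rewrite /trajectory /setI /mkset size_rcons E -rcons_cons.
  by move/eqP; rewrite eqseq_rcons => /andP[/eqP e1 /eqP e2].
by move=> [e1 e2]; congr rcons.
Qed.

Lemma input_sigma_trajectory v t : input_sigma (inl v) (trajectory v t).
Proof.
elim/last_ind: t => [|t y IH].
  rewrite trajectory_nil (_ : [set w | _] = X v 0%N @^-1` [set v]) //.
  exact: input_sigma_walk.
by rewrite trajectory_rcons; apply: input_sigma_setI => //; apply: input_sigma_walk.
Qed.

Lemma P_trajectory v t : P (trajectory v t) = (srw_cylinder R e v t)%:E.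
Proof. by rewrite /trajectory (srw_law (input_walk input v)) eqxx mul1r. Qed.

Lemma srw_cylinder_rcons v t y :
  srw_cylinder R e v (rcons t y) = srw_cylinder R e v t * srw_step R e (last v t) y.
Proof.
elim: t v => [|x t IH] v; first by rewrite /srw_cylinder /= big_seq1 big_nil mul1r.
by rewrite rcons_cons !srw_cylinder_cons IH mulrA.
Qed.

Definition time_fset (n : nat) : {fset nat} := [fset i | i in iota 1 n]%fset.

Lemma mem_time_fset i n : (i \in time_fset n) = (0 < i <= n)%N.
Proof.
by apply/imfsetP/idP => [[j /= + ->]|ij]; last exists i => //=; rewrite mem_iota add1n ltnS.
Qed.

(* [Bs] lists constraints on [Y 1], [Y 2], ... *)
Definition unif_event (v : V) (Bs : seq (set R)) : set T :=
  \bigcap_(i in [set` time_fset (size Bs)]) (Y v i @^-1` nth setT Bs i.-1).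

Lemma unif_event_nil v : unif_event v [::] = setT.
Proof.
apply/seteqP; split=> // w _ i; rewrite /= mem_time_fset => /andP[i0].
by rewrite leqNgt i0.
Qed.

Lemma unif_event_rcons v Bs B :
  unif_event v (rcons Bs B) = unif_event v Bs `&` (Y v (size Bs).+1 @^-1` B).
Proof.
apply/seteqP; split=> [w H|w [H HB] i].
  split=> [i|]; rewrite /= ?mem_time_fset.
    move=> /andP[i1 iB].
    have := H i; rewrite /= mem_time_fset size_rcons i1 leqW // => /(_ isT).
    by rewrite nth_rcons prednK // iB.
  have := H (size Bs).+1; rewrite /= mem_time_fset size_rcons leqnn => /(_ isT).
  by rewrite nth_rcons ltnn eqxx.
rewrite /= mem_time_fset size_rcons => /andP[i1].
rewrite leq_eqVlt => /orP[/eqP ->|]; first by rewrite /= nth_rcons ltnn eqxx.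
rewrite ltnS => iB; have := H i; rewrite /= mem_time_fset i1 iB => /(_ isT).
by rewrite nth_rcons prednK // iB.
Qed.

Definition meas_seq (Bs : seq (set R)) := forall B, List.In B Bs -> measurable B.

Lemma meas_seq_rcons Bs B : meas_seq Bs -> measurable B -> meas_seq (rcons Bs B).
Proof.
move=> mBs mB A; rewrite -cats1 => /(@List.in_app_or _ Bs [:: B] A)[/mBs//|[<-|[]]].
exact: mB.
Qed.

Lemma meas_seq_nth Bs i : meas_seq Bs -> measurable (nth setT Bs i).
Proof.
elim: Bs i => [|B Bs IH] [|i] mBs /=; try exact: measurableT.
  by apply: mBs; left.
by apply: IH => A AB; apply: mBs; right.
Qed.

Lemma input_sigma_unif_event v Bs : meas_seq Bs -> input_sigma (inr v) (unif_event v Bs).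
Proof.
move=> mBs; rewrite /unif_event.
apply: (@fin_bigcap_measurable _ (g_sigma_algebraType _)); first exact: finite_fset.
by move=> i _; apply: input_sigma_unif; apply: meas_seq_nth.
Qed.

Lemma P_unif_event_rcons v Bs B : meas_seq Bs -> measurable B ->
  P (unif_event v (rcons Bs B)) = (P (unif_event v Bs) * uniform_prob (@ltr01 R) B)%E.
Proof.
move=> mBs mB; have mBs' := meas_seq_rcons mBs mB.
have indep Bs1 : meas_seq Bs1 -> P (unif_event v Bs1) =
    (\prod_(i <- time_fset (size Bs1)) P (Y v i @^-1` nth setT Bs1 i.-1))%E.
  move=> m1; apply: (iid_indep (input_unif input v)) => i _.
  by exists (nth setT Bs1 i.-1) => //; apply: meas_seq_nth.
rewrite !indep // size_rcons.
have -> : time_fset (size Bs).+1 = ((size Bs).+1 |` time_fset (size Bs))%fset.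
  apply/fsetP => i; rewrite in_fset1U !mem_time_fset [(i <= _.+1)%N]leq_eqVlt ltnS.
  by case: eqP => [->|_] //=.
rewrite big_fsetU1 /=; last by rewrite mem_time_fset ltnn andbF.
rewrite nth_rcons ltnn eqxx muleC; congr (_ * _)%E; last first.
  by rewrite -(iid_law (input_unif input v) (size Bs).+1 mB).
apply: eq_big_seq => i; rewrite mem_time_fset => /andP[i1 iB].
by rewrite nth_rcons prednK // iB.
Qed.

(** Constraints on the uniforms instead of their values: the loop-erased walk only compares each of
    them with one loop weight, and the events keep a product form. *)
Definition walk_event (H : set T) v t Bs := H `&` (trajectory v t `&` unif_event v Bs).

Section Walk.
Variables (K : {fset (V + V)}) (H : set T) (v : V).
Hypothesis HK : past K H.
Hypothesis vK : inl v \notin K.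
Hypothesis vK' : inr v \notin K.

Lemma walk_event_past t Bs : meas_seq Bs ->
  P (walk_event H v t Bs) = (P H * (srw_cylinder R e v t)%:E * P (unif_event v Bs))%E /\
  past (inr v |` (inl v |` K))%fset (walk_event H v t Bs).
Proof.
move=> mBs; rewrite /walk_event setIA.
have [e1 p1] := past_extend HK vK (@input_sigma_trajectory v t).
have vK1 : inr v \notin (inl v |` K)%fset by rewrite !inE (negbTE vK').
have [e2 p2] := past_extend p1 vK1 (@input_sigma_unif_event v _ mBs).
by split=> //; rewrite e2 e1 P_trajectory.
Qed.

Lemma walk_event_measurable t Bs : meas_seq Bs -> measurable (walk_event H v t Bs).
Proof. by move=> mBs; have [_ /past_measurable] := walk_event_past t mBs. Qed.

Lemma walk_event_nil : pr P (walk_event H v [::] [::]) = pr P H.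
Proof.
apply: pr_eq; have m0 : meas_seq [::] by [].
have [-> _] := walk_event_past [::] m0.
rewrite unif_event_nil probability_setT mule1 /srw_cylinder /= big_nil mule1 prE //.
exact: past_measurable HK.
Qed.

Lemma walk_event_rcons t y Bs B : size t = size Bs ->
  walk_event H v (rcons t y) (rcons Bs B) =
  walk_event H v t Bs `&` ((X v (size t).+1 @^-1` [set y]) `&` (Y v (size t).+1 @^-1` B)).
Proof.
move=> sz; rewrite /walk_event trajectory_rcons unif_event_rcons -sz.
by rewrite -!setIA; congr (_ `&` (_ `&` _)); rewrite setICA.
Qed.

Lemma pr_walk_event_rcons t y Bs B b : meas_seq Bs -> measurable B ->
  uniform_prob (@ltr01 R) B = b%:E ->
  pr P (walk_event H v (rcons t y) (rcons Bs B)) =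
  pr P (walk_event H v t Bs) * (srw_step R e (last v t) y * b).
Proof.
move=> mBs mB eb; apply: pr_eq.
have [-> _] := walk_event_past (rcons t y) (meas_seq_rcons mBs mB).
rewrite P_unif_event_rcons // eb srw_cylinder_rcons !EFinM.
have [e1 _] := walk_event_past t mBs.
rewrite -prE; last exact: walk_event_measurable.
rewrite e1 -!muleA; congr (_ * (_ * _))%E.
by rewrite !muleA; congr (_ * _)%E; rewrite muleC.
Qed.

End Walk.
End Input.

Section Deterministic.
Variables (R : realType) (V : countType) (e : rel V) (p : cycle_weight R e).
Variables (xs : nat -> V) (ys : nat -> R).

Lemma lerw_none_le n j : (lerw p xs ys n).2 = None -> (j <= n)%N ->
  (lerw p xs ys j).2 = None.
Proof.
elim: n => [|n IH] /=; first by rewrite leqn0 => _ /eqP ->.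
move=> H; rewrite leq_eqVlt => /orP[/eqP -> //|]; rewrite ltnS => jn.
by apply: IH => //; move: H; case: (lerw p xs ys n) => s [].
Qed.

Lemma lerw_new k s : lerw p xs ys k = (s, None) -> xs k.+1 \notin s ->
  lerw p xs ys k.+1 = (rcons s (xs k.+1), None).
Proof. by move=> /= -> /= ->. Qed.

Lemma lerw_keep k s : lerw p xs ys k = (s, None) -> xs k.+1 \in s ->
  ys k.+1 <= loop_weight p (drop (index (xs k.+1) s) s) ->
  lerw p xs ys k.+1 = (s, Some (drop (index (xs k.+1) s) s)).
Proof. by move=> /= -> /= -> /= ->. Qed.

Lemma lerw_erase k s : lerw p xs ys k = (s, None) -> xs k.+1 \in s ->
  loop_weight p (drop (index (xs k.+1) s) s) < ys k.+1 ->
  lerw p xs ys k.+1 = (take (index (xs k.+1) s).+1 s, None).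
Proof. by move=> /= -> /= -> /=; rewrite leNgt => -> . Qed.

Lemma lerw_final_first (W : {fset V}) n : ended p W xs ys n ->
  (forall j, (j < n)%N -> ~~ ended p W xs ys j) ->
  lerw_final p W xs ys = lerw p xs ys n.
Proof.
move=> en before; rewrite /lerw_final; case: pselect => [ex|nex]; last by case: nex; exists n.
case: ex_minnP => m em mmin; congr lerw; apply/eqP; rewrite eqn_leq mmin //=.
by rewrite leqNgt; apply/negP => /before; rewrite em.
Qed.

End Deterministic.

(** * One walk of the algorithm against its killed value *)

Section Bounds.
Variables (R : realType) (V : countType) (e : rel V) (p : cycle_weight R e).
Context (d : measure_display) (T : measurableType d) (P : probability T R).
Variables (X : V -> nat -> T -> V) (Y : V -> nat -> {RV P >-> R}).
Hypothesis input : algorithm_input e X Y.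
Variable x0 : V.

Local Notation xs w := (fun x n => X x n w).
Local Notation ys w := (fun x n => Y x n w : R).
Local Notation lerw_at v w n := (lerw p (fun i => X v i w) (fun i => Y v i w : R) n).
Local Notation walk_event := (walk_event X Y).
Local Notation past := (past X Y).

Lemma uniform_setT : uniform_prob (@ltr01 R) setT = 1%:E.
Proof. by rewrite probability_setT. Qed.

Lemma loop_weight_itv c : 0 <= loop_weight p c <= 1.
Proof. by rewrite loop_weight_ge0 loop_weight_le1. Qed.

Lemma measurable_le (c : R) : measurable [set y : R | y <= c].
Proof.
rewrite (_ : [set y | y <= c] = `]-oo, c]%classic); first exact: measurable_itv.
by apply/seteqP; split=> y /=; rewrite in_itv.
Qed.

Lemma measurable_gt (c : R) : measurable [set y : R | c < y].
Proof.
rewrite (_ : [set y | c < y] = `]c, +oo[%classic); first exact: measurable_itv.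
by apply/seteqP; split=> y /=; rewrite in_itv /= andbT.
Qed.

Section Walk.
Variables (K : {fset (V + V)}) (H : set T) (v : V).
Hypothesis HK : past K H.
Hypothesis vK : inl v \notin K.
Hypothesis vK' : inr v \notin K.

Let mwalk t Bs (mBs : meas_seq Bs) : measurable (walk_event H v t Bs) :=
  walk_event_measurable input HK vK vK' t mBs.

Let pr_step t y Bs B b (mBs : meas_seq Bs) (mB : measurable B) :=
  @pr_walk_event_rcons _ _ _ _ _ _ _ _ input _ _ _ HK vK vK' t y Bs B b mBs mB.

Section Killed.
Variables (W U : {fset V}) (m : nat) (Good : set T) (Psi : lerw_state V -> R).
Hypothesis Good_meas : measurable Good.
Hypothesis Psi_ge0 : forall L, 0 <= Psi L.
Hypothesis Good_rooted : forall w, Good w -> (lerw_at v w m).2 <> None.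
Hypothesis Good_U : forall w k, Good w -> (k <= m)%N -> X v k w \in U.
Hypothesis Good_final : forall t Bs L, meas_seq Bs -> size t = size Bs ->
  (forall w, walk_event H v t Bs w ->
     lerw_final p W (fun n => X v n w) (fun n => Y v n w : R) = L) ->
  pr P (walk_event H v t Bs `&` Good) <= pr P (walk_event H v t Bs) * Psi L.

(** Induction on the number [r] of steps left, on events that determine the current path. On [Good]
    the next vertex lies in [U], and the walk ends in [W], extends its path or closes a loop; in the
    last case the event is cut according to whether the uniform exceeds the loop weight.
    [Good_final] passes the bound on to the walks still to come. *)
Lemma killed_bound r t Bs s : size t = size Bs -> meas_seq Bs -> (size t + r)%N = m ->
  last x0 s = last v t -> (forall z, z \in s -> z \notin W) ->
  (forall w, walk_event H v t Bs w -> lerw_at v w (size t) = (s, None) /\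
     forall j, (j <= size t)%N -> X v j w \notin W) ->
  pr P (walk_event H v t Bs `&` Good) <=
  pr P (walk_event H v t Bs) * killed_value p U x0 W Psi r s.
Proof.
elim: r t Bs s => [|r IH] t Bs s sz mBs tm ls sW run.
  (* No step is left and the walk is unrooted at time [m], against [Good_rooted]. *)
  rewrite (_ : _ `&` Good = set0) ?pr_set0 ?mulr0 //.
  apply/seteqP; split=> // w [/run[ew _] /Good_rooted]; rewrite -tm addn0.
  by rewrite ew.
set E := walk_event H v t Bs in run *; have mE : measurable E := mwalk t mBs.
pose k := size t.
have msT : measurable (setT : set R) by [].
have mF y : measurable (E `&` (X v k.+1 @^-1` [set y]) `&` Good).
  apply: measurableI => //; apply: measurableI => //.
  exact: (walk_discrete input v k.+1 y).
have cover : pr P (E `&` Good) <=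
    \sum_(y <- U) pr P (E `&` (X v k.+1 @^-1` [set y]) `&` Good).
  apply: pr_cover => // [|w [Ew Gw]]; first exact: measurableI.
  exists (X v k.+1 w); last by [].
  by apply: Good_U => //; rewrite -tm addnS ltnS leq_addr.
apply: (le_trans cover); rewrite /= mulr_sumr; apply: ler_sum => y _.
have ext B : walk_event H v (rcons t y) (rcons Bs B) =
    E `&` ((X v k.+1 @^-1` [set y]) `&` (Y v k.+1 @^-1` B)) by exact: walk_event_rcons.
have szS B : size (rcons t y) = size (rcons Bs B) by rewrite !size_rcons sz.
have runX j w : E w -> X v k.+1 w = y -> y \notin W -> (j <= k.+1)%N -> X v j w \notin W.
  move=> /run[_ nW] ey yW; rewrite leq_eqVlt => /orP[/eqP -> |]; first by rewrite ey.
  by rewrite ltnS; apply: nW.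
have before w : E w -> forall j, (j < k.+1)%N ->
    ~~ ended p W (fun n => X v n w) (fun n => Y v n w : R) j.
  move=> /run[ew nW] j; rewrite ltnS => jk; rewrite /ended (negbTE (nW j jk)) orbF negbK.
  by apply/eqP/(@lerw_none_le _ _ _ _ _ _ k) => //; rewrite ew.
have full B : E `&` (X v k.+1 @^-1` [set y]) `&` Good `<=` walk_event H v (rcons t y) (rcons Bs setT) `&` Good.
  by move=> w [[Ew yw] Gw]; split=> //; rewrite ext.
rewrite ls /move_value; case: ifPn => yW.
  apply: (@le_trans _ _ (pr P (walk_event H v (rcons t y) (rcons Bs setT) `&` Good))).
    apply: pr_le => //; last exact: full.
    by apply: measurableI => //; apply: mwalk; apply: meas_seq_rcons.
  apply: le_trans (Good_final (L := (rcons s y, None)) _ (szS _) _) _.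
  - exact: meas_seq_rcons.
  - move=> w; rewrite ext => -[Ew [/= ey _]]; have [ew nW] := run w Ew.
    rewrite (@lerw_final_first _ _ _ _ _ _ _ k.+1); last exact: before.
      rewrite (lerw_new ew) ey //; apply/negP => /sW; by rewrite yW.
    by rewrite /ended ey yW orbT.
  - by rewrite (pr_step t y mBs msT uniform_setT) mulr1 mulrA.
case: ifPn => ys.
  set c := drop (index y s) s; set l := loop_weight p c.
  have ml := measurable_le l; have mg := measurable_gt l.
  apply: (@le_trans _ _ (pr P (walk_event H v (rcons t y) (rcons Bs [set z | z <= l]) `&` Good)
     + pr P (walk_event H v (rcons t y) (rcons Bs [set z | l < z]) `&` Good))).
    have m1 : measurable (walk_event H v (rcons t y) (rcons Bs [set z | z <= l]) `&` Good).
      by apply: measurableI => //; apply: mwalk; apply: meas_seq_rcons.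
    have m2 : measurable (walk_event H v (rcons t y) (rcons Bs [set z | l < z]) `&` Good).
      by apply: measurableI => //; apply: mwalk; apply: meas_seq_rcons.
    apply: le_trans (pr_setU P m1 m2); apply: pr_le => //; first exact: measurableU.
    move=> w [[Ew yw] Gw]; rewrite !ext.
    by have [le|lt] := leP (Y v k.+1 w) l; [left|right].
  rewrite mulrDr mulrDr; apply: lerD.
    apply: le_trans (Good_final (L := (s, Some c)) _ (szS _) _) _.
    - exact: meas_seq_rcons.
    - move=> w; rewrite ext => -[Ew [/= ey yl]]; have [ew nW] := run w Ew.
      have e1 : lerw_at v w k.+1 = (s, Some c).
        by rewrite (lerw_keep ew) ?ey.
      rewrite (@lerw_final_first _ _ _ _ _ _ _ k.+1) //; last exact: before.
      by rewrite /ended e1.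
    - by rewrite (pr_step t y mBs ml (uniform_prob_le (loop_weight_itv c))) !mulrA.
  have IHs : pr P (walk_event H v (rcons t y) (rcons Bs [set z | l < z]) `&` Good) <=
      pr P (walk_event H v (rcons t y) (rcons Bs [set z | l < z])) *
      killed_value p U x0 W Psi r (take (index y s).+1 s).
    apply: IH; first exact: szS.
    - exact: meas_seq_rcons.
    - by rewrite size_rcons addSnnS.
    - have := last_erase_step x0 s y; rewrite /erase_step ys => ->.
      by rewrite last_rcons.
    - by move=> z /mem_take; apply: sW.
    move=> w; rewrite ext => -[Ew [/= ey yl]]; have [ew nW] := run w Ew.
    rewrite size_rcons; split; first by rewrite (lerw_erase ew) ?ey.
    by move=> j; apply: runX.
  apply: (le_trans IHs).
  by rewrite (pr_step t y mBs mg (uniform_prob_gt (loop_weight_itv c))) !mulrA.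
apply: (@le_trans _ _ (pr P (walk_event H v (rcons t y) (rcons Bs setT) `&` Good))).
  apply: pr_le => //; last exact: full.
  by apply: measurableI => //; apply: mwalk; apply: meas_seq_rcons.
have IHs : pr P (walk_event H v (rcons t y) (rcons Bs setT) `&` Good) <=
    pr P (walk_event H v (rcons t y) (rcons Bs setT)) *
    killed_value p U x0 W Psi r (rcons s y).
  apply: IH; first exact: szS.
  - exact: meas_seq_rcons.
  - by rewrite size_rcons addSnnS.
  - by rewrite !last_rcons.
  - by move=> z; rewrite mem_rcons inE => /orP[/eqP -> //|]; apply: sW.
  move=> w; rewrite ext => -[Ew [/= ey _]]; have [ew nW] := run w Ew.
  rewrite size_rcons; split; first by rewrite (lerw_new ew) ?ey.
  by move=> j; apply: runX.
apply: (le_trans IHs).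
by rewrite (pr_step t y mBs msT uniform_setT) mulr1 !mulrA.
Qed.

End Killed.
End Walk.
End Bounds.

(** * Measurability of the random forest *)

Section Measurability.
Context (d : measure_display) (T : measurableType d).

Lemma measurable_prop (Q : Prop) : measurable [set w : T | Q].
Proof.
have [q|q] := pselect Q.
  by rewrite (_ : [set w | _] = setT) //; apply/seteqP; split.
by rewrite (_ : [set w | _] = set0) //; apply/seteqP; split.
Qed.

Lemma discrete_pair (A B : Type) (f : T -> A) (g : T -> B) :
  discrete_rv f -> discrete_rv g -> discrete_rv (fun w => (f w, g w)).
Proof.
move=> mf mg [a b]; rewrite (_ : [set w | _] = [set w | f w = a] `&` [set w | g w = b]).
  exact: measurableI.
by apply/seteqP; split=> w /= [-> ->].
Qed.

Variables (R : realType) (V : countType) (e : rel V) (p : cycle_weight R e).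
Variable (P : probability T R).
Variables (X : V -> nat -> T -> V) (Y : V -> nat -> {RV P >-> R}).
Hypothesis input : algorithm_input e X Y.

Local Notation xs w := (fun x n => X x n w).
Local Notation ys w := (fun x n => Y x n w : R).
Local Notation lerw_at v w n := (lerw p (fun i => X v i w) (fun i => Y v i w : R) n).

Lemma measurable_unif_le v n (c : R) : measurable [set w | Y v n w <= c].
Proof.
have := measurable_le c => /(measurable_funP (Y v n) measurableT).
by rewrite setTI.
Qed.

Lemma lerw_discrete v n : discrete_rv (fun w => lerw_at v w n).
Proof.
elim: n => [|n IH] L /=.
  have := walk_discrete input v 0 => mX.
  exact: (@discrete_preimage _ _ _ (X v 0%N) [set x | ([:: x], None) = L] mX).
have mXY := discrete_pair IH (walk_discrete input v n.+1).
apply: (@discrete_compose _ _ (lerw_state V * V)%type _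
  (fun sx w => lerw_step p sx.1 sx.2 (Y v n.+1 w) = L) mXY) => -[[s kept] x] /=.
case: kept => [c|]; first exact: measurable_prop.
case xs : (x \in s) => /=; last exact: measurable_prop.
set c := loop_weight p (drop (index x s) s).
rewrite /=.
rewrite [X in measurable X](_ : _ =
  ([set w | Y v n.+1 w <= c] `&` [set w | (s, Some (drop (index x s) s)) = L]) `|`
  (~` [set w | Y v n.+1 w <= c] `&` [set w | (take (index x s).+1 s, None) = L])).
  apply: measurableU; apply: measurableI; try exact: measurable_prop.
    exact: measurable_unif_le.
  by apply: measurableC; exact: measurable_unif_le.
apply/seteqP; split=> w /=; case: ifP => h; [by left| |by case=> -[]//|by case=> -[]//].
by right; split=> //; apply/negP; rewrite h.
Qed.

Lemma ended_measurable v (W : {fset V}) n :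
  measurable [set w | ended p W (fun i => X v i w) (fun i => Y v i w : R) n].
Proof.
have mXY := discrete_pair (lerw_discrete v n) (walk_discrete input v n).
exact: (@discrete_preimage _ _ (lerw_state V * V)%type _
  [set sx | (sx.1.2 != None) || (sx.2 \in W)] mXY).
Qed.

(** The event is split by the ending time; if the walk never ends, the final state is the default,
    the starting point. *)
Lemma lerw_final_discrete v (W : {fset V}) :
  discrete_rv (fun w => lerw_final p W (fun i => X v i w) (fun i => Y v i w : R)).
Proof.
move=> L; pose E n := [set w | ended p W (fun i => X v i w) (fun i => Y v i w : R) n].
have mE n : measurable (E n) := ended_measurable v W n.
rewrite (_ : [set w | _] =
  (\bigcup_n (E n `&` (\bigcap_(j in [set j | (j < n)%N]) ~` E j) `&` [set w | lerw_at v w n = L])) `|`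
  ((\bigcap_n ~` E n) `&` [set w | X v 0%N w \in [set x | ([:: x], None) = L]])).
  apply: measurableU.
    apply: bigcupT_measurable => n; apply: measurableI; last exact: lerw_discrete.
    apply: measurableI => //; apply: fin_bigcap_measurable.
      exact: finite_II.
    by move=> k _; apply: measurableC.
  apply: measurableI; first by apply: bigcapT_measurable => k; apply: measurableC.
  rewrite (_ : [set w | _] = X v 0%N @^-1` [set x | ([:: x], None) = L]).
    exact/discrete_preimage/(walk_discrete input).
  by apply/seteqP; split=> w /=; rewrite inE.
apply/seteqP; split=> w /=.
  have [[n0 en0]|nex] := pselect (exists n, ended p W (fun i => X v i w) (fun i => Y v i w : R) n).
    have ex : exists n, ended p W (fun i => X v i w) (fun i => Y v i w : R) n by exists n0.
    case: (ex_minnP ex) => n en nmin eL; left; exists n => //.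
    have before j : (j < n)%N -> ~~ ended p W (fun i => X v i w) (fun i => Y v i w : R) j.
      by move=> jn; apply/negP => /nmin; rewrite leqNgt jn.
    split; last by rewrite /= -eL (lerw_final_first en before).
    by split=> // j jn; apply/negP/before.
  rewrite /lerw_final; case: pselect => // _ eL; right; split; last by rewrite inE.
  by move=> n _ en; apply: nex; exists n.
case=> [[n _ [[en before] eL]]|[none]].
  by rewrite (lerw_final_first en) // => j jn; apply/negP/(before j jn).
rewrite inE /= => eL; rewrite /lerw_final; case: pselect => // -[n en].
by case: (none n I).
Qed.

Variable phi : nat -> V.

Lemma forest_step_discrete j : discrete_rv (fun w => forest_step p phi (xs w) (ys w) j).
Proof.
elim: j => [|j IH] F /=; first exact: measurable_prop.
apply: (@discrete_compose _ _ ({fset V} * {fset {fset V}})%type _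
  (fun F0 w => ((F0.1 `|` state_vertices (lerw_final p F0.1 (xs w (phi j)) (ys w (phi j))))%fset,
     (F0.2 `|` state_edges (lerw_final p F0.1 (xs w (phi j)) (ys w (phi j))))%fset) = F) IH) => F0.
exact: (@discrete_preimage _ _ (lerw_state V) _
  [set L | ((F0.1 `|` state_vertices L)%fset, (F0.2 `|` state_edges L)%fset) = F]
  (lerw_final_discrete (phi j) F0.1)).
Qed.

Lemma limit_forest_measurable :
  measurable_fun setT (fun w => limit_forest p phi (xs w) (ys w)).
Proof.
apply: (@measurability _ _ T (Omega e) setT _ (@cylinders V e) erefl).
move=> _ [_ [a [b ->]] <-]; rewrite setTI.
pose A := \bigcup_i [set w | val a \in (forest_step p phi (xs w) (ys w) i).2].
have mA : measurable A.
  apply: bigcupT_measurable => i.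
  exact: (@discrete_preimage _ _ ({fset V} * {fset {fset V}})%type _
    [set F : {fset V} * {fset {fset V}} | val a \in F.2] (forest_step_discrete i)).
have eA w : (limit_forest p phi (xs w) (ys w) a = true) <-> A w.
  by rewrite /limit_forest /config; split=> [/asboolP[i _ ai]|[i _ ai]]; [exists i|apply/asboolP; exists i].
case: b.
  by rewrite (_ : _ @^-1` _ = A) //; apply/seteqP; split=> w /=; rewrite eA.
rewrite (_ : _ @^-1` _ = ~` A); first exact: measurableC.
apply/seteqP; split=> w /=; first by move=> h /eA; rewrite h.
by case h : (limit_forest _ _ _ _ _) => // nA; case: nA; apply/eA.
Qed.

End Measurability.

(** * The probability of remaining unrooted *)

Section SurvivalBound.
Variables (R : realType) (V : countType) (e : rel V) (p : cycle_weight R e).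
Context (d : measure_display) (T : measurableType d) (P : probability T R).
Variables (X : V -> nat -> T -> V) (Y : V -> nat -> {RV P >-> R}).
Hypothesis input : algorithm_input e X Y.
Hypothesis e_lf : locally_finite e.
Hypothesis e_deg : forall x, (0 < degree e x)%N.
Variable x0 : V.

Local Notation lerw_at v w n := (lerw p (fun i => X v i w) (fun i => Y v i w : R) n).
Local Notation walk_event := (walk_event X Y).
Local Notation past := (past X Y).

Definition unrooted v n := [set w | (lerw_at v w n).2 = None].

Lemma unrooted_measurable v n : measurable (unrooted v n).
Proof.
exact: (@discrete_preimage _ _ (lerw_state V) _ [set L | L.2 = None] (lerw_discrete p input v n)).
Qed.

Variable v : V.

Let vK : inl v \notin (fset0 : {fset (V + V)}). Proof. by rewrite in_fset0. Qed.
Let vK' : inr v \notin (fset0 : {fset (V + V)}). Proof. by rewrite in_fset0. Qed.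

Let mwalk t Bs (mBs : meas_seq Bs) : measurable (walk_event setT v t Bs) :=
  walk_event_measurable input (past_setT X Y) vK vK' t mBs.

Let pr_step t y Bs B b (mBs : meas_seq Bs) (mB : measurable B) :=
  @pr_walk_event_rcons _ _ _ _ _ _ _ _ input _ _ _ (past_setT X Y) vK vK' t y Bs B b mBs mB.

(** The induction of [killed_bound] without confinement to a finite set: the next vertex ranges over
    all of [V], so jumps to non-neighbours must first be discarded as a null event. *)
Lemma survival_bound r t Bs s : size t = size Bs -> meas_seq Bs -> last x0 s = last v t ->
  (forall w, walk_event setT v t Bs w -> lerw_at v w (size t) = (s, None)) ->
  pr P (walk_event setT v t Bs `&` unrooted v (size t + r)) <=
  pr P (walk_event setT v t Bs) * survival p x0 r s.
Proof.
elim: r t Bs s => [|r IH] t Bs s sz mBs ls run.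
  rewrite mulr1; apply: pr_le; [|exact: mwalk|exact: subIsetl].
  by apply: measurableI; [exact: mwalk|exact: unrooted_measurable].
set E := walk_event setT v t Bs in run *; have mE : measurable E := mwalk t mBs.
pose k := size t.
have msT : measurable (setT : set R) by [].
have mX y : measurable (X v k.+1 @^-1` [set y]) := walk_discrete input v k.+1 y.
have ext B y : walk_event setT v (rcons t y) (rcons Bs B) =
    E `&` ((X v k.+1 @^-1` [set y]) `&` (Y v k.+1 @^-1` B)) by exact: walk_event_rcons.
have szS B y : size (rcons t y) = size (rcons Bs B) by rewrite !size_rcons sz.
have prE y : pr P (E `&` X v k.+1 @^-1` [set y]) = pr P E * srw_step R e (last v t) y.
  rewrite (_ : _ `&` _ = walk_event setT v (rcons t y) (rcons Bs setT)); last first.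
    by rewrite ext preimage_setT setIT.
  by rewrite (pr_step t y mBs msT (uniform_setT R)) mulr1.
pose N := neighbours e (last v t).
pose Z := E `&` X v k.+1 @^-1` (~` [set` N]).
have mZ : measurable Z.
  by apply: measurableI => //; apply: discrete_preimage; apply: (walk_discrete input).
(* The steps to neighbours already exhaust the probability of [E]. *)
have Z0 : pr P Z = 0.
  pose F := E `&` X v k.+1 @^-1` [set` N].
  have mF : measurable F.
    by apply: measurableI => //; apply: discrete_preimage; apply: (walk_discrete input).
  have FZ : pr P E = pr P F + pr P Z.
    rewrite -pr_setU_disjoint //.
      by rewrite -setIUr -preimage_setU setUv preimage_setT setIT.
    by apply/seteqP; split=> // w [[_ h] [_ h']].
  have Ffull : forall s : seq V, uniq s ->
      pr P (E `&` X v k.+1 @^-1` [set` s]) = \sum_(y <- s) pr P E * srw_step R e (last v t) y.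
    elim=> [|y s' IHs] /=.
      move=> _; rewrite big_nil (_ : _ `&` _ = set0) ?pr_set0 //.
      by apply/seteqP; split=> // w [_]; rewrite /= in_nil.
    case/andP => ys us; rewrite big_cons -IHs // -prE -pr_setU_disjoint.
    - congr (pr P _); rewrite -setIUr; congr (_ `&` _).
      apply/seteqP; split=> w /=; rewrite inE.
        by move=> /orP[/eqP|]; [left|right].
      by move=> [->|->]; rewrite ?eqxx ?orbT.
    - exact: measurableI.
    - by apply: measurableI => //; apply: discrete_preimage; apply: (walk_discrete input).
    - apply/seteqP; split=> // w [[_ /= ey] [_ /= ys']].
      by rewrite -ey ys' in ys.
  have : pr P F = pr P E.
    rewrite /F (Ffull N (fset_uniq N)) -mulr_sumr srw_step_neighbours // mulr1.
    by [].
  lra.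
have mU := unrooted_measurable v (k + r.+1).
have mEyU y : measurable (E `&` X v k.+1 @^-1` [set y] `&` unrooted v (k + r.+1)).
  by apply: measurableI => //; apply: measurableI.
have cover : pr P (E `&` unrooted v (k + r.+1)) <=
    pr P Z + \sum_(y <- N) pr P (E `&` X v k.+1 @^-1` [set y] `&` unrooted v (k + r.+1)).
  have mZ' : measurable ((E `&` unrooted v (k + r.+1)) `\` Z).
    by apply: measurableD => //; apply: measurableI.
  apply: (@le_trans _ _ (pr P (Z `|` ((E `&` unrooted v (k + r.+1)) `\` Z)))).
    apply: pr_le; [exact: measurableI|exact: measurableU|].
    by move=> w Ew; have [Zw|Zw] := pselect (Z w); [left|right].
  apply: (le_trans (pr_setU P mZ mZ')); rewrite lerD2l; apply: pr_cover => //.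
  move=> w [[Ew Uw] nZ]; exists (X v k.+1 w) => //.
  by apply: contrapT => nN; apply: nZ.
apply: (le_trans cover); rewrite Z0 add0r /= ls mulr_sumr; apply: ler_sum => y _.
have key B b s' : measurable B -> uniform_prob (@ltr01 R) B = b%:E ->
    last x0 s' = y ->
    (forall w, E w -> X v k.+1 w = y -> B (Y v k.+1 w) -> lerw_at v w k.+1 = (s', None)) ->
    (forall w, E w -> X v k.+1 w = y -> unrooted v (k + r.+1) w -> B (Y v k.+1 w)) ->
    pr P (E `&` X v k.+1 @^-1` [set y] `&` unrooted v (k + r.+1)) <=
    pr P E * (srw_step R e (last v t) y * (b * survival p x0 r s')).
  move=> mB eb ls' next inB.
  have mBs' := meas_seq_rcons mBs mB.
  apply: (@le_trans _ _ (pr P (walk_event setT v (rcons t y) (rcons Bs B) `&`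
      unrooted v (size (rcons t y) + r)))).
    rewrite size_rcons addSnnS; apply: pr_le => //.
      by apply: measurableI => //; apply: mwalk.
    move=> w [[Ew ey] Uw]; split=> //; rewrite ext; split=> //; split=> //.
    exact: inB.
  apply: (le_trans (IH _ _ s' (szS B y) mBs' _ _)).
  - by rewrite ls' last_rcons.
  - move=> w; rewrite ext size_rcons => -[Ew [/= ey By]]; exact: next.
  - by rewrite (pr_step t y mBs mB eb) !mulrA.
rewrite /erase_prob; case: ifPn => ys.
  set c := drop (index y s) s.
  apply: (key [set z | loop_weight p c < z]).
  - exact: measurable_gt.
  - exact/uniform_prob_gt/loop_weight_itv.
  - exact: last_erase_step.
  - move=> w Ew ey yl; rewrite /erase_step ys.
    by rewrite -[k]/(size t) (lerw_erase (run w Ew)) ey.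
  - move=> w Ew ey Uw /=; rewrite ltNge; apply/negP => yl.
    have := lerw_none_le (j := k.+1) Uw; rewrite addnS ltnS leq_addr => /(_ isT).
    by rewrite -[k]/(size t) (lerw_keep (run w Ew)) ey.
apply: (key setT) => //.
- exact: (uniform_setT R).
- exact: last_erase_step.
- move=> w Ew ey _; rewrite /erase_step (negbTE ys).
  by rewrite -[k]/(size t) (lerw_new (run w Ew)) ey.
Qed.

End SurvivalBound.

(** * Successive walks on the infinite graph *)

Section Algorithm.
Variables (R : realType) (V : countType) (e : rel V) (p : cycle_weight R e).
Context (d : measure_display) (T : measurableType d) (P : probability T R).
Variables (X : V -> nat -> T -> V) (Y : V -> nat -> {RV P >-> R}).
Hypothesis input : algorithm_input e X Y.
Variables (x0 : V) (phi : nat -> V).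
Hypothesis phi_inj : injective phi.

Local Notation xs w := (fun x n => X x n w).
Local Notation ys w := (fun x n => Y x n w : R).
Local Notation step w j := (forest_step p phi (xs w) (ys w) j).
Local Notation lerw_at v w n := (lerw p (fun i => X v i w) (fun i => Y v i w : R) n).
Local Notation walk_event := (walk_event X Y).
Local Notation past := (past X Y).

Section Good.
Variables (U : {fset V}) (m i : nat) (Phi : {fset {fset V}} -> R) (Good : set T).
Hypothesis Good_meas : measurable Good.
Hypothesis Phi_ge0 : forall A, 0 <= Phi A.
Hypothesis Good_start : forall w j, Good w -> (j < i)%N -> X (phi j) 0%N w = phi j.
Hypothesis Good_U : forall w j k, Good w -> (j < i)%N -> (k <= m)%N -> X (phi j) k w \in U.
Hypothesis Good_rooted : forall w j, Good w -> (j < i)%N -> (lerw_at (phi j) w m).2 <> None.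
Hypothesis Good_Phi : forall w, Good w -> 1 <= Phi (step w i).2.

(** [H] fixes the forest built so far and involves only the sequences in [K]. As [phi] is injective,
    the next walk reads fresh sequences, and [killed_bound] applies with the value of the remaining
    walks as payoff. *)
Lemma forest_bound r j K H F : (r + j = i)%N -> past K H ->
  (forall l, (j <= l < i)%N -> inl (phi l) \notin K /\ inr (phi l) \notin K) ->
  (forall w, H w -> step w j = F) ->
  pr P (H `&` Good) <= pr P H * forest_value p U x0 phi Phi m r j F.
Proof.
elim: r j K H F => [|r IH] j K H F rj HK fresh HF /=.
  have mH := past_measurable input HK.
  have [->|/eqP/set0P[w [Hw Gw]]] := pselect (H `&` Good = set0).
    by rewrite pr_set0 mulr_ge0 ?pr_ge0.
  have := Good_Phi Gw; rewrite -rj add0n (HF w Hw) => Phi1.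
  apply: (@le_trans _ _ (pr P H)).
    by apply: pr_le; [exact: measurableI|exact: mH|exact: subIsetl].
  by rewrite ler_peMr ?pr_ge0.
have ji : (j < i)%N by rewrite -rj addSn ltnS leq_addl.
have [vK vK'] : inl (phi j) \notin K /\ inr (phi j) \notin K.
  by apply: fresh; rewrite leqnn.
set v := phi j in vK vK' *.
set next := fun L => _.
have next0 L : 0 <= next L by apply: forest_value_ge0.
have start : pr P (H `&` Good) = pr P (walk_event H v [::] [::] `&` Good).
  congr (pr P _); apply/seteqP; split=> w [Hw Gw]; split=> //; last by case: Hw.
  split=> //; split; last by rewrite unif_event_nil.
  by rewrite trajectory_nil /= Good_start.
have final t Bs L : meas_seq Bs -> size t = size Bs ->
  (forall w, walk_event H v t Bs w -> lerw_final p F.1 (xs w v) (ys w v) = L) ->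
  pr P (walk_event H v t Bs `&` Good) <= pr P (walk_event H v t Bs) * next L.
  move=> mBs sz fin; have [_ HK'] := walk_event_past input HK vK vK' t mBs.
  apply: (IH j.+1 _ _ _ _ HK'); first by rewrite addnS.
    move=> l /andP[jl li]; have [lK lK'] := fresh l (ltac:(by rewrite li ltnW)).
    have lj : phi l <> v by move/phi_inj => lj; rewrite lj ltnn in jl.
    split; apply/negP; rewrite !in_fset1U => /orP[/eqP|/orP[/eqP|]] //.
    - by case.
    - by rewrite (negbTE lK).
    - by case.
    - by rewrite (negbTE lK').
  move=> w Ew; have Hw : H w by case: Ew.
  by rewrite /= (HF w Hw) (fin w Ew).
rewrite start -(walk_event_nil input HK vK vK').
have m0 : meas_seq ([::] : seq (set R)) by [].
case: ifP => jF.
  apply: final => // w [_ [+ _]]; rewrite trajectory_nil /= => ew.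
  have en : ended p F.1 (xs w v) (ys w v) 0 by rewrite /ended ew jF orbT.
  by rewrite (lerw_final_first en) //= ew.
apply: (killed_bound input (x0 := x0) HK vK vK' (m := m)) => //.
- by move=> w Gw; apply: Good_rooted.
- by move=> w k Gw km; apply: Good_U.
- by move=> z; rewrite inE => /eqP ->; rewrite jF.
- move=> w [_ [+ _]]; rewrite trajectory_nil /= => ew.
  by split=> [|k]; [rewrite ew|rewrite leqn0 => /eqP ->; rewrite ew jF].
Qed.

Lemma good_bound : pr P Good <= forest_value p U x0 phi Phi m i 0 (fset0, fset0).
Proof.
have := @forest_bound i 0 fset0 setT (fset0, fset0) (addn0 i) (past_setT X Y).
by rewrite setTI pr_setT mul1r; apply.
Qed.

End Good.

End Algorithm.

(** * The edges added by one walk, and stability of the forest built *)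

Section Forest.
Variables (R : realType) (V : countType) (e : rel V) (p : cycle_weight R e).
Implicit Types (xs : nat -> V) (ys : nat -> R) (W : {fset V}).

Lemma lerw_visited xs ys n z : z \in (lerw p xs ys n).1 -> exists2 j, (j <= n)%N & z = xs j.
Proof.
elim: n z => [|n IH] z /=; first by rewrite inE => /eqP ->; exists 0%N.
case: (lerw p xs ys n) IH => s [c|] /= IH.
  by move=> /IH[j jn ->]; exists j => //; apply: leqW.
have old y : y \in s -> exists2 j, (j <= n.+1)%N & y = xs j.
  by move=> /IH[j jn ->]; exists j => //; apply: leqW.
case: ifP => _; first by rewrite mem_rcons inE => /orP[/eqP ->|/old //]; exists n.+1.
by case: ifP => _ //= => [/old //|/mem_take/old].
Qed.

Lemma path_edges_rcons (s : seq V) x a : a \in path_edges (rcons s x) ->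
  exists2 z, z \in a & z \in s.
Proof.
case/mem_path_edges => xy + ->; elim: s => [//|y [|y' s] IH].
  by rewrite /= inE => /eqP -> /=; exists y; rewrite !inE eqxx.
rewrite rcons_cons [behead _]/= rcons_cons [zip _ _]/= inE => /orP[/eqP -> /=|/IH[z za zs]].
  by exists y; rewrite !inE eqxx.
by exists z => //; rewrite inE zs orbT.
Qed.

Lemma path_edges_mem (s : seq V) a : a \in path_edges s -> exists2 z, z \in a & z \in s.
Proof.
case/lastP: s => [|s x]; first by case/mem_path_edges.
by case/path_edges_rcons => z za zs; exists z => //; rewrite mem_rcons inE zs orbT.
Qed.

(** Before its ending time the walk avoids [W], so only the last vertex of the final path can lie in
    [W], and every edge has another endpoint. *)
Lemma lerw_final_edges W xs ys a : a \in state_edges (lerw_final p W xs ys) ->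
  exists2 z, z \in a & z \notin W.
Proof.
have nil x : a \in state_edges ([:: x], None) -> False.
  by rewrite /state_edges in_fsetU in_fset0 orbF => /mem_path_edges[].
rewrite /lerw_final; case: pselect => [ex|_]; last by move/nil.
case: ex_minnP => n en nmin; case: n en nmin => [|k] en nmin; first by move/nil.
have before j : (j <= k)%N -> (lerw p xs ys j).2 = None /\ xs j \notin W.
  move=> jk; have : ~~ ended p W xs ys j by apply/negP => /nmin; rewrite ltnNge jk.
  by rewrite /ended negb_or negbK => /andP[/eqP].
have [k0 _] := before k (leqnn k).
case ek : (lerw p xs ys k) k0 => [s kept] /= ekept; rewrite {kept}ekept in ek *.
have sW z : z \in s -> z \notin W.
  move=> zs; have [|j jk ->] := @lerw_visited xs ys k z; first by rewrite ek.
  by have [] := before j jk.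
rewrite ek /lerw_step; case: ifP => _.
  rewrite /state_edges in_fsetU in_fset0 orbF => /path_edges_rcons[z za zs].
  by exists z => //; apply: sW.
case: ifP => _; rewrite /state_edges in_fsetU /=.
  case/orP => [/path_edges_mem[z za zs]|/mem_cycle_edges[z zc ->]].
    by exists z => //; apply: sW.
  by exists z; [rewrite !inE eqxx|apply/sW/(mem_drop zc)].
rewrite in_fset0 orbF => /path_edges_mem[z za /mem_take zs].
by exists z => //; apply: sW.
Qed.

Variables (phi : nat -> V) (xs : V -> nat -> V) (ys : V -> nat -> R).
Local Notation step := (forest_step p phi xs ys).

Lemma forest_step_vertex j l : (l < j)%N -> xs (phi l) 0%N = phi l -> phi l \in (step j).1.
Proof.
elim: j => // j IH; rewrite ltnS leq_eqVlt => /orP[/eqP ->|lj] el /=; last first.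
  by rewrite in_fsetU IH.
rewrite in_fsetU; apply/orP; right.
have starts n : exists s, (lerw p (xs (phi j)) (ys (phi j)) n).1 = phi j :: s.
  elim: n => [|n [s es]] /=; first by exists [::]; rewrite el.
  case: (lerw p (xs (phi j)) (ys (phi j)) n) es => s' [c|] /= ->; first by exists s.
  case: ifP => _; first by exists (rcons s (xs (phi j) n.+1)).
  case: ifP => _; first by exists s.
  by rewrite /=; eexists.
have [s es] : exists s, (lerw_final p (step j).1 (xs (phi j)) (ys (phi j))).1 = phi j :: s.
  rewrite /lerw_final; case: pselect => [ex|_]; first exact: starts.
  by exists [::]; rewrite /= el.
by rewrite /state_vertices es; apply/imfsetP; exists (phi j); rewrite //= mem_head.
Qed.

Lemma forest_step_le i j : (i <= j)%N ->
  ((step i).1 `<=` (step j).1)%fset /\ ((step i).2 `<=` (step j).2)%fset.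
Proof.
move=> /subnK <-; elim: (j - i)%N => [|k [IH1 IH2]]; first by split; apply: fsubset_refl.
rewrite addSn /=; split.
  exact: fsubset_trans IH1 (fsubsetUl _ _).
exact: fsubset_trans IH2 (fsubsetUl _ _).
Qed.

(* A later walk stops on reaching the forest, so each edge that it adds has an
   endpoint outside. *)
Lemma limit_forest_edges i (a : edge_set e) : (val a `<=` (step i).1)%fset ->
  limit_forest p phi xs ys a = (val a \in (step i).2).
Proof.
move=> aF; have later k : val a \in (step (k + i)).2 -> val a \in (step i).2.
  elim: k => // k IH; rewrite addSn /= in_fsetU => /orP[/IH //|/lerw_final_edges[z za zF]].
  case/negP: zF; apply: (fsubsetP (forest_step_le (leq_addl k i)).1).
  exact: (fsubsetP aF).
apply/asboolP/idP => [[j _ /= aj]|ai]; last by exists i.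
have [ij|ij] := leqP i j; first by apply: (later (j - i)%N); rewrite subnK.
exact: (fsubsetP (forest_step_le (ltnW ij)).2).
Qed.

End Forest.

(** * The good events have almost full probability *)

Section LimitLower.
Variables (R : realType) (V : countType) (e : rel V) (p : cycle_weight R e).
Context (d : measure_display) (T : measurableType d) (P : probability T R).
Variables (X : V -> nat -> T -> V) (Y : V -> nat -> {RV P >-> R}).
Hypothesis input : algorithm_input e X Y.
Hypothesis e_lf : locally_finite e.
Hypothesis e_deg : forall x, (0 < degree e x)%N.
Variables (x0 : V) (phi : nat -> V).
Hypothesis phi_bij : bijective phi.
Hypothesis survival0 : forall v, survival p x0 ^~ [:: v] @ \oo --> (0 : R).

Local Notation xs w := (fun x n => X x n w).
Local Notation ys w := (fun x n => Y x n w : R).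

Let mX v n B : measurable (X v n @^-1` B).
Proof. exact/discrete_preimage/(walk_discrete input). Qed.

Lemma start_ne v : pr P (~` (X v 0%N @^-1` [set v])) = 0.
Proof.
rewrite pr_setC // (_ : pr P _ = 1) ?subrr //; apply: pr_eq.
have := P_trajectory input v [::]; rewrite trajectory_nil /srw_cylinder /= big_nil.
by [].
Qed.

Lemma unrooted_le v m : pr P (unrooted p X Y v m) <= survival p x0 m [:: v].
Proof.
have mU := unrooted_measurable p input v m.
have vK : inl v \notin (fset0 : {fset (V + V)}) by rewrite in_fset0.
have vK' : inr v \notin (fset0 : {fset (V + V)}) by rewrite in_fset0.
have m0 : meas_seq ([::] : seq (set R)) by [].
have mE := walk_event_measurable input (past_setT X Y) vK vK' [::] m0.
have eE : walk_event X Y setT v [::] [::] = X v 0%N @^-1` [set v].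
  by rewrite /walk_event unif_event_nil setIT setTI trajectory_nil.
have := survival_bound input e_lf e_deg (x0 := x0) (p := p) (v := v) m (t := [::]) (Bs := [::]) (s := [:: v])
  erefl m0 erefl.
rewrite (walk_event_nil input (past_setT X Y) vK vK') pr_setT mul1r add0n => H.
apply: (@le_trans _ _ (pr P ((walk_event X Y setT v [::] [::] `&` unrooted p X Y v m) `|`
   ~` (X v 0%N @^-1` [set v])))).
  apply: pr_le => //.
    apply: measurableU; first exact: measurableI.
    exact: measurableC.
  by move=> w Uw; rewrite eE; have [h|h] := pselect (X v 0%N w = v); [left|right].
apply: (le_trans (pr_setU P _ _)); [exact: measurableI|exact: measurableC|].
rewrite start_ne addr0; apply: H => w; rewrite eE => /= ->.
by [].
Qed.

Definition first_vertices (N : nat) : {fset V} := [fset phi j | j in iota 0 N]%fset.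

Lemma mem_first_vertices N j : (j < N)%N -> phi j \in first_vertices N.
Proof. by move=> jN; apply/imfsetP; exists j => //=; rewrite mem_iota. Qed.

Lemma outside_cvg0 v k : (fun N => pr P (X v k @^-1` (~` [set` first_vertices N]))) @ \oo --> (0 : R).
Proof.
pose F N := X v k @^-1` [set` first_vertices N].
have FT : \bigcup_N F N = setT.
  apply/seteqP; split=> // w _; have [g gK phiK] := phi_bij.
  exists (g (X v k w)).+1 => //; rewrite /F /=.
  by have := @mem_first_vertices (g (X v k w)).+1 (g (X v k w)) (ltnSn _); rewrite phiK.
have cF : (fun N => P (F N)) @ \oo --> P (\bigcup_N F N).
  apply: nondecreasing_cvg_mu.
  - by move=> N; apply: mX.
  - by apply: bigcupT_measurable => N; apply: mX.
  move=> N M NM; apply/subsetPset => w; rewrite /F /= => /imfsetP[j /=].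
  rewrite mem_iota => /andP[_ jN] ->; apply: mem_first_vertices.
  exact: leq_trans NM.
rewrite FT probability_setT in cF.
have cF1 : pr P \o F @ \oo --> (1 : R) by apply: fine_cvg.
have -> : (fun N => pr P (X v k @^-1` (~` [set` first_vertices N]))) = (fun N => 1 - pr P (F N)).
  by apply/funext => N; rewrite -preimage_setC (pr_setC P (mX v k _)).
rewrite -[X in _ --> X](subrr (1 : R)).
by apply: cvgB; [exact: cvg_cst|exact: cF1].
Qed.

Lemma sum_cvg0 (I : Type) (s : seq I) (F : I -> nat -> R) :
  (forall i, F i @ \oo --> (0 : R)) -> (fun n => \sum_(i <- s) F i n) @ \oo --> (0 : R).
Proof.
move=> F0; rewrite [X in _ --> X](_ : 0 = \sum_(i <- s) 0); last by rewrite big1.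
by apply: cvg_big => //; exact: add_continuous.
Qed.

Lemma cvg0_small (F : nat -> R) (eps : R) N0 : F @ \oo --> (0 : R) -> 0 < eps ->
  exists2 N, (N0 <= N)%N & F N < eps.
Proof.
move=> F0 e0; have [N _ HN] : \forall n \near \oo, F n < eps by apply: (cvgr_lt (0 : R)).
exists (maxn N0 N); first exact: leq_maxl.
by apply: HN; rewrite /= leq_maxr.
Qed.

Section Event.
Variables (E : set (Omega e)) (i : nat) (D : {fset V}) (eps : R).
Hypothesis E_meas : measurable E.
Hypothesis D_phi : forall x, x \in D -> exists2 j, (j < i)%N & x = phi j.
Hypothesis E_local : forall w w' : Omega e,
  (forall a : edge_set e, (val a `<=` D)%fset -> w a = w' a) -> E w -> E w'.
Hypothesis eps_gt0 : 0 < eps.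

Definition event_payoff (A : {fset {fset V}}) : R := (`[< E (@config V e [set` A]) >])%:R.

Lemma event_payoff_ge0 A : 0 <= event_payoff A.
Proof. by rewrite /event_payoff; case: asboolP. Qed.

Let limE := (fun w => limit_forest p phi (xs w) (ys w) : Omega e) @^-1` E.

Lemma limit_event_measurable : measurable limE.
Proof.
have := limit_forest_measurable p input phi measurableT E_meas.
by rewrite setTI.
Qed.

(** First [m] is chosen so that the first [i] walks are rooted by time [m], then [N] so that they
    stay among the first [N] vertices up to that time, each with an error below [eps / 2]. Off these
    exceptional events the forest after [i] walks contains [D] and decides [E]. *)
Lemma limit_lower : exists m U, (forall j, (j < i)%N -> phi j \in U) /\
  pr P limE - eps <= forest_value p U x0 phi event_payoff m i 0 (fset0, fset0).
Proof.
have mE := limit_event_measurable.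
have e2 : 0 < eps / 2 by rewrite divr_gt0.
have [m _ sm] : exists2 m, (0 <= m)%N & \sum_(j <- iota 0 i) survival p x0 m [:: phi j] < eps / 2.
  apply: cvg0_small => //.
  by apply: (@sum_cvg0 _ _ (fun j n => survival p x0 n [:: phi j])) => j.
have [N iN oN] : exists2 N, (i <= N)%N & \sum_(j <- iota 0 i) \sum_(k <- iota 0 m.+1)
    pr P (X (phi j) k @^-1` (~` [set` first_vertices N])) < eps / 2.
  apply: cvg0_small => //.
  apply: (@sum_cvg0 _ _ (fun j n => \sum_(k <- iota 0 m.+1)
     pr P (X (phi j) k @^-1` (~` [set` first_vertices n])))) => j.
  by apply: (@sum_cvg0 _ _ (fun k n => pr P (X (phi j) k @^-1` (~` [set` first_vertices n])))) => k; apply: outside_cvg0.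
exists m, (first_vertices N); set U := first_vertices N in oN *.
have phiU j : (j < i)%N -> phi j \in U by move=> ji; apply/mem_first_vertices/(leq_trans ji).
split=> //.
pose out j := \bigcup_(k in `I_m.+1) (X (phi j) k @^-1` (~` [set` U])).
pose bad j := ~` (X (phi j) 0%N @^-1` [set phi j]) `|` out j `|` unrooted p X Y (phi j) m.
have mout j : measurable (out j).
  by apply: bigcup_measurable => k _; apply: mX.
have mU j := unrooted_measurable p input (phi j) m.
have mbad j : measurable (bad j).
  by apply: measurableU => //; apply: measurableU => //; apply: measurableC.
have bad_le j : pr P (bad j) <=
    \sum_(k <- iota 0 m.+1) pr P (X (phi j) k @^-1` (~` [set` U])) + survival p x0 m [:: phi j].
  have m1 : measurable (~` (X (phi j) 0%N @^-1` [set phi j])) by apply: measurableC.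
  apply: (le_trans (pr_setU P (measurableU _ _ m1 (mout j)) (mU j))).
  apply: lerD; last exact: unrooted_le.
  apply: (le_trans (pr_setU P m1 (mout j))); rewrite start_ne add0r.
  apply: pr_cover => // w [k km ok]; exists k => //.
  by rewrite mem_iota.
pose Good := limE `&` \bigcap_(j in `I_i) ~` bad j.
have mGood : measurable Good.
  apply: measurableI => //; apply: fin_bigcap_measurable; first exact: finite_II.
  by move=> j _; apply: measurableC.
have split_bad : pr P limE <= pr P Good + \sum_(j <- iota 0 i) pr P (bad j).
  have mD : measurable (limE `\` Good) by apply: measurableD.
  apply: (@le_trans _ _ (pr P (Good `|` (limE `\` Good)))).
    apply: pr_le => //; first exact: measurableU.
    by move=> w Ew; have [g|g] := pselect (Good w); [left|right].
  apply: (le_trans (pr_setU P mGood mD)); rewrite lerD2l; apply: pr_cover => //.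
  move=> w [Ew nG]; apply: contrapT => none; apply: nG; split=> // j ji bj.
  by apply: none; exists j => //; rewrite mem_iota.
have total : \sum_(j <- iota 0 i) pr P (bad j) <= eps.
  apply: (@le_trans _ _ (\sum_(j <- iota 0 i) (\sum_(k <- iota 0 m.+1)
     pr P (X (phi j) k @^-1` (~` [set` U])) + survival p x0 m [:: phi j]))).
    by apply: ler_sum => j _.
  rewrite big_split /=; lra.
have nbad w j : Good w -> (j < i)%N ->
    [/\ X (phi j) 0%N w = phi j, forall k, (k <= m)%N -> X (phi j) k w \in U &
     ~ unrooted p X Y (phi j) m w].
  move=> [_ nb] ji; have {}nb := nb j ji; split.
  - by apply: contrapT => h; apply: nb; left; left.
  - by move=> k km; apply: contrapT => h; apply: nb; left; right; exists k.
  - by move=> h; apply: nb; right.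
have GP : pr P Good <= forest_value p U x0 phi event_payoff m i 0 (fset0, fset0).
  apply: (good_bound input) => //.
  - exact: bij_inj.
  - by move=> w j Gw ji; have [] := nbad w j Gw ji.
  - by move=> w j k Gw ji km; have [_ + _] := nbad w j Gw ji; apply.
  - by move=> w j Gw ji; have [_ _ +] := nbad w j Gw ji; apply.
  - move=> w Gw; rewrite /event_payoff; case: asboolP => // nE; case: nE.
    have [Ew _] := Gw; apply: E_local Ew => a aD.
    have aF : (val a `<=` (forest_step p phi (xs w) (ys w) i).1)%fset.
      apply/fsubsetP => x /(fsubsetP aD)/D_phi[j ji ->].
      by apply: forest_step_vertex => //; have [] := nbad w j Gw ji.
    rewrite (limit_forest_edges aF) /config /=.
    by apply/idP/asboolP.
lra.
Qed.

End Event.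
End LimitLower.

(** * Weak convergence *)

Section ForestMeasure.
Variables (R : realType) (V : countType) (e : rel V) (p : cycle_weight R e).

Lemma forest_measure_pr (S : {fset {fset {fset V}}}) (E : set (Omega e)) :
  0 < \sum_(F <- S) forest_weight p F ->
  forest_measure p S E =
  ((\sum_(F <- S) forest_weight p F * event_payoff R E F) / \sum_(F <- S) forest_weight p F)%:E.
Proof.
move=> Z0; rewrite /forest_measure /mnormalize.
have msumE (A : set (Omega e)) : msum (fun i : nat =>
      mscale (NngNum (forest_weight_ge0 p (nth fset0 S i)))
        (dirac (@config V e [set` nth fset0 S i]))) #|` S| A =
    (\sum_(F <- S) forest_weight p F * event_payoff R A F)%:E.
  rewrite /msum -sumEFin (big_nth fset0) big_mkord; apply: eq_bigr => k _.
  rewrite EFinM; congr (_ * _)%E; rewrite /dirac /= indicE /event_payoff.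
have eT : \sum_(F <- S) forest_weight p F * event_payoff R (setT : set (Omega e)) F =
    \sum_(F <- S) forest_weight p F.
  by apply: eq_bigr => F _; rewrite /event_payoff; case: asboolP => [_|[]] //; rewrite mulr1.
rewrite /= !msumE eT orbF eqe gt_eqF //=. by rewrite msumE -EFinM.
Qed.

End ForestMeasure.

Section LocalSets.
Variables (R : realType) (V : countType) (e : rel V).

Lemma coordinate_measurable (a : edge_set e) b : measurable [set w : Omega e | w a = b].
Proof. by apply: sub_sigma_algebra; exists a, b. Qed.

Lemma pattern_discrete (D : seq (edge_set e)) :
  discrete_rv (fun w : Omega e => [seq w a | a <- D]).
Proof.
elim: D => [|a D IH] b /=; first exact: measurable_prop.
case: b => [|b bs].
  by rewrite [X in measurable X](_ : _ = set0) //; apply/seteqP; split.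
rewrite (_ : [set w | _] = [set w : Omega e | w a = b] `&` [set w : Omega e | [seq w a | a <- D] = bs]).
  by apply: measurableI; [exact: coordinate_measurable|exact: IH].
by apply/seteqP; split=> w /= [-> ->].
Qed.

Definition determined_by (D : {fset edge_set e}) (E : set (Omega e)) :=
  forall w w' : Omega e, (forall a, a \in D -> w a = w' a) -> E w -> E w'.

Lemma determined_measurable D E : determined_by D E -> measurable E.
Proof.
move=> ED; rewrite (_ : E = (fun w : Omega e => [seq w a | a <- D]) @^-1`
    [set b | exists2 w : Omega e, [seq w a | a <- D] = b & E w]).
  exact: (@discrete_preimage _ _ (seq bool) _ _ (pattern_discrete (enum_fset D))).
apply/seteqP; split=> [w Ew|w [w' ew Ew']]; first by exists w.
by move/eq_in_map: ew => ew; apply: ED Ew' => a aD; apply: ew.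
Qed.

Lemma determinedC D E : determined_by D E -> determined_by D (~` E).
Proof. by move=> ED w w' ww' nE Ew'; apply: nE; apply: ED Ew' => a aD; rewrite ww'. Qed.

Section Integral.
Variables (D : {fset edge_set e}) (f : Omega e -> R).
Hypothesis fD : forall w w' : Omega e, (forall a, a \in D -> w a = w' a) -> f w = f w'.

Let pattern (b : (size D).-tuple bool) : set (Omega e) := [set w | [seq w a | a <- D] = b].

Lemma pattern_determined b : determined_by D (pattern b).
Proof.
move=> w w' ww' eb; rewrite /pattern /mkset -eb.
by apply/esym/eq_in_map => a aD; apply: ww'.
Qed.

Let value (b : (size D).-tuple bool) : R := f (xget (fun=> false) (pattern b)).

(** A local function is a finite combination of indicators of patterns on [D], so weak convergence
    reduces to convergence of finitely many probabilities. *)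
Lemma local_integral (mu : probability (Omega e) R) :
  (\int[mu]_w (f w)%:E = (\sum_b value b * fine (mu (pattern b)))%:E)%E.
Proof.
have mp b : measurable (pattern b) by apply: determined_measurable; apply: pattern_determined.
have fE w : (f w)%:E = (\sum_b (value b)%:E * (\1_(pattern b) w)%:E)%E.
  have sz : size [seq w a | a <- D] == size D by rewrite size_map.
  pose b0 : (size D).-tuple bool := Tuple sz.
  rewrite (bigD1 b0) //= big1 ?adde0.
    rewrite indicE mem_set // mule1 /value; congr (_%:E); apply: fD => a aD.
    have : pattern b0 (xget (fun=> false) (pattern b0)) by apply: xgetPex; exists w.
    by move=> /esym/eq_in_map; apply.
  move=> b bb0; rewrite indicE memNset ?mule0 // => wb.
  by move/eqP: bb0; apply; apply: val_inj.
under eq_integral do rewrite fE.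
rewrite integral_sum //; last first.
  by move=> b; apply: integrableZl => //; apply: integrable_indic.
rewrite -sumEFin; apply: eq_bigr => b _.
rewrite integralZl //; last exact: integrable_indic.
by rewrite integral_indic // setIT EFinM fineK // fin_num_measure.
Qed.

End Integral.

Lemma weak_limit (mu : nat -> probability (Omega e) R) (nu : probability (Omega e) R) :
  (forall D E eps, determined_by D E -> 0 < eps ->
     \forall n \near \oo, fine (nu E) - eps <= fine (mu n E)) ->
  converges_weakly (fun n => mu n) nu.
Proof.
move=> low f [D fD].
have cvE E : determined_by D E -> (fun n => fine (mu n E)) @ \oo --> fine (nu E).
  move=> ED; have mE := determined_measurable ED.
  apply/cvgrPdist_le => eps eps0.
  have lowE := low D E eps ED eps0; have lowC := low D (~` E) eps (determinedC ED) eps0.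
  near=> n; have h1 : fine (nu E) - eps <= fine (mu n E) by near: n.
  have h2 : fine (nu (~` E)) - eps <= fine (mu n (~` E)) by near: n.
  have eC (m : probability (Omega e) R) : fine (m (~` E)) = 1 - fine (m E) := pr_setC m mE.
  rewrite !eC in h2; rewrite ler_norml; apply/andP; split; lra.
rewrite (local_integral fD nu).
under eq_fun do rewrite (local_integral fD (mu _)).
apply: cvg_EFin; first by apply: nearW.
apply: cvg_big => //=; first exact: add_continuous.
by move=> b _; apply: cvgMl_tmp; apply: cvE; apply: pattern_determined.
Unshelve. all: by end_near.
Qed.

End LocalSets.

Lemma degree_gt0 (V : countType) (e : rel V) : infinite_graph e ->
  forall x, (0 < degree e x)%N.
Proof.
move=> gr x; have [y yx] : exists y, y != x.
  apply: contrapT => none; apply: (graph_inf gr).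
  rewrite (_ : [set: V] = [set x]); first exact: finite_set1.
  apply/seteqP; split=> // y _ /=; apply: contrapT => yx; apply: none.
  by exists y; apply/eqP.
have [s ps ey] := (graph_conn gr).2 x y I I.
case: s ps ey => [|z s] /=; first by move=> _ ey; rewrite ey eqxx in yx.
case/andP => exz _ _; rewrite /degree cardfs_gt0; apply/fset0Pn; exists z.
by rewrite -[fset_set _]/(neighbours e x) mem_neighbours //; apply: graph_lfin gr.
Qed.

Section Convergence.
Variables (R : realType) (V : countType) (e : rel V) (G : nat -> {fset V}).
Variables (p : cycle_weight R e) (phi : nat -> V).
Context (d : measure_display) (T : measurableType d) (P : probability T R).
Variables (X : V -> nat -> T -> V) (Y : V -> nat -> {RV P >-> R}).
Hypothesis gr : infinite_graph e.
Hypothesis exh : exhaustion e G.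
Hypothesis loops : loop_assumption p G.
Hypothesis phi_bij : bijective phi.
Hypothesis input : algorithm_input e X Y.

Let e_irr := graph_irr gr.
Let e_sym := graph_sym gr.
Let e_lf := graph_lfin gr.
Let e_deg := degree_gt0 gr.
Let limit w : Omega e := limit_forest p phi (fun x n => X x n w) (fun x n => Y x n w : R).

Lemma survival_cvg0 v : survival p (phi 0%N) ^~ [:: v] @ \oo --> (0 : R).
Proof.
rewrite -(survival_lim_eq0 e_lf e_deg (phi 0%N) (graph_conn gr) (graph_inf gr)
  exh (s := [:: v]) loops) //.
exact: survival_cvg.
Qed.

Lemma boundary_neq0 n : exists v, v \in boundary e (G n).
Proof.
have [[x xG] _] := exh_conn exh n.
have [s _ sb] := boundary_reached (graph_conn gr) (graph_inf gr) (G := G) xG.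
by exists (last x s).
Qed.

Section Volume.
Variable W : nat -> {fset V}.
Hypothesis W_boundary : forall n, (W n `<=` boundary e (G n))%fset.
Hypothesis W_pos : forall n, (0 < n)%N ->
  0 < \sum_(F <- ECRSFs e (G n) (W n)) forest_weight p F.

(** [m] and [U] come from the infinite graph; [n] only has to be so large that [G n] contains [U]
    and all its neighbours, whence [U] misses the boundary and with it [W n]. *)
Lemma volume_lower (D : {fset edge_set e}) (E : set (Omega e)) (eps : R) :
  determined_by D E -> 0 < eps ->
  \forall n \near \oo, pr P (limit @^-1` E) - eps <=
    fine (forest_measure p (ECRSFs e (G n) (W n)) E).
Proof.
move=> ED eps0; have mE := determined_measurable ED.
pose DV : {fset V} := (\bigcup_(a <- D) val a)%fset.
have [g gK phiK] := phi_bij.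
(* One more than the largest index of an endpoint of an edge in [D], so that each endpoint starts
   one of the first [i] walks. *)
pose i := (\max_(x <- DV) g x).+1.
have DVi x : x \in DV -> exists2 j, (j < i)%N & x = phi j.
  by move=> xD; exists (g x); rewrite ?phiK // ltnS; apply: leq_bigmax_seq.
have DDV a : a \in D -> (val a `<=` DV)%fset.
  by move=> aD; apply: bigfcup_sup.
have E_loc (w w' : Omega e) : (forall a : edge_set e, (val a `<=` DV)%fset -> w a = w' a) ->
    E w -> E w'.
  by move=> ww'; apply: ED => a aD; apply/ww'/DDV.
have [m [U [phiU low]]] :=
  limit_lower input e_lf e_deg phi_bij survival_cvg0 mE DVi E_loc eps0.
have [n0 Un0] := exhaustion_cover exh (enum_fset U ++ flatten [seq enum_fset (neighbours e x) | x <- U]).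
(* The successor ensures [0 < n], as [W_pos] requires. *)
exists n0.+1 => // n /= n0n.
have sub z : z \in U \/ (exists2 x, x \in U & e x z) -> z \in G n.
  move=> zU; apply: (fsubsetP (exhaustion_le exh (ltnW n0n))); apply: Un0.
  rewrite mem_cat; case: zU => [->//|[x xU xz]]; apply/orP; right.
  apply/flattenP; exists (enum_fset (neighbours e x)); first exact: map_f.
  by rewrite -[_ \in _]/(z \in neighbours e x) mem_neighbours.
have UG : (U `<=` G n)%fset by apply/fsubsetP => z zU; apply: sub; left.
have UW x : x \in U -> x \notin W n.
  move=> xU; apply/negP => /(fsubsetP (W_boundary n))/mem_boundary[_ [y [exy /negP]]].
  by apply; apply: sub; right; exists x.
have Z0 := W_pos (leq_ltn_trans (leq0n _) n0n).
rewrite forest_measure_pr //=; apply: (le_trans low).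
rewrite ler_pdivlMr //.
apply: (finite_volume_bound p e_sym e_irr e_lf e_deg (phi 0%N) m UG UW _ _ phiU DVi).
- by move=> A; apply: event_payoff_ge0.
- move=> A B AB; rewrite /event_payoff; congr (nat_of_bool _)%:R.
  have agree_AB (w w' : {fset {fset V}}) : (forall a, (a `<=` DV)%fset -> (a \in w) = (a \in w')) ->
      E (@config V e [set` w]) -> E (@config V e [set` w']).
    move=> ww'; apply: E_loc => a aD; rewrite /config.
    by apply: asbool_equiv_eq; rewrite /= (ww' _ aD).
  apply: asbool_equiv_eq; split; apply: agree_AB => // a aD.
  by rewrite AB.
Qed.

Lemma volume_converges :
  converges_weakly (fun n => forest_measure p (ECRSFs e (G n) (W n)))
    (algorithm_law p phi X Y).
Proof.
have mL : measurable_fun setT limit := limit_forest_measurable p input phi.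
pose L : {mfun T >-> Omega e} := mfun_Sub (mem_set mL).
(* This is [forest_measure] unfolded, so that its structure of probability measure is found. *)
pose mu n : probability (Omega e) R := mnormalize
    (msum (fun i => mscale (NngNum (forest_weight_ge0 p (nth fset0 (ECRSFs e (G n) (W n)) i)))
                           (dirac (@config V e [set` nth fset0 (ECRSFs e (G n) (W n)) i])))
          #|` ECRSFs e (G n) (W n)|)
    (dirac (@config V e set0)).
apply: (@weak_limit R V e mu (distribution P L)) => D E eps ED eps0.
exact: volume_lower ED eps0.
Qed.

End Volume.

Lemma free_converges :
  converges_weakly (fun n => free_measure p (G n)) (algorithm_law p phi X Y).
Proof.
rewrite (_ : (fun n => free_measure p (G n)) =
  (fun n => forest_measure p (ECRSFs e (G n) fset0))); last first.
  by apply/funext => n; rewrite /free_measure CRSFs_ECRSFs.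
apply: (@volume_converges (fun=> fset0)) => [n|n n0]; first exact: fsub0set.
(* The loop assumption at index 0 provides a cycle of positive weight in [G 1], hence in every [G n]
   with [0 < n]; at index 0 itself the normalizing constant may vanish. *)
have [alpha [beta [a0 _ lp]]] := loops; have [v vb] := boundary_neq0 0.
have [c [sc cG ac _]] := lp 0%N v vb.
apply: (free_weight_gt0 e_sym e_irr _ (exh_conn exh n) sc) => //.
  move=> x /cG[xG _ _]; exact: (fsubsetP (exhaustion_le exh n0)).
exact: lt_le_trans ac.
Qed.

Lemma wired_converges :
  converges_weakly (fun n => wired_measure p (G n)) (algorithm_law p phi X Y).
Proof.
apply: (@volume_converges (fun n => boundary e (G n))) => [n|n n0]; first exact: fsubset_refl.
have [v vb] := boundary_neq0 n.
apply: (wired_weight_gt0 p e_sym e_irr (exh_conn exh n)); exists v => //.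
by case/mem_boundary: vb.
Qed.

End Convergence.

Theorem theorem3p3p1 (R : realType) (V : countType) (e : rel V)
  (G : nat -> {fset V}) (p : cycle_weight R e) (phi : nat -> V)
  (d : measure_display) (T : measurableType d) (P : probability T R)
  (X : V -> nat -> T -> V) (Y : V -> nat -> {RV P >-> R}) :
  infinite_graph e ->
  exhaustion e G ->
  loop_assumption p G ->
  bijective phi ->
  algorithm_input e X Y ->
  converges_weakly (fun n => free_measure p (G n)) (algorithm_law p phi X Y) /\
  converges_weakly (fun n => wired_measure p (G n)) (algorithm_law p phi X Y).
Proof.
by move=> gr exh loops phi_bij input; split;
  [apply: free_converges|apply: wired_converges].
Qed.
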